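(* Suppose the following hold. (A1a) There is $k_0\ge1$ such that for every integer $i\ge1$, $\sup_{k\ge k_0}\sup_{x\in\overline{B}_i\cap V_k}\sum_{y\in V_k}\mathcal{C}^{(k)}(x,y)\big(\frac{\rho_k(x,y)}{k}\wedge1\big)^2m_k(y)<\infty$. (A2) (i) For any $\varepsilon>0$, $x\mapsto j(x,M\setminus B(x,\varepsilon))$ is locally integrable with respect to $m$; (ii) for all non-negative Borel $u,v$, $\int_Mu(x)(jv)(x)m(dx)=\int_M(ju)(x)v(x)m(dx)\ (\le\infty)$, where $ju(x):=\int_{M\setminus\{x\}}u(y)j(x,dy)$; (iii) for any compact $K\subset M$, $\sup_{x\in K}\int_M(\rho(x,y)\wedge1)^2j(x,dy)<\infty$. (A3) $\mathrm{Lip}_c(M)$ is dense in $(\mathcal{F},\mathcal{E}(\cdot,\cdot)+\|\cdot\|_2^2)$. (A4) (i) For any compact $K\subset M$, $$\lim_{\eta\to0}\limsup_{k\to\infty}\iint_{\{(x,y)\in K\times K:\rho(x,y)\le\eta\}}\rho(x,y)^2\mathcal{C}^{(k)}(x,y)m(dx)m(dy)=0,\qquad\lim_{i\to\infty}\limsup_{k\to\infty}\int_K\int_{B_i^c}\mathcal{C}^{(k)}(x,y)m(dx)m(dy)=0;$$ (ii) for every $\varepsilon>0$ there is $N>0$ such that for every $k\ge i\ge N$ and $f\in L^2(V_i;m_i)$, $\mathcal{E}^{(k)}(\pi_kE_if,\pi_kE_if)^{1/2}\le\mathcal{E}^{(i)}(f,f)^{1/2}+\varepsilon$; (iii) for any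 sufficiently small $\delta>0$ and large $i\in\mathbb{N}$, $\lim_{k\to\infty}\overline{\mathcal{E}}^{(k)}_{i,\delta}(f,f)=\mathcal{E}_{i,\delta}(f,f)$ for every $f\in\mathrm{Lip}_c(M)$. Then $(\mathcal{E}^{(k)},\mathcal{F}^{(k)})$ is Mosco convergent to $(\mathcal{E},\mathcal{F})$ in the generalized sense, that is: (a) if $v_k\in L^2(V_k;m_k)$, $u\in L^2(M;m)$ and $E_kv_k\to u$ weakly in $L^2(M;m)$, then $\liminf_{k\to\infty}\mathcal{E}^{(k)}(v_k,v_k)\ge\mathcal{E}(u,u)$; (b) for every $u\in L^2(M;m)$ there exist $u_k\in L^2(V_k;m_k)$ such that $E_ku_k\to u$ strongly in $L^2(M;m)$ and $\limsup_{k\to\infty}\mathcal{E}^{(k)}(u_k,u_k)\le\mathcal{E}(u,u)$.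
   Context: Space. $(M,\rho)$ is a locally compact separable connected metric space, $m$ is a Radon measure on $M$, $B(x,r)$ is the open ball, $V(x,r):=m(B(x,r))$, $\partial B(x,r):=\overline{B(x,r)}\setminus B(x,r)$; it is assumed that $V(x,r)\in(0,\infty)$ and $m(\partial B(x,r))=0$ for all $x\in M$, $r>0$, and: (MMS.1) $\overline{B(x,r)}$ is compact for all $x,r$; (MMS.2) $\rho$ is geodesic: for all $x,y\in M$ there is a continuous $\gamma:[0,\rho(x,y)]\to M$ with $\gamma(0)=x$, $\gamma(\rho(x,y))=y$, $\rho(\gamma(s),\gamma(t))=t-s$ for $0\le s\le t\le\rho(x,y)$; (MMS.3) there is $c_1>0$ with $V(x,2r)\le c_1V(x,r)$ for all $x,r$. Fix $x_0\in M$, $B_r:=B(x_0,r)$. Approximating graphs. For $k\in\mathbb{N}$, $(V_k,B_k)$ is a graph (vertices $V_k$, edges $B_k$) with graph distance $\rho_k$ and an associated partition $\{U_k(x):x\in V_k\}$ of $M$ into measurable sets, such that, with positive constants $C_1,\dots,C_5$ not depending on $k$ or the points: (AG.1) $(V_k,B_k)$ is connected and has uniformly bounded degree; (AG.2) $V_k\subset M$, $\bigcup_kV_k$ is dense in $M$, $\frac{C_1}{k}\rho_k(x,y)\le\rho(x,y)\le\frac{C_2}{k}\rho_k(x,y)$ for $x,y\in V_k$; (AG.3) $\bigcup_{x\in V_k}U_k(x)=M$, $m(U_k(x)\cap U_k(y))=0$ for $x\ne y$, $\sup\{\rho(\xi,\eta):\xi,\eta\in U_k(x)\}\le C_3/k$,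 and for each $x\in V_k$, $V_k\cap\mathrm{Int}\,U_k(x)=\{x\}$ and $C_4m(U_k(x))\le V(x,1/k)\le C_5m(U_k(x))$. Discrete forms. $m_k(A)=\sum_{y\in A}m(U_k(y))$ for $A\subset V_k$, $m_k(y):=m_k(\{y\})$. $\mathcal{C}^{(k)}(x,y)=\mathcal{C}^{(k)}(y,x)\ge0$, $x,y\in V_k$, are conductances (unrelated to $B_k$). $\mathcal{F}^{(k)}:=\{u\in L^2(V_k;m_k):\sum_{x,y\in V_k}(u(x)-u(y))^2\mathcal{C}^{(k)}(x,y)m_k(x)m_k(y)<\infty\}$, $\mathcal{E}^{(k)}(u,v):=\frac12\sum_{x,y\in V_k}(u(x)-u(y))(v(x)-v(y))\mathcal{C}^{(k)}(x,y)m_k(x)m_k(y)$, and $\mathcal{E}^{(k)}(u,u):=\infty$ for $u\in L^2(V_k;m_k)\setminus\mathcal{F}^{(k)}$. Limit form. $j$ is a kernel such that for $m$-a.e. $x\in M$, $j(x,\cdot)$ is a positive measure on $M\setminus\{x\}$; $J(dx,dy)=j(x,dy)m(dx)$ on $M\times M\setminus\widehat d$, $\widehat d$ the diagonal. $\mathcal{F}:=\{u\in L^2(M,m):\int_{M\times M\setminus\widehat d}(u(x)-u(y))^2J(dx,dy)<\infty\}$, $\mathcal{E}(u,v):=\frac12\int_{M\times M\setminus\widehat d}(u(x)-u(y))(v(x)-v(y))J(dx,dy)$, and $\mathcal{E}(u,u):=\infty$ for $u\in L^2(M;m)\setminus\mathcal{F}$. Operators. $\pi_kf(x)=\frac1{m_k(x)}\int_{U_k(x)}f\,dm$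 for $f\in L^2(M,m)$, $x\in V_k$; $E_kg(z)=g(x)$ for $g\in L^2(V_k,m_k)$ and $m$-a.e. $z\in U_k(x)$, $x\in V_k$. $\mathcal{C}^{(k)}$ is extended to $M\times M$ ($m\otimes m$-a.e.) by $\mathcal{C}^{(k)}(z,w)=\mathcal{C}^{(k)}(x,y)$ for $z\in U_k(x)$, $w\in U_k(y)$. For $f:M\to\mathbb{R}$, $$\overline{\mathcal{E}}^{(k)}_{i,\delta}(f,f):=\tfrac12\iint_{\{(z,w)\in B_i\times B_i:\rho(z,w)>\delta\}}(f(w)-f(z))^2\mathcal{C}^{(k)}(w,z)m(dw)m(dz),\quad\mathcal{E}_{i,\delta}(f,f):=\tfrac12\iint_{\{(z,w)\in B_i\times B_i:\rho(z,w)>\delta\}}(f(w)-f(z))^2J(dw,dz).$$ $\mathrm{Lip}_c(M)$ denotes the Lipschitz functions on $M$ with compact support. *)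

(* Defs.v *)
From HB Require Import structures.
From mathcomp Require Import all_boot all_order all_algebra.
From mathcomp Require Import all_classical all_reals all_analysis.
Set Implicit Arguments.
Unset Strict Implicit.
Unset Printing Implicit Defensive.
Import Order.TTheory GRing.Theory Num.Theory.
Import numFieldNormedType.Exports.
Local Open Scope classical_set_scope.
Local Open Scope ring_scope.

(* A metric space that also carries a sigma-algebra; [borel_sigma_algebra]
   says that the latter is generated by the open sets. *)
#[short(type="metricMeasurableType")]
HB.structure Definition MetricMeasurable (R : numDomainType) d :=
  {M of Metric R M & Measurable d M}.

Section Space.
Context (R : realType) (d : measure_display) (M : metricMeasurableType R d).
Local Open Scope ereal_scope.

Definition borel_sigma_algebra := @measurable d M = <<s (@open M) >>.

Definition separable := exists2 D : set M, countable D & dense D.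

Definition radon (m : {measure set M -> \bar R}) :=
  [/\ forall K, compact K -> m K < +oo,
      forall A, measurable A ->
        m A = ereal_inf [set m O | O in [set O | open O /\ A `<=` O]] &
      forall O, open O ->
        m O = ereal_sup [set m K | K in [set K | compact K /\ K `<=` O]]].

Definition geodesic := forall x y : M, exists g : R -> M,
  [/\ {within `[0%R, mdist x y], continuous g}, g 0%R = x, g (mdist x y) = y &
      forall s t, (0 <= s)%R -> (s <= t)%R -> (t <= mdist x y)%R ->
        mdist (g s) (g t) = (t - s)%R].

Definition volume_doubling (m : {measure set M -> \bar R}) :=
  exists2 c : R, (0 < c)%R & forall (x : M) (r : R), (0 < r)%R ->
    m (ball x (2 * r)) <= c%:E * m (ball x r).

Record metric_measure_space (m : {measure set M -> \bar R}) : Prop := {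
  mms_borel : borel_sigma_algebra;
  mms_locally_compact : locally_compact [set: M];
  mms_separable : separable;
  mms_connected : connected [set: M];
  mms_radon : radon m;
  mms_volume : forall (x : M) (r : R), (0 < r)%R -> 0 < m (ball x r) < +oo;
  mms_sphere : forall (x : M) (r : R), (0 < r)%R ->
    m (closure (ball x r) `\` ball x r) = 0;
  mms_compact_ball : forall (x : M) (r : R), (0 < r)%R ->
    compact (closure (ball x r));
  mms_geodesic : geodesic;
  mms_doubling : volume_doubling m
}.

End Space.

Section Graph.
Context (R : realType) (M : choiceType).

(* The least number of edges of a path from x to y; the infimum is attained
   as soon as x and y are connected. *)
Definition graph_dist (B : rel M) (x y : M) : R :=
  inf [set (size p)%:R | p in [set p | path B x p /\ last x p = y]].

Definition connected_graph (V : set M) (B : rel M) :=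
  forall x y, V x -> V y -> exists2 p, path B x p & last x p = y.

End Graph.

Section ApproximatingGraphs.
Context (R : realType) (d : measure_display) (M : metricMeasurableType R d).
Variable m : {measure set M -> \bar R}.
Local Open Scope ereal_scope.

(* V k, B k, U k : vertices, edges and cells of the k-th graph, for k >= 1;
   the value at k = 0 is irrelevant.  U k x matters only for x in V k. *)
Record approximating_graphs (V : nat -> set M) (B : nat -> rel M)
    (U : nat -> M -> set M) : Prop := {
  ag_sym : forall k, (0 < k)%N -> symmetric (B k);
  ag_edge : forall k x y, (0 < k)%N -> B k x y -> V k x /\ V k y;
  ag_cell : forall k x, (0 < k)%N -> V k x -> measurable (U k x);
  ag_connected : forall k, (0 < k)%N -> connected_graph (V k) (B k);
  ag_degree : exists D : nat, forall k x, (0 < k)%N -> V k x ->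
    ([set y | B k x y] #<= `I_D)%card;
  ag_dense : dense (\bigcup_(k in [set k | (0 < k)%N]) V k);
  ag_dist : exists C1 C2 : R, [/\ (0 < C1)%R, (0 < C2)%R &
    forall k x y, (0 < k)%N -> V k x -> V k y ->
      (C1 / k%:R * graph_dist R (B k) x y <= mdist x y
       <= C2 / k%:R * graph_dist R (B k) x y)%R];
  ag_cover : forall k, (0 < k)%N -> \bigcup_(x in V k) U k x = setT;
  ag_disjoint : forall k x y, (0 < k)%N -> V k x -> V k y -> x <> y ->
    m (U k x `&` U k y) = 0;
  ag_diam : exists2 C3 : R, (0 < C3)%R &
    forall k x, (0 < k)%N -> V k x ->
      forall xi eta, U k x xi -> U k x eta -> (mdist xi eta <= C3 / k%:R)%R;
  ag_interior : forall k x, (0 < k)%N -> V k x -> V k `&` (U k x)° = [set x];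
  ag_cell_volume : exists C4 C5 : R, [/\ (0 < C4)%R, (0 < C5)%R &
    forall k x, (0 < k)%N -> V k x ->
      C4%:E * m (U k x) <= m (ball x k%:R^-1) <= C5%:E * m (U k x)]
}.

End ApproximatingGraphs.

(* One level of the approximation: vertices V, cells U, conductances c.
   Functions on V are represented by functions on M, of which only the values
   on V are used. *)
Section Level.
Context (R : realType) (d : measure_display) (M : metricMeasurableType R d).
Variables (m : {measure set M -> \bar R}) (V : set M) (U : M -> set M).
Local Open Scope ereal_scope.

Definition L2V : set (M -> R) :=
  [set u | \esum_(x in V) (((u x) ^+ 2)%:E * m (U x)) < +oo].

Definition discrete_sum (c : M -> M -> R) (u : M -> R) : \bar R :=
  \esum_(x in V) \esum_(y in V)
    (((u x - u y) ^+ 2 * c x y)%:E * m (U x) * m (U y)).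

Definition discrete_domain (c : M -> M -> R) : set (M -> R) :=
  [set u | L2V u /\ discrete_sum c u < +oo].

(* u |-> E^(k)(u, u) *)
Definition discrete_energy (c : M -> M -> R) (u : M -> R) : \bar R :=
  if `[< discrete_domain c u >] then 2^-1%:E * discrete_sum c u else +oo.

Definition average (f : M -> R) (x : M) : R :=
  ((fine (m (U x)))^-1 * \int[m]_(z in U x) f z)%R.

(* The points of U x that lie in no other cell: the cells overlap in null sets,
   so that core x has full measure in U x.  At points lying in several cells
   the extensions below are 0. *)
Definition core (x : M) : set M := U x `\` \bigcup_(y in V `\ x) U y.

Definition extend (g : M -> R) (z : M) : R :=
  (\sum_(x \in V) g x * \1_(core x) z)%R.

Definition extend2 (c : M -> M -> R) (z w : M) : R :=
  (\sum_(x \in V) \sum_(y \in V) c x y * \1_(core x) z * \1_(core y) w)%R.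

End Level.

Section Forms.
Context (R : realType) (d : measure_display) (M : metricMeasurableType R d).
Variable m : {measure set M -> \bar R}.
Local Open Scope ereal_scope.

Definition L2 : set (M -> R) := [set u | u \in Lfun m 2%:E].

Definition L2norm (u : M -> R) : \bar R := 'N[m]_2%:E[EFin \o u].

Definition Lipc : set (M -> R) :=
  [set f | (exists L : R, forall x y, (`|f x - f y| <= L * mdist x y)%R) /\
           compact (closure [set x | f x != 0%R])].

(* A measure on M \ {x} is represented by a measure on M without mass at x. *)
Definition jump_kernel (j : R.-ker M ~> M) :=
  {ae m, forall x, j x [set x] = 0}.

Variable j : R.-ker M ~> M.

(* The integral of (u x - u y)^2 off the diagonal w.r.t. J(dx,dy) = j(x,dy)m(dx) *)
Definition jump_integral (u : M -> R) : \bar R :=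
  \int[m]_x \int[j x]_(y in [set~ x]) ((u x - u y) ^+ 2)%:E.

Definition domain : set (M -> R) := [set u | L2 u /\ jump_integral u < +oo].

(* u |-> E(u, u) *)
Definition energy (u : M -> R) : \bar R :=
  if `[< domain u >] then 2^-1%:E * jump_integral u else +oo.

(* The two truncated forms are over {(z, w) in A x A : rho(z, w) > delta}. *)
Definition truncated_discrete_energy (c : M -> M -> R) (A : set M) (delta : R)
    (f : M -> R) : \bar R :=
  2^-1%:E * \int[m]_(z in A) \int[m]_(w in A `&` [set w | (delta < mdist z w)%R])
    ((f w - f z) ^+ 2 * c w z)%:E.

Definition truncated_energy (A : set M) (delta : R) (f : M -> R) : \bar R :=
  2^-1%:E * \int[m]_(w in A) \int[j w]_(z in A `&` [set z | (delta < mdist z w)%R])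
    ((f w - f z) ^+ 2)%:E.

Definition kernel_apply (u : M -> R) (x : M) : \bar R :=
  \int[j x]_(y in [set~ x]) (u y)%:E.

Definition weak_cvg (f : nat -> M -> R) (u : M -> R) :=
  forall phi, L2 phi ->
    \int[m]_x (f k x * phi x)%:E @[k --> \oo] --> \int[m]_x (u x * phi x)%:E.

Definition strong_cvg (f : nat -> M -> R) (u : M -> R) :=
  L2norm (f k \- u)%R @[k --> \oo] --> 0.

End Forms.

Section Assumptions.
Context (R : realType) (d : measure_display) (M : metricMeasurableType R d).
Variables (m : {measure set M -> \bar R}) (x0 : M).
Variables (V : nat -> set M) (B : nat -> rel M) (U : nat -> M -> set M).
Variables (C : nat -> M -> M -> R) (j : R.-ker M ~> M).
Local Open Scope ereal_scope.

Let Br (i : nat) : set M := ball x0 (i%:R : R).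
Let Cbar (k : nat) : M -> M -> R := extend2 (V k) (U k) (C k).

Definition conductances := forall k x y, (0 < k)%N -> V k x -> V k y ->
  C k x y = C k y x /\ (0 <= C k x y)%R.

Definition A1a := exists2 k0 : nat, (1 <= k0)%N & forall i : nat, (1 <= i)%N ->
  ereal_sup [set ereal_sup
    [set \esum_(y in V k)
           ((C k x y * Num.min (graph_dist R (B k) x y / k%:R) 1 ^+ 2)%R%:E
              * m (U k y)) | x in closure (Br i) `&` V k]
    | k in [set k | (k0 <= k)%N]] < +oo.

Definition A2i := forall eps : R, (0 < eps)%R -> forall K : set M, compact K ->
  m.-integrable K (fun x => j x (~` ball x eps)).

Definition A2ii := forall u v : M -> R,
  measurable_fun setT u -> measurable_fun setT v ->
  (forall x, (0 <= u x)%R) -> (forall x, (0 <= v x)%R) ->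
  \int[m]_x ((u x)%:E * kernel_apply j v x) =
  \int[m]_x (kernel_apply j u x * (v x)%:E).

Definition A2iii := forall K : set M, compact K ->
  ereal_sup [set \int[j x]_y ((Num.min (mdist x y) 1 ^+ 2)%R)%:E | x in K] < +oo.

Definition A3 := @Lipc R d M `<=` domain m j /\
  forall u, domain m j u -> forall eps : R, (0 < eps)%R -> exists2 f, Lipc f &
    energy m j (f \- u)%R + L2norm m (f \- u)%R ^+ 2 < eps%:E.

Definition A4i_near := forall K : set M, compact K ->
  limn_esup (fun k =>
    \int[m]_(y in K) \int[m]_(x in K `&` [set x | (mdist x y <= eta)%R])
      (mdist x y ^+ 2 * Cbar k x y)%:E) @[eta --> (0%R : R)^'+] --> 0.

Definition A4i_far := forall K : set M, compact K ->
  limn_esup (fun k =>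
    \int[m]_(y in K) \int[m]_(x in ~` Br i) (Cbar k x y)%:E) @[i --> \oo] --> 0.

Definition A4ii := forall eps : R, (0 < eps)%R -> exists2 N : nat, (0 < N)%N &
  forall k i : nat, (N <= i)%N -> (i <= k)%N -> forall f, L2V m (V i) (U i) f ->
    discrete_energy m (V k) (U k) (C k)
      (average m (U k) (extend (V i) (U i) f)) `^ 2^-1 <=
    discrete_energy m (V i) (U i) (C i) f `^ 2^-1 + eps%:E.

Definition A4iii := exists2 delta0 : R, (0 < delta0)%R & exists i0 : nat,
  forall (delta : R) (i : nat), (0 < delta < delta0)%R -> (i0 <= i)%N ->
  forall f, Lipc f ->
    truncated_discrete_energy m (Cbar k) (Br i) delta f @[k --> \oo]
      --> truncated_energy m j (Br i) delta f.

Definition mosco_convergent :=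
  (forall (v : nat -> M -> R) (u : M -> R),
     (forall k, (0 < k)%N -> L2V m (V k) (U k) (v k)) -> L2 m u ->
     weak_cvg m (fun k => extend (V k) (U k) (v k)) u ->
     energy m j u <=
       limn_einf (fun k => discrete_energy m (V k) (U k) (C k) (v k))) /\
  (forall u, L2 m u -> exists v : nat -> M -> R,
     [/\ forall k, (0 < k)%N -> L2V m (V k) (U k) (v k),
         strong_cvg m (fun k => extend (V k) (U k) (v k)) u &
         limn_esup (fun k => discrete_energy m (V k) (U k) (C k) (v k))
           <= energy m j u]).

End Assumptions.

(* Main.v *)
(* Truncate the limit form to pairs in B_I x B_I at distance more than delta.  By (A2.iii) and
   the symmetry (A2.ii) the truncated form Q is bounded on L^2, and it increases to the jump
   integral as I grows and delta decreases.  By (A1a) the truncated discrete forms are bounded on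
   L^2 uniformly in k, so (A4.iii) and the density of Lip_c in L^2 let one pass to the limit
   along strongly convergent sequences.

   Lower bound.  For fixed i apply this to pi_k E_i v_i, which tends strongly to E_i v_i as k
   grows: by (A4.ii), Q(E_i v_i)/2 <= (E^(i)(v_i, v_i)^(1/2) + eps)^2.  Then let i grow: Q is
   weakly lower semicontinuous, since for f in Lip_c close to u in L^2 the difference
   Q(v) - Q(v - f) is affine in v, represented by a function of L^2.

   Recovery sequence.  By (A3) and a diagonal argument it suffices to take u in Lip_c and
   v_k = pi_k u.  Split the discrete energy into pairs far from x0, controlled by (A4.i), pairs
   of B_I at distance more than delta, controlled by (A4.iii), and close pairs.  For the latter
   one has |pi_k u(x) - pi_k u(y)| <= L d(z, w) + O(1/k) on U_k(x) x U_k(y), and the error is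
   absorbed because the mean of d(z, .)^2 over U_k(y) is at least a multiple of k^(-2): a ball
   of radius e/k around z fills at most half of U_k(y), by reverse volume doubling. *)

From HB Require Import structures.
Require Import Defs.
From mathcomp Require Import all_boot all_order all_algebra.
From mathcomp Require Import all_classical all_reals all_analysis.
From mathcomp Require Import measurable_realfun.
From mathcomp Require Import ring lra.
Set Implicit Arguments.
Unset Strict Implicit.
Unset Printing Implicit Defensive.
Import Order.TTheory GRing.Theory Num.Theory.
Import numFieldNormedType.Exports.
Local Open Scope classical_set_scope.
Local Open Scope ring_scope.

(** * Measurability in separable metric spaces *)

(** Little is known of [j]: the measure [j x] may be infinite near x, and (A2.ii) speaks only of
    products u(x) v(y) with the diagonal removed. Measurability and symmetry are therefore
    established on truncations, by writing {d > r} as a countable union of rectangles with disjoint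
    sides; what concerns the full off-diagonal is a monotone limit.

    Energies are extended reals, so forms are not compared through a triangle inequality for square
    roots but by (a + b)^2 <= (1 + t) a^2 + (1 + 1/t) b^2: [t] is fixed close to 0 first, and the
    L^2 error is then made small against 1/t. Most constants below arise in this way.

    The detour through pi_k E_i v_i is forced: (A4.iii) concerns fixed Lipschitz functions and
    extends to strongly convergent sequences, whereas E_k v_k converges only weakly.

    Geodesics enter through reverse doubling: the point they provide at an intermediate distance
    from z keeps a neighbouring cell from concentrating near z, and so gives the bound of order
    k^(-2) on its second moment. *)

Lemma countable_enumeration (T : Type) (A : set T) : countable A ->
  A = set0 \/ exists e : nat -> T, A = range e.
Proof. by move=> /pfcard_geP[->|[e]]; [left|right; exists e; rewrite image_eq]. Qed.

Section MetricSpace.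
Context (R : realType) (d : measure_display) (M : metricMeasurableType R d).
Implicit Types (x y z : M) (r : R).

Lemma open_far x r : open [set y : M | r < mdist x y].
Proof.
rewrite openE => y /= ry; apply/nbhs_ballP; exists (mdist x y - r) => /=.
  by rewrite subr_gt0.
move=> z; rewrite ballEmdist /= => yz.
have := metric_triangle x z y; rewrite (metric_sym z y); lra.
Qed.

Lemma open_mball x r : open (ball x r : set M).
Proof.
rewrite openE => y; rewrite /= ballEmdist /= => ry; apply/nbhs_ballP.
exists (r - mdist x y) => /=; first by rewrite subr_gt0.
move=> z; rewrite ballEmdist /= => yz.
have := metric_triangle x y z; lra.
Qed.

Hypothesis borelM : borel_sigma_algebra M.

Lemma open_measurableM (A : set M) : open A -> measurable A.
Proof. by move=> oA; rewrite borelM; exact: sub_sigma_algebra. Qed.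

Lemma closed_measurableM (A : set M) : closed A -> measurable A.
Proof.
by move=> cA; rewrite -(setCK A); apply/measurableC/open_measurableM; rewrite openC.
Qed.

Lemma measurable_mball x r : measurable (ball x r : set M).
Proof. exact/open_measurableM/open_mball. Qed.

Lemma compact_measurableM (A : set M) : compact A -> measurable A.
Proof.
move=> cA; apply: closed_measurableM; apply: compact_closed cA.
exact: metric_hausdorff.
Qed.

Lemma measurable_set1M x : measurable [set x].
Proof. by apply: compact_measurableM; exact: compact_set1. Qed.

Lemma lipschitz_measurable (f : M -> R) (L : R) :
  (forall x y, `|f x - f y| <= L * mdist x y) -> measurable_fun setT f.
Proof.
move=> fL; apply: (measurability _ (RGenOInfty.measurableE R)) => //.
move=> _ [_ [a ->] <-]; rewrite setTI; apply: open_measurableM.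
rewrite openE => x /=; rewrite in_itv /= andbT => ax.
apply/nbhs_ballP; exists ((f x - a) / (`|L| + 1)) => /=.
  by rewrite divr_gt0// ?subr_gt0// ltr_wpDl.
move=> y; rewrite ballEmdist /= in_itv /= andbT ltr_pdivlMr; last first.
  by rewrite ltr_wpDl.
move=> xy; have := fL x y; have := ler_norm (f x - f y).
have := mdist_ge0 x y; have := ler_norm L; nra.
Qed.

Hypothesis sepM : separable M.

Lemma dense_seq x : exists p : nat -> M,
  forall y r, 0 < r -> exists n, mdist y (p n) < r.
Proof.
have [D cD dD] := sepM.
have dense_ball y r : 0 < r -> exists2 z, D z & mdist y z < r.
  move=> r0; have [|z [yz Dz]] := dD (ball y r) _ (open_mball _ _).
    by exists y; exact: ballxx.
  by exists z => //; move: yz; rewrite ballEmdist.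
have [D0|[p DE]] := countable_enumeration cD.
  by have [z] := dense_ball x 1 ltr01; rewrite D0.
exists p => y r /(dense_ball y)[z]; rewrite DE => -[n _ <-]; by exists n.
Qed.

(** For d(y, z) > r take 1/(k+1) below half of the excess d(y, z) - r and a dense point p_i within
    1/(k+1) of y; then d(p_i, z) still exceeds r + 1/(k+1). The rectangles serve twice: they make
    the far set measurable for the product sigma-algebra, and they are the sets on which (A2.ii) can
    be tested. *)
Lemma far_rectangles (x : M) (r : R) : exists A B : nat -> set M,
  [/\ forall n, measurable (A n), forall n, measurable (B n) &
      [set p : M * M | r < mdist p.1 p.2] = \bigcup_n (A n `*` B n)].
Proof.
have [p pd] := dense_seq x.
pose A n : set M := if unpickle n is Some (i, k) then ball (p i) k.+1%:R^-1 else set0.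
pose B n : set M := if unpickle n is Some (i, k)
  then [set y | r + k.+1%:R^-1 < mdist (p i) y] else set0.
exists A, B; split.
- move=> n; rewrite /A; case: unpickle => [[i k]|]; last exact: measurable0.
  exact: measurable_mball.
- move=> n; rewrite /B; case: unpickle => [[i k]|]; last exact: measurable0.
  exact/open_measurableM/open_far.
apply/seteqP; split => -[y z] /=.
  move=> ryz.
  have e0 : 0 < (mdist y z - r) / 2 by rewrite divr_gt0// subr_gt0.
  have /ltr_add_invr[k] := e0; rewrite add0r => k0.
  have [i yi] := pd y k.+1%:R^-1 ltac:(by rewrite invr_gt0).
  exists (pickle (i, k)) => //; rewrite /A /B pickleK /= ballEmdist /=.
  rewrite metric_sym; split => //; move: yi k0; set e := _^-1 => yi k0.
  have := metric_triangle y (p i) z; lra.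
move=> [n _]; rewrite /A /B; case: unpickle => [[i k]|[]//] /=.
rewrite ballEmdist /=; set e := _^-1 => -[iy iz].
have := metric_triangle (p i) y z; lra.
Qed.

Lemma measurable_far (x : M) (r : R) :
  measurable [set p : M * M | r < mdist p.1 p.2].
Proof.
have [A [B [mA mB ->]]] := far_rectangles x r.
by apply: bigcupT_measurable => n; exact: measurableX.
Qed.

Lemma measurable_mdist (x : M) :
  measurable_fun setT (fun p : M * M => mdist p.1 p.2 : R).
Proof.
apply: (measurability _ (RGenOInfty.measurableE R)) => //.
move=> _ [_ [a ->] <-]; rewrite setTI.
rewrite [X in measurable X](_ : _ = [set p : M * M | a < mdist p.1 p.2]).
  exact: measurable_far.
by apply/seteqP; split => p /=; rewrite in_itv /= andbT.
Qed.

Lemma measurable_mdist1 (x : M) : measurable_fun setT (fun y => mdist x y : R).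
Proof.
by apply: (measurable_fun_pair2 (f := fun p : M * M => mdist p.1 p.2)); exact: measurable_mdist.
Qed.

End MetricSpace.

(** * Symmetry of the jump measure *)

Lemma integral_setI_mul_indic d (T : measurableType d) (R : realType)
    (mu : {measure set T -> \bar R}) (S D : set T) (v : T -> R) :
  (\int[mu]_(y in S `&` D) (v y)%:E = \int[mu]_(y in S) (v y * \1_D y)%:E)%E.
Proof.
rewrite integral_mkcondr; apply: eq_integral => y _.
by rewrite patchE indicE; case: ifPn => _; rewrite ?mulr1 ?mulr0.
Qed.

Section RectangleUnions.
Context (R : realType) (d : measure_display) (M : metricMeasurableType R d).
Variable j : R.-ker M ~> M.
Local Open Scope ereal_scope.

(** Section at [x] of the union of the first [N] rectangles with sides [C n] and [D n]. *)
Definition slice (C D : nat -> set M) (N : nat) (x : M) : set M :=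
  \bigcup_(n in [set n | (n < N)%N /\ C n x]) D n.

Definition slice_int (C D : nat -> set M) (N : nat) (v : M -> R) (x : M) :=
  \int[j x]_(y in slice C D N x) (v y)%:E.

Lemma measurable_slice (C D : nat -> set M) N x : (forall n, measurable (D n)) ->
  measurable (slice C D N x).
Proof. by move=> mD; exact: bigcup_measurable. Qed.

Lemma slice0 C D x : slice C D 0 x = set0.
Proof. by apply/seteqP; split => // y [n []]. Qed.

Lemma slice_in (C D : nat -> set M) N x : C N x -> slice C D N.+1 x = D N `|` slice C D N x.
Proof.
move=> CNx; apply/seteqP; split => y.
  move=> [n [/= + Cn] Dn]; rewrite ltnS leq_eqVlt => /predU1P[<-|nN]; first by left.
  by right; exists n.
by move=> [DN|[n [/= nN Cn] Dn]]; [exists N|exists n => //=; split => //; exact: ltnW].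
Qed.

Lemma slice_notin (C D : nat -> set M) N x : ~ C N x -> slice C D N.+1 x = slice C D N x.
Proof.
move=> CNx; apply/seteqP; split => y.
  move=> [n [/= + Cn] Dn]; rewrite ltnS leq_eqVlt => /predU1P[nN|nN]; last by exists n.
  by move: CNx; rewrite -nN.
by move=> [n [/= nN Cn] Dn]; exists n => //=; split => //; exact: ltnW.
Qed.

Lemma slice_int_ge0 (C D : nat -> set M) N (v : M -> R) x : (forall y, (0 <= v y)%R) ->
  0 <= slice_int C D N v x.
Proof. by move=> v0; apply: integral_ge0 => y _; rewrite lee_fin. Qed.

(** The rectangle of index [N] is split off. Over its first side the integral on [D N] is taken out,
    and the factor killing [v] on [D N] prevents points of earlier rectangles from being counted
    twice; elsewhere the slice does not change. *)
Lemma slice_intS (C D : nat -> set M) N (v : M -> R) x :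
  (forall n, measurable (D n)) ->
  measurable_fun setT v -> (forall y, (0 <= v y)%R) ->
  slice_int C D N.+1 v x =
    (\1_(C N) x)%:E * \int[j x]_(y in D N) (v y)%:E
    + (\1_(C N) x)%:E * slice_int C D N (fun y => v y * \1_(~` D N) y)%R x
    + (\1_(~` C N) x)%:E * slice_int C D N v x.
Proof.
move=> mD mv v0; rewrite /slice_int !indicE in_setC.
have [/set_mem CNx|/negP CNx] := boolP (x \in C N); last first.
  rewrite slice_notin; last by move=> /mem_set.
  by rewrite /= !mul0e mul1e !add0e.
rewrite slice_in//= !mul1e mul0e adde0 -integral_setI_mul_indic -setDE.
rewrite (_ : D N `|` slice C D N x = D N `|` (slice C D N x `\` D N)); last first.
  apply/seteqP; split => y; last by move=> [Dy|[Dy _]]; [left|right].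
  by move=> [Dy|Sy]; [left|have [Dy|Dy] := pselect (D N y); [left|right]].
have mS : measurable (slice C D N x `\` D N).
  by apply: measurableD => //; exact: measurable_slice.
rewrite ge0_integral_setU//.
- by apply/measurable_EFinP; exact: measurable_funTS.
- by move=> y _; rewrite lee_fin.
- by apply/eqP/seteqP; split => // y [Dy [_]].
Qed.

Lemma measurable_int_kernel (E : set M) (v : M -> R) : measurable E ->
  measurable_fun setT v -> (forall y, (0 <= v y)%R) ->
  measurable_fun setT (fun x => \int[j x]_(y in E) (v y)%:E).
Proof.
move=> mE mv v0.
rewrite [X in measurable_fun _ X](_ : _ =
    (fun x => \int[j x]_y (v y * \1_E y)%:E)).
  apply: measurable_fun_integral_kernel.
  - by move=> U mU; exact: measurable_kernel.
  - by move=> z; rewrite lee_fin mulr_ge0.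
  - apply/measurable_EFinP; exact: measurable_funM.
by apply/funext => x; rewrite -integral_setI_mul_indic setTI.
Qed.

(** Induction on [N] for all [v] at once, since the recursion also applies to the restriction of [v]
    off [D N]. Only integrals of a fixed function over a fixed set occur, so [j x] may be
    infinite. *)
Lemma measurable_slice_int (C D : nat -> set M) N (v : M -> R) :
  (forall n, measurable (C n)) -> (forall n, measurable (D n)) ->
  measurable_fun setT v -> (forall y, (0 <= v y)%R) ->
  measurable_fun setT (slice_int C D N v).
Proof.
move=> mC mD; elim: N v => [|N IH] v mv v0.
  rewrite (_ : slice_int _ _ _ _ = cst 0); first exact: measurable_cst.
  by apply/funext => x; rewrite /slice_int slice0 integral_set0.
have m1 (E : set M) : measurable E -> measurable_fun setT (fun x => (\1_E x : R)%:E).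
  by move=> mE; apply/measurable_EFinP; exact: measurable_indic.
rewrite (funext (fun x => slice_intS C N x mD mv v0)).
have mDC := measurableC (mD N).
have mCC := measurableC (mC N).
apply: emeasurable_funD; first apply: emeasurable_funD.
- by apply: emeasurable_funM; [exact: m1|exact: measurable_int_kernel].
- apply: emeasurable_funM; [exact: m1|apply: IH].
    by apply: measurable_funM => //; exact: measurable_indic.
  by move=> y; rewrite mulr_ge0.
- by apply: emeasurable_funM; [exact: m1|exact: IH].
Qed.

Section Symmetry.
Variable m : {measure set M -> \bar R}.
Hypothesis symj : A2ii m j.

Lemma slice_int_split (C D : nat -> set M) N (E : set M) (v : M -> R) x :
  (forall n, measurable (D n)) -> measurable E ->
  measurable_fun setT v -> (forall y, (0 <= v y)%R) ->
  slice_int C D N v x = slice_int C D N (fun y => v y * \1_E y)%R x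
                      + slice_int C D N (fun y => v y * \1_(~` E) y)%R x.
Proof.
move=> mD mE mv v0; rewrite /slice_int -ge0_integralD//=.
- apply: eq_integral => y _; rewrite -EFinD -mulrDr !indicE in_setC.
  by case: (y \in E); rewrite /= ?addr0 ?add0r mulr1.
- exact: measurable_slice.
- by move=> y _; rewrite lee_fin mulr_ge0.
- apply/measurable_EFinP; apply: measurable_funTS; exact: measurable_funM.
- by move=> y _; rewrite lee_fin mulr_ge0.
- apply/measurable_EFinP; apply: measurable_funTS; apply: measurable_funM => //;
  exact/measurable_indic/measurableC.
Qed.

(* (A2.ii) gives the symmetry of J on products of disjoint sets.  The last rectangle is removed
   at each step, by multiplying u and v with the indicators of its sides, so that the
   rectangles need not be disjoint from each other. *)
Lemma slice_int_sym (C D : nat -> set M) N (u v : M -> R) :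
  (forall n, measurable (C n)) -> (forall n, measurable (D n)) ->
  (forall n, C n `&` D n = set0) ->
  measurable_fun setT u -> measurable_fun setT v ->
  (forall x, (0 <= u x)%R) -> (forall x, (0 <= v x)%R) ->
  \int[m]_x ((u x)%:E * slice_int C D N v x) =
  \int[m]_x ((v x)%:E * slice_int D C N u x).
Proof.
move=> mC mD CD; elim: N u v => [|N IH] u v mu mv u0 v0.
  by rewrite !integral0_eq// => x _; rewrite /slice_int slice0 integral_set0 mule0.
have mM (E : set M) (w : M -> R) : measurable E -> measurable_fun setT w ->
    measurable_fun setT (fun x => w x * \1_E x)%R.
  by move=> mE mw; apply: measurable_funM => //; exact: measurable_indic.
have M0 (E : set M) (w : M -> R) : (forall x, (0 <= w x)%R) ->
    forall x, (0 <= w x * \1_E x)%R.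
  by move=> w0 x; rewrite mulr_ge0.
have p0 (E : set M) (w w' : M -> R) C' D' n x : (forall x, (0 <= w x)%R) ->
    (forall x, (0 <= w' x)%R) -> 0 <= (w x * \1_E x)%:E * slice_int C' D' n w' x.
  by move=> w0 w'0; apply: mule_ge0; [rewrite lee_fin; exact: M0|exact: slice_int_ge0].
have mDC := measurableC (mD N).
have mCC := measurableC (mC N).
have expand (C' D' : nat -> set M) (u' v' : M -> R) :
    (forall n, measurable (C' n)) -> (forall n, measurable (D' n)) ->
    measurable_fun setT u' -> measurable_fun setT v' ->
    (forall x, (0 <= u' x)%R) -> (forall x, (0 <= v' x)%R) ->
    \int[m]_x ((u' x)%:E * slice_int C' D' N.+1 v' x) =
    \int[m]_x ((u' x * \1_(C' N) x)%:E * \int[j x]_(y in D' N) (v' y)%:E)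
    + \int[m]_x ((u' x * \1_(C' N) x)%:E *
        slice_int C' D' N (fun y => v' y * \1_(~` D' N) y)%R x)
    + \int[m]_x ((u' x * \1_(~` C' N) x)%:E * slice_int C' D' N v' x).
  move=> mC' mD' mu' mv' u'0 v'0.
  have mD'C := measurableC (mD' N).
  have mC'C := measurableC (mC' N).
  have i0 x : 0 <= \int[j x]_(y in D' N) (v' y)%:E.
    by apply: integral_ge0 => y _; rewrite lee_fin.
  have me (E : set M) f : measurable E -> measurable_fun setT f ->
      measurable_fun setT (fun x => (u' x * \1_E x)%:E * f x).
    by move=> mE mf; apply: emeasurable_funM => //; apply/measurable_EFinP; exact: mM.
  rewrite -!ge0_integralD//.
  - apply: eq_integral => x _; rewrite slice_intS// !EFinM -!muleA.
    have h1 : 0 <= (\1_(C' N) x)%:E * \int[j x]_(y in D' N) (v' y)%:E.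
      by rewrite mule_ge0 ?lee_fin.
    have h2 : 0 <= (\1_(C' N) x)%:E *
        slice_int C' D' N (fun y => v' y * \1_(~` D' N) y)%R x.
      by rewrite mule_ge0 ?lee_fin//; apply: slice_int_ge0; exact: M0.
    have h3 : 0 <= (\1_(~` C' N) x)%:E * slice_int C' D' N v' x.
      by rewrite mule_ge0 ?lee_fin//; exact: slice_int_ge0.
    by rewrite ge0_muleDr ?adde_ge0// ge0_muleDr.
  - move=> x _; apply: adde_ge0; apply: mule_ge0 => //; rewrite ?lee_fin; try exact: M0.
    by apply: slice_int_ge0; exact: M0.
  - apply: emeasurable_funD; apply: me => //; first exact: measurable_int_kernel.
    by apply: measurable_slice_int => //; [exact: mM|exact: M0].
  - by move=> x _; apply: p0 => //; exact: M0.
  - by apply: me => //; exact: measurable_slice_int.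
  - by move=> x _; rewrite mule_ge0 ?lee_fin//; exact: M0.
  - by apply: me => //; exact: measurable_int_kernel.
  - by move=> x _; apply: p0 => //; exact: M0.
  - apply: me => //.
    by apply: measurable_slice_int => //; [exact: mM|exact: M0].
(* [C N] and [D N] are disjoint: for x in one side, the integral over the other avoids x. Removing
   the diagonal thus changes nothing, and (A2.ii) applies to [u] restricted to [C N] and [v]
   restricted to [D N]. *)
have rect : \int[m]_x ((u x * \1_(C N) x)%:E * \int[j x]_(y in D N) (v y)%:E) =
            \int[m]_x ((v x * \1_(D N) x)%:E * \int[j x]_(y in C N) (u y)%:E).
  have part (E F : set M) (w w' : M -> R) x : E `&` F = set0 ->
      (w x * \1_E x)%:E * \int[j x]_(y in F) (w' y)%:E =
      (w x * \1_E x)%:E * \int[j x]_(y in [set~ x]) (w' y * \1_F y)%:E.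
    move=> EF; have [/set_mem Ex|xE] := boolP (x \in E); last first.
      by rewrite indicE (negbTE xE) mulr0 !mul0e.
    rewrite -integral_setI_mul_indic; congr (_ * integral _ _ _).
    apply/seteqP; split => y //=; last by case.
    move=> Fy; split => // yx; have : (E `&` F) x by split => //; rewrite -yx.
    by rewrite EF.
  under eq_integral do rewrite part//.
  rewrite symj//; try exact: mM; try exact: M0.
  apply: eq_integral => x _; rewrite muleC [RHS]part// setIC//.
rewrite (expand C D u v mC mD mu mv u0 v0) (expand D C v u mD mC mv mu v0 u0) rect.
have congr_add (a b c b' c' : \bar R) : b + c = b' + c' -> a + b + c = a + b' + c'.
  by rewrite -!addeA => ->.
apply: congr_add.
(* The induction hypothesis turns both remaining terms on the left into integrals against [v].
   Splitting [v] along [D N] in the second one yields the first remaining term on the right; the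
   other piece, which carries [u] off [C N], merges with the term carrying [u] on [C N]. *)
have -> : \int[m]_x ((u x * \1_(C N) x)%:E *
      slice_int C D N (fun y => v y * \1_(~` D N) y)%R x) =
    \int[m]_x ((v x * \1_(~` D N) x)%:E *
      slice_int D C N (fun y => u y * \1_(C N) y)%R x).
  by apply: IH; [exact: mM|exact: mM|exact: M0|exact: M0].
have -> : \int[m]_x ((u x * \1_(~` C N) x)%:E * slice_int C D N v x) =
    \int[m]_x ((v x)%:E * slice_int D C N (fun y => u y * \1_(~` C N) y)%R x).
  by apply: IH; [exact: mM|exact: mv|exact: M0|exact: v0].
have me (E : set M) (w w': M -> R) : measurable E -> measurable_fun setT w ->
    measurable_fun setT w' -> (forall y, (0 <= w' y)%R) ->
    measurable_fun setT (fun x => (w x * \1_E x)%:E * slice_int D C N w' x).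
  move=> mE mw mw' w'0; apply: emeasurable_funM.
    by apply/measurable_EFinP; exact: mM.
  exact: measurable_slice_int.
have -> : \int[m]_x ((v x)%:E * slice_int D C N (fun y => u y * \1_(~` C N) y)%R x)
  = \int[m]_x ((v x * \1_(D N) x)%:E * slice_int D C N (fun y => u y * \1_(~` C N) y)%R x)
  + \int[m]_x ((v x * \1_(~` D N) x)%:E * slice_int D C N (fun y => u y * \1_(~` C N) y)%R x).
  rewrite -ge0_integralD//.
  - apply: eq_integral => x _; rewrite !indicE in_setC.
    by case: (x \in D N); rewrite /= mulr1 mulr0 mul0e ?adde0 ?add0e.
  - by move=> x _; apply: p0 => //; exact: M0.
  - by apply: me => //; [exact: mM|exact: M0].
  - by move=> x _; apply: p0 => //; exact: M0.
  - by apply: me => //; [exact: mM|exact: M0].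
have congr_addCA (a b c e : \bar R) : a + c = e -> a + (b + c) = b + e.
  by rewrite addeCA => ->.
apply: congr_addCA.
rewrite -ge0_integralD//.
- apply: eq_integral => x _; rewrite -ge0_muleDr; try by apply: slice_int_ge0; exact: M0.
  by rewrite -slice_int_split.
- by move=> x _; apply: p0 => //; exact: M0.
- by apply: me => //; [exact: mM|exact: M0].
- by move=> x _; apply: p0 => //; exact: M0.
- by apply: me => //; [exact: mM|exact: M0].
Qed.

End Symmetry.
End RectangleUnions.

Lemma integral_monotone_cvg d (T : measurableType d) (R : realType)
    (mu : {measure set T -> \bar R}) (g : nat -> T -> \bar R) (f : T -> \bar R) :
  (forall n, measurable_fun setT (g n)) -> (forall n x, (0 <= g n x)%E) ->
  (forall x, nondecreasing_seq (g^~ x)) -> (forall x, g n x @[n --> \oo] --> f x) ->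
  (\int[mu]_x g n x)%E @[n --> \oo] --> (\int[mu]_x f x)%E.
Proof.
move=> mg g0 ndg gf.
have -> : (\int[mu]_x f x = \int[mu]_x limn (g^~ x))%E.
  by apply: eq_integral => x _; apply/esym/cvg_lim => //; exact: gf.
by apply: cvg_monotone_convergence => // x _; exact: ndg.
Qed.

Lemma ge0_integral_mrestr d (T : measurableType d) (R : realType)
    (mu : {measure set T -> \bar R}) (D : set T) (mD : measurable D)
    (f : T -> \bar R) : measurable_fun setT f -> (forall x, (0 <= f x)%E) ->
  (\int[mrestr mu mD]_x f x = \int[mu]_(x in D) f x)%E.
Proof.
move=> mf f0; have mDC := measurableC mD.
rewrite (@ge0_negligible_integral _ _ _ (mrestr mu mD) setT (~` D))//; last first.
  by change (mu (~` D `&` D) = 0%E); rewrite setICl measure0.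
rewrite setTD setCK; apply: eq_measure_integral => B mB BD.
by change (mu (B `&` D) = mu B); rewrite (setIidl BD).
Qed.

(** * The jump kernel truncated away from the diagonal *)

Section TruncatedKernel.
Context (R : realType) (d : measure_display) (M : metricMeasurableType R d).
Variable j : R.-ker M ~> M.
Hypotheses (borelM : borel_sigma_algebra M) (sepM : separable M).
Variables (A : set M) (r : R).
Hypotheses (mA : measurable A) (r0 : 0 <= r).
Local Open Scope ereal_scope.

Definition trunc_set (x : M) : set M := [set y | [/\ A x, A y & (r < mdist x y)%R]].

(** A rectangle inside {d > r} with r >= 0 has disjoint sides because d(x, x) = 0, as
    [slice_int_sym] demands. The truncated set is symmetric, so exchanging the two families of sides
    describes the same sections. *)
Lemma trunc_set_slices : exists C D : nat -> set M,
  [/\ forall n, measurable (C n), forall n, measurable (D n),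
      forall n, C n `&` D n = set0,
      forall x, trunc_set x = \bigcup_N slice C D N x &
      forall x, trunc_set x = \bigcup_N slice D C N x].
Proof.
have [A0|/set0P[x0 Ax0]] := eqVneq A set0.
  exists (fun=> set0), (fun=> set0); split => //.
  - by move=> n; rewrite set0I.
  - by move=> x; apply/seteqP; split => y; [rewrite /trunc_set A0 => -[]|move=> [N _ [n]]].
  - by move=> x; apply/seteqP; split => y; [rewrite /trunc_set A0 => -[]|move=> [N _ [n]]].
have [C [D [mC mD CD]]] := far_rectangles borelM sepM x0 r.
have far x y : (r < mdist x y)%R <-> exists n, C n x /\ D n y.
  rewrite -/([set p : M * M | (r < mdist p.1 p.2)%R] (x, y)) CD; split.
    by move=> [n _ [/= ? ?]]; exists n.
  by move=> [n [? ?]]; exists n.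
exists (fun n => C n `&` A), (fun n => D n `&` A); split.
- by move=> n; exact: measurableI.
- by move=> n; exact: measurableI.
- move=> n; apply/seteqP; split => // x [[Cx _] [Dx _]].
  have : (r < mdist x x)%R by apply/far; exists n.
  by rewrite mdistxx ltNge r0.
- move=> x; apply/seteqP; split => y.
    move=> [Ax Ay /far[n [Cx Dy]]]; exists n.+1 => //; exists n => //=.
  move=> [N _ [n [/= _ [Cx Ax]] [Dy Ay]]]; split => //; apply/far.
  by exists n.
- move=> x; apply/seteqP; split => y.
    move=> [Ax Ay]; rewrite metric_sym => /far[n [Cx Dy]].
    by exists n.+1 => //; exists n => //=.
  move=> [N _ [n [/= _ [Cx Ax]] [Dy Ay]]]; split => //; rewrite metric_sym.
  by apply/far; exists n.
Qed.

Lemma measurable_trunc_set x : measurable (trunc_set x).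
Proof.
have [C [D [mC mD _ -> _]]] := trunc_set_slices.
by apply: bigcupT_measurable => n; exact: measurable_slice.
Qed.

Lemma slice_nondecreasing (C D : nat -> set M) x :
  nondecreasing_seq (fun N => slice C D N x).
Proof.
move=> n k nk; rewrite subsetEset => y [i [/= ni Ci] Di].
by exists i => //=; split => //; exact: leq_trans nk.
Qed.

Lemma slice_int_cvg (C D : nat -> set M) (v : M -> R) x :
  (forall n, measurable (D n)) ->
  measurable_fun setT v -> (forall y, (0 <= v y)%R) ->
  slice_int j C D N v x @[N --> \oo] -->
  \int[j x]_(y in \bigcup_N slice C D N x) (v y)%:E.
Proof.
move=> mD mv v0; apply: ge0_nondecreasing_set_cvg_integral.
- exact: slice_nondecreasing.
- by move=> i; exact: measurable_slice.
- by move=> i; apply/measurable_EFinP; exact: measurable_funTS.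
- by move=> i y _; rewrite lee_fin.
Qed.

Lemma slice_int_nondecreasing (C D : nat -> set M) (v : M -> R) x :
  (forall n, measurable (D n)) ->
  measurable_fun setT v -> (forall y, (0 <= v y)%R) ->
  nondecreasing_seq (fun N => slice_int j C D N v x).
Proof.
move=> mD mv v0; apply: ge0_nondecreasing_set_nondecreasing_integral.
- exact: slice_nondecreasing.
- by move=> i; exact: measurable_slice.
- by move=> i; apply/measurable_EFinP; exact: measurable_funTS.
- by move=> i y _; rewrite lee_fin.
Qed.

Lemma measurable_trunc_int1 (v : M -> R) :
  measurable_fun setT v -> (forall y, (0 <= v y)%R) ->
  measurable_fun setT (fun x => \int[j x]_(y in trunc_set x) (v y)%:E).
Proof.
move=> mv v0; have [C [D [mC mD _ CD _]]] := trunc_set_slices.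
apply: (@emeasurable_fun_cvg _ _ _ _ (fun N => slice_int j C D N v)).
  by move=> N; exact: measurable_slice_int.
by move=> x _; rewrite CD; exact: slice_int_cvg.
Qed.

(** The symmetry for the first [N] rectangles passes to their union by monotone convergence on both
    sides. *)
Lemma trunc_int_sym (m : {measure set M -> \bar R}) (u v : M -> R) :
  A2ii m j ->
  measurable_fun setT u -> measurable_fun setT v ->
  (forall x, (0 <= u x)%R) -> (forall x, (0 <= v x)%R) ->
  \int[m]_x ((u x)%:E * \int[j x]_(y in trunc_set x) (v y)%:E) =
  \int[m]_x ((v x)%:E * \int[j x]_(y in trunc_set x) (u y)%:E).
Proof.
move=> symj mu mv u0 v0; have [C [D [mC mD CD CDt DCt]]] := trunc_set_slices.
have main (C' D' : nat -> set M) (u' v' : M -> R) :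
    (forall n, measurable (C' n)) -> (forall n, measurable (D' n)) ->
    (forall x, trunc_set x = \bigcup_N slice C' D' N x) ->
    measurable_fun setT u' -> measurable_fun setT v' ->
    (forall x, (0 <= u' x)%R) -> (forall x, (0 <= v' x)%R) ->
    \int[m]_x ((u' x)%:E * slice_int j C' D' N v' x) @[N --> \oo] -->
    \int[m]_x ((u' x)%:E * \int[j x]_(y in trunc_set x) (v' y)%:E).
  move=> mC' mD' t mu' mv' u'0 v'0; apply: integral_monotone_cvg.
  - move=> n; apply: emeasurable_funM; first exact/measurable_EFinP.
    exact: measurable_slice_int.
  - by move=> n x; rewrite mule_ge0 ?lee_fin//; exact: slice_int_ge0.
  - move=> x n k nk; rewrite lee_wpmul2l ?lee_fin//.
    exact: slice_int_nondecreasing.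
  - by move=> x; apply: cvgeZl => //; rewrite t; exact: slice_int_cvg.
have := main C D u v mC mD CDt mu mv u0 v0.
under eq_fun do rewrite (slice_int_sym symj)//.
move=> /cvg_unique; apply => //.
exact: main D C v u mD mC DCt mv mu v0 u0.
Qed.

Variable Lam : R.
Hypothesis jLam : forall x, A x -> j x (trunc_set x) <= Lam%:E.

(* Fubini-type measurability is available for finite kernels only, whereas j x may have
   infinite mass near x. *)
Let trunc (x : M) : {measure set M -> \bar R} := mrestr (j x) (measurable_trunc_set x).

Let measurable_trunc (E : set M) : measurable E -> measurable_fun setT (trunc ^~ E).
Proof.
move=> mE; rewrite [X in measurable_fun _ X](_ : _ =
    fun x => \int[j x]_(y in trunc_set x) (\1_E y)%:E).
  by apply: measurable_trunc_int1 => // y; rewrite lee_fin.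
by apply/funext => x; rewrite integral_indic//; exact: measurable_trunc_set.
Qed.

HB.instance Definition _ := isKernel.Build _ _ M M R trunc measurable_trunc.

Let trunc_uub : measure_fam_uub trunc.
Proof.
exists (`|Lam| + 1)%R => x.
change (j x (setT `&` trunc_set x) < (`|Lam| + 1)%:E); rewrite setTI.
have [Ax|Ax] := pselect (A x).
  by rewrite (le_lt_trans (jLam Ax))// lte_fin (le_lt_trans (ler_norm _))// ltrDl.
rewrite (_ : trunc_set x = set0) ?measure0 ?lte_fin ?ltr_wpDl//.
by apply/seteqP; split => y // [].
Qed.

HB.instance Definition _ := Kernel_isFinite.Build _ _ M M R trunc trunc_uub.

Lemma measurable_trunc_int (h : M * M -> \bar R) :
  measurable_fun setT h -> (forall p, 0 <= h p) ->
  measurable_fun setT (fun x => \int[j x]_(y in trunc_set x) h (x, y)).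
Proof.
move=> mh h0; rewrite [X in measurable_fun _ X](_ : _ =
    fun x => \int[trunc x]_y h (x, y)).
  exact: (measurable_fun_integral_finite_kernel h trunc).
apply/funext => x; rewrite ge0_integral_mrestr//.
by apply: measurableT_comp => //; exact: pair1_measurable.
Qed.

End TruncatedKernel.

Section RealIntegrands.
Context (d : measure_display) (T : measurableType d) (R : realType).
Variable mu : {measure set T -> \bar R}.
Implicit Types (f g : T -> R).
Local Open Scope ereal_scope.

Lemma integral_EFin_cst (D : set T) (c : R) : measurable D ->
  \int[mu]_(x in D) c%:E = c%:E * mu D.
Proof. by move=> mD; rewrite -integral_cst. Qed.

Lemma ge0_integralD_EFin f g : measurable_fun setT f -> measurable_fun setT g ->
  (forall x, (0 <= f x)%R) -> (forall x, (0 <= g x)%R) ->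
  \int[mu]_x (f x + g x)%:E = \int[mu]_x (f x)%:E + \int[mu]_x (g x)%:E.
Proof.
move=> mf mg f0 g0; rewrite -ge0_integralD => //.
- by move=> x _; rewrite lee_fin.
- exact/measurable_EFinP.
- by move=> x _; rewrite lee_fin.
- exact/measurable_EFinP.
Qed.

Lemma ge0_integralZ_EFin (c : R) f : measurable_fun setT f ->
  (0 <= c)%R -> (forall x, (0 <= f x)%R) ->
  \int[mu]_x (c * f x)%:E = c%:E * \int[mu]_x (f x)%:E.
Proof.
move=> mf c0 f0; rewrite -ge0_integralZl => //.
- exact/measurable_EFinP.
- by move=> x _; rewrite lee_fin.
Qed.

Lemma ge0_le_integral_EFin f g : measurable_fun setT f -> measurable_fun setT g ->
  (forall x, (0 <= f x)%R) -> (forall x, (f x <= g x)%R) ->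
  \int[mu]_x (f x)%:E <= \int[mu]_x (g x)%:E.
Proof.
move=> mf mg f0 fg; apply: ge0_le_integral => //.
- by move=> x _; rewrite lee_fin.
- exact/measurable_EFinP.
- exact/measurable_EFinP.
- by move=> x _; rewrite lee_fin.
Qed.

Lemma ge0_integral_EFin f : (forall x, (0 <= f x)%R) -> 0 <= \int[mu]_x (f x)%:E.
Proof. by move=> f0; apply: integral_ge0 => x _; rewrite lee_fin. Qed.

End RealIntegrands.

(** * Quadratic forms on pairs with bounded marginals *)

Section PairForm.
Context (d : measure_display) (T : measurableType d) (R : realType).
Variable m : {measure set T -> \bar R}.
Local Open Scope ereal_scope.

Definition sqint (f : T -> R) : \bar R := \int[m]_x ((f x) ^+ 2)%:E.

Lemma sqint_ge0 f : 0 <= sqint f.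
Proof. by apply: integral_ge0 => x _; rewrite lee_fin sqr_ge0. Qed.

Lemma sqintBC (f g : T -> R) : sqint (fun x => f x - g x)%R = sqint (fun x => g x - f x)%R.
Proof. by apply: eq_integral => x _; rewrite -sqrrN opprB. Qed.

(* Common to the truncations of J(dx, dy) and of C^(k)(x, y) m(dx) m(dy): a symmetric measure
   on pairs whose marginals are at most Lam m. *)
Record pair_form (I : (T * T -> R) -> \bar R) (Lam : R) : Prop := {
  pair_form_ge0 : forall h : T * T -> R, (forall p, (0 <= h p)%R) -> 0 <= I h;
  pair_formD : forall h k : T * T -> R, measurable_fun setT h -> measurable_fun setT k ->
    (forall p, (0 <= h p)%R) -> (forall p, (0 <= k p)%R) ->
    I (fun p => h p + k p)%R = I h + I k;
  pair_formZ : forall (c : R) (h : T * T -> R), (0 <= c)%R -> measurable_fun setT h ->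
    (forall p, (0 <= h p)%R) -> I (fun p => c * h p)%R = c%:E * I h;
  pair_form_le : forall h k : T * T -> R, measurable_fun setT h -> measurable_fun setT k ->
    (forall p, (0 <= h p)%R) -> (forall p, (h p <= k p)%R) -> I h <= I k;
  pair_form_fst : forall u : T -> R, measurable_fun setT u ->
    (forall x, (0 <= u x)%R) -> I (fun p => u p.1) <= Lam%:E * \int[m]_x (u x)%:E;
  pair_form_snd : forall u : T -> R, measurable_fun setT u ->
    (forall x, (0 <= u x)%R) -> I (fun p => u p.2) <= Lam%:E * \int[m]_x (u x)%:E
}.

Definition quad (I : (T * T -> R) -> \bar R) (f : T -> R) : \bar R :=
  I (fun p => (f p.1 - f p.2) ^+ 2)%R.

Lemma measurable_fst_comp (f : T -> R) : measurable_fun setT f ->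
  measurable_fun setT (fun p : T * T => f p.1).
Proof. by move=> mf; exact: (measurableT_comp mf). Qed.

Lemma measurable_snd_comp (f : T -> R) : measurable_fun setT f ->
  measurable_fun setT (fun p : T * T => f p.2).
Proof. by move=> mf; exact: (measurableT_comp mf). Qed.

Lemma measurable_sqr_diff (f : T -> R) : measurable_fun setT f ->
  measurable_fun setT (fun p : T * T => (f p.1 - f p.2) ^+ 2)%R.
Proof.
move=> mf; apply: measurable_funX; apply: measurable_funB.
  exact: measurable_fst_comp.
exact: measurable_snd_comp.
Qed.

(** The right side minus the left is (t a - b)^2 / t. *)
Lemma sqr_add_young (t a b : R) : (0 < t)%R ->
  ((a + b) ^+ 2 <= (1 + t) * a ^+ 2 + (1 + t^-1) * b ^+ 2)%R.
Proof.
move=> t0; have t1 : (t * t^-1 = 1)%R by rewrite divff// gt_eqF.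
have : (0 <= t^-1 * (t * a - b) ^+ 2)%R.
  by rewrite mulr_ge0 ?sqr_ge0// invr_ge0 ltW.
have -> : (t^-1 * (t * a - b) ^+ 2 =
  t * t^-1 * t * a ^+ 2 - 2 * (t * t^-1) * a * b + t^-1 * b ^+ 2)%R by ring.
rewrite t1; nra.
Qed.

Variables (I : (T * T -> R) -> \bar R) (Lam : R).
Hypotheses (Lam0 : (0 <= Lam)%R) (HI : pair_form I Lam).

Lemma quad_ge0 f : 0 <= quad I f.
Proof. by apply: (pair_form_ge0 HI) => p; exact: sqr_ge0. Qed.

(** (a - b)^2 <= 2 (a^2 + b^2), and each of the two marginals contributes [Lam]: hence the 4. *)
Lemma quad_bound (f : T -> R) : measurable_fun setT f -> quad I f <= (4 * Lam)%:E * sqint f.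
Proof.
move=> mf; have mf2 : measurable_fun setT (fun x => f x ^+ 2)%R by exact: measurable_funX.
have m1 := measurable_fst_comp mf2; have m2 := measurable_snd_comp mf2.
apply: (@le_trans _ _ (I (fun p => 2 * (f p.1 ^+ 2 + f p.2 ^+ 2))%R)).
  apply: (pair_form_le HI).
  - exact: measurable_sqr_diff.
  - by apply: measurable_funM => //; exact: measurable_funD.
  - by move=> p; exact: sqr_ge0.
  - by move=> p; have := sqr_ge0 (f p.1 + f p.2)%R; rewrite !sqrrD sqrrN; nra.
rewrite (pair_formZ HI)//; last 2 first.
- exact: measurable_funD.
- by move=> p; rewrite addr_ge0 ?sqr_ge0.
rewrite (pair_formD HI)//; try by move=> p; exact: sqr_ge0.
rewrite (_ : (4 * Lam)%R = 2 * (Lam + Lam))%R; last by ring.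
rewrite EFinM -muleA lee_pmul2l// EFinD ge0_muleDl ?lee_fin// leeD//.
  by apply: (pair_form_fst HI) => // x; exact: sqr_ge0.
by apply: (pair_form_snd HI) => // x; exact: sqr_ge0.
Qed.

Lemma quad_young (t : R) (f g : T -> R) : (0 < t)%R -> measurable_fun setT f ->
  measurable_fun setT g ->
  quad I (fun x => f x + g x)%R <= (1 + t)%:E * quad I f + (1 + t^-1)%:E * quad I g.
Proof.
move=> t0 mf mg; have t1 : (0 <= 1 + t)%R by rewrite addr_ge0// ltW.
have t2 : (0 <= 1 + t^-1)%R by rewrite addr_ge0// invr_ge0 ltW.
have mf2 := measurable_sqr_diff mf; have mg2 := measurable_sqr_diff mg.
rewrite -!(pair_formZ HI)//; try by move=> p; exact: sqr_ge0.
rewrite -(pair_formD HI)//; last 4 first.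
- exact: measurable_funM.
- exact: measurable_funM.
- by move=> p; rewrite mulr_ge0 ?sqr_ge0.
- by move=> p; rewrite mulr_ge0 ?sqr_ge0.
apply: (pair_form_le HI).
- by apply: (measurable_sqr_diff (f := fun x => f x + g x)%R); exact: measurable_funD.
- by apply: measurable_funD; exact: measurable_funM.
- by move=> p; exact: sqr_ge0.
- move=> p; rewrite (_ : f p.1 + g p.1 - _ = (f p.1 - f p.2) + (g p.1 - g p.2))%R.
    exact: sqr_add_young.
  by ring.
Qed.

(** The substitute for continuity of a seminorm: with [t] fixed near 0, the form at [f] is
    controlled by the form at [g] as soon as the L^2 distance is small against the constant in
    1/t. *)
Lemma quad_perturb (t : R) (f g : T -> R) : (0 < t)%R -> measurable_fun setT f ->
  measurable_fun setT g ->
  quad I f <= (1 + t)%:E * quad I g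
            + ((1 + t^-1) * (4 * Lam))%:E * sqint (fun x => f x - g x)%R.
Proof.
move=> t0 mf mg; have mfg : measurable_fun setT (fun x => f x - g x)%R.
  exact: measurable_funB.
rewrite (_ : quad I f = quad I (fun x => g x + (f x - g x))%R); last first.
  by congr (quad I); apply/funext => x; ring.
apply: (le_trans (quad_young t0 mg mfg)).
rewrite leeD2l// EFinM -muleA lee_wpmul2l//; last exact: quad_bound.
by rewrite lee_fin addr_ge0// invr_ge0 ltW.
Qed.

End PairForm.

Lemma sqint_young (d : measure_display) (T : measurableType d) (R : realType)
    (m : {measure set T -> \bar R}) (f g : T -> R) :
  measurable_fun setT f -> measurable_fun setT g ->
  (sqint m (fun x => f x + g x)%R <= 2%:E * sqint m f + 2%:E * sqint m g)%E.
Proof.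
move=> mf mg; rewrite /sqint -!ge0_integralZl//=; last 4 first.
- by apply/measurable_EFinP; exact: measurable_funX.
- by move=> x _; rewrite lee_fin sqr_ge0.
- by apply/measurable_EFinP; exact: measurable_funX.
- by move=> x _; rewrite lee_fin sqr_ge0.
rewrite -ge0_integralD//=; last 4 first.
- by move=> x _; rewrite -EFinM lee_fin mulr_ge0 ?sqr_ge0.
- by apply: measurable_funeM; apply/measurable_EFinP; exact: measurable_funX.
- by move=> x _; rewrite -EFinM lee_fin mulr_ge0 ?sqr_ge0.
- by apply: measurable_funeM; apply/measurable_EFinP; exact: measurable_funX.
apply: ge0_le_integral => //.
- by move=> x _; rewrite lee_fin sqr_ge0.
- by apply/measurable_EFinP; apply: measurable_funX; exact: measurable_funD.
- by apply: emeasurable_funD; apply: measurable_funeM; apply/measurable_EFinP;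
    exact: measurable_funX.
- move=> x _; rewrite -!EFinM -EFinD lee_fin.
  by have := sqr_ge0 (f x - g x); nra.
Qed.

Definition square_integrable (d : measure_display) (T : measurableType d) (R : realType)
    (m : {measure set T -> \bar R}) (f : T -> R) :=
  measurable_fun setT f /\ (sqint m f < +oo)%E.

(** * Truncated jump forms *)

Section JumpForm.
Context (R : realType) (d : measure_display) (M : metricMeasurableType R d).
Variables (m : {measure set M -> \bar R}) (j : R.-ker M ~> M).
Hypotheses (borelM : borel_sigma_algebra M) (sepM : separable M).
Variables (A : set M) (r Lam : R).
Hypotheses (mA : measurable A) (r0 : 0 <= r) (Lam0 : 0 <= Lam).
Local Open Scope ereal_scope.
Hypothesis jLam : forall x, A x -> j x (trunc_set A r x) <= Lam%:E.
Hypothesis symj : A2ii m j.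

Definition jump_form (h : M * M -> R) : \bar R :=
  \int[m]_x \int[j x]_(y in trunc_set A r x) (h (x, y))%:E.

Let mts x : measurable (trunc_set A r x).
Proof. exact: measurable_trunc_set. Qed.

Let mint (h : M * M -> R) : measurable_fun setT h -> (forall p, (0 <= h p)%R) ->
  measurable_fun setT (fun x => \int[j x]_(y in trunc_set A r x) (h (x, y))%:E).
Proof.
move=> mh h0.
apply: (measurable_trunc_int borelM sepM mA r0 jLam (h := fun p => (h p)%:E)).
  exact/measurable_EFinP.
by move=> p; rewrite lee_fin.
Qed.

Let msec (h : M * M -> R) x : measurable_fun setT h ->
  measurable_fun (trunc_set A r x) (fun y => (h (x, y))%:E).
Proof.
move=> mh; apply: measurable_funTS; apply/measurable_EFinP.
exact: measurable_fun_pair2.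
Qed.

Let int0 (h : M * M -> R) x : (forall p, (0 <= h p)%R) ->
  0 <= \int[j x]_(y in trunc_set A r x) (h (x, y))%:E.
Proof. by move=> h0; apply: integral_ge0 => y _; rewrite lee_fin. Qed.

Lemma trunc_mass_le x : j x (trunc_set A r x) <= (Lam * \1_A x)%:E.
Proof.
rewrite indicE; have [/set_mem Ax|/negP Ax] := boolP (x \in A).
  by rewrite mulr1; exact: jLam.
rewrite mulr0 (_ : trunc_set A r x = set0) ?measure0//.
by apply/seteqP; split => y // [] /mem_set.
Qed.

Let trunc_mass_le' x : j x (trunc_set A r x) <= Lam%:E.
Proof.
by rewrite (le_trans (trunc_mass_le x))// lee_fin ler_piMr// indicE lern1 leq_b1.
Qed.

Lemma jump_form_pair_form : pair_form m jump_form Lam.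
Proof.
split.
- by move=> h h0; apply: integral_ge0 => x _; exact: int0.
- move=> h k mh mk h0 k0; rewrite /jump_form -ge0_integralD//; last 4 first.
  - by move=> x _; exact: int0.
  - exact: mint.
  - by move=> x _; exact: int0.
  - exact: mint.
  apply: eq_integral => x _; rewrite -ge0_integralD//.
  - by move=> y _; rewrite lee_fin.
  - exact: msec.
  - by move=> y _; rewrite lee_fin.
  - exact: msec.
- move=> c h c0 mh h0; rewrite /jump_form -ge0_integralZl//; last 2 first.
  - exact: mint.
  - by move=> x _; exact: int0.
  apply: eq_integral => x _; rewrite -ge0_integralZl//.
  - exact: msec.
  - by move=> y _; rewrite lee_fin.
- move=> h k mh mk h0 hk; have k0 p : (0 <= k p)%R by exact: le_trans (hk p).
  apply: ge0_le_integral => //.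
  - by move=> x _; exact: int0.
  - exact: mint.
  - exact: mint.
  - move=> x _; apply: ge0_le_integral => //.
    - by move=> y _; rewrite lee_fin.
    - exact: msec.
    - exact: msec.
    - by move=> y _; rewrite lee_fin.
- move=> u mu u0; rewrite /jump_form -ge0_integralZl//; last 2 first.
  - exact/measurable_EFinP.
  - by move=> x _; rewrite lee_fin.
  - apply: ge0_le_integral => //.
    - by move=> x _; apply: integral_ge0 => y _; rewrite lee_fin.
    - by apply: (mint (h := fun p => u p.1)) => //; exact: measurable_fst_comp.
    - by apply: measurable_funeM; exact/measurable_EFinP.
    - by move=> x _; rewrite /= integral_EFin_cst// muleC lee_wpmul2r ?lee_fin.
- move=> u mu u0; rewrite /jump_form -ge0_integralZl//; last 2 first.
  - exact/measurable_EFinP.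
  - by move=> x _; rewrite lee_fin.
  have m1 : measurable_fun setT (fun x => \int[j x]_(y in trunc_set A r x) (1%R : R)%:E).
    exact: (mint (h := fun=> 1%R)).
  (* The second marginal is turned into the first by symmetry, tested on [u] and the constant 1. *)
  have -> : \int[m]_x \int[j x]_(y in trunc_set A r x) (u y)%:E =
      \int[m]_x ((u x)%:E * \int[j x]_(y in trunc_set A r x) (1%R : R)%:E).
    rewrite -(trunc_int_sym borelM sepM mA r0 symj (measurable_cst (1%R : R)) mu
      (fun=> ler01) u0).
    by apply: eq_integral => x _; rewrite mul1e.
  apply: ge0_le_integral => //.
  - move=> x _; apply: mule_ge0; first by rewrite lee_fin.
    by apply: integral_ge0 => y _; rewrite lee_fin.
  - by apply: emeasurable_funM => //; exact/measurable_EFinP.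
  - by apply: measurable_funeM; exact/measurable_EFinP.
  - by move=> x _; rewrite muleC lee_wpmul2r ?lee_fin// integral_EFin_cst// mul1e.
Qed.

Lemma truncated_energyE (f : M -> R) :
  truncated_energy m j A r f = 2^-1%:E * quad jump_form f.
Proof.
congr (_ * _); rewrite integral_mkcond; apply: eq_integral => x _.
rewrite patchE; have [/set_mem Ax|/negP Ax] := boolP (x \in A); last first.
  by rewrite integral0_eq// => y [] /mem_set.
congr (integral _ _ _); apply/seteqP; split => y /=.
  by rewrite metric_sym => -[].
by rewrite metric_sym => -[].
Qed.

(** * Polarization and the generator of the truncated energy *)

Section Polarization.
Hypothesis mAoo : m A < +oo.
Variables (g : M -> R) (G : R).
Hypotheses (mg : measurable_fun setT g) (g0 : forall x, (0 <= g x)%R)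
  (gG : forall x, (g x <= G)%R).

Let alpha (x : M) : R := (g x * fine (j x (trunc_set A r x)))%R.
Let beta (x : M) : R := fine (\int[j x]_(y in trunc_set A r x) (g y)%:E).

Let G0 : (0 <= G)%R. Proof. exact: le_trans (g0 point) (gG point). Qed.

Let mass_fin x : j x (trunc_set A r x) \is a fin_num.
Proof. by rewrite ge0_fin_numE// (le_lt_trans (trunc_mass_le' x)) ?ltry. Qed.

Let Kg_le x : \int[j x]_(y in trunc_set A r x) (g y)%:E <= (G * Lam * \1_A x)%:E.
Proof.
apply: (@le_trans _ _ (\int[j x]_(y in trunc_set A r x) G%:E)).
  apply: ge0_le_integral => //.
  - by move=> y _; rewrite lee_fin.
  - by apply: measurable_funTS; exact/measurable_EFinP.
  - by move=> y _; rewrite lee_fin.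
rewrite integral_EFin_cst// -mulrA EFinM lee_wpmul2l ?lee_fin//.
exact: trunc_mass_le.
Qed.

Let Kg_fin x : \int[j x]_(y in trunc_set A r x) (g y)%:E \is a fin_num.
Proof.
rewrite ge0_fin_numE; first by rewrite (le_lt_trans (Kg_le x)) ?ltry.
by apply: integral_ge0 => y _; rewrite lee_fin.
Qed.

Let alpha_ge0 x : (0 <= alpha x)%R.
Proof. by rewrite mulr_ge0// fine_ge0. Qed.

Let beta_ge0 x : (0 <= beta x)%R.
Proof. by rewrite fine_ge0//; apply: integral_ge0 => y _; rewrite lee_fin. Qed.

Let alpha_le x : (alpha x <= G * Lam * \1_A x)%R.
Proof.
rewrite -mulrA ler_pM ?fine_ge0// -lee_fin fineK//; exact: trunc_mass_le.
Qed.

Let beta_le x : (beta x <= G * Lam * \1_A x)%R.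
Proof. by rewrite -lee_fin fineK. Qed.

Let malpha : measurable_fun setT alpha.
Proof.
apply: measurable_funM => //; apply: measurableT_comp => //.
rewrite (_ : (fun x => _) = (fun x => \int[j x]_(y in trunc_set A r x) (1%R : R)%:E)).
  exact: (mint (h := fun=> 1%R)).
by apply/funext => x; rewrite integral_EFin_cst// mul1e.
Qed.

Let mbeta : measurable_fun setT beta.
Proof.
apply: measurableT_comp => //; apply: (mint (h := fun p => g p.2)) => //.
exact: measurable_snd_comp.
Qed.

(** The integral of g(x) - g(y) against j(x, dy) over the truncated set, that is, minus the
    generator of the truncated energy at [g]. It is bounded and vanishes off [A], which has finite
    measure, so it can serve as a test function for weak convergence. *)
Definition gradient (x : M) : R := (alpha x - beta x)%R.

Lemma measurable_gradient : measurable_fun setT gradient.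
Proof. exact: measurable_funB. Qed.

Lemma gradient_le x : (`|gradient x| <= G * Lam * \1_A x)%R.
Proof.
have := alpha_ge0 x; have := beta_ge0 x; have := alpha_le x; have := beta_le x.
by rewrite /gradient ler_norml => *; apply/andP; split; lra.
Qed.

Let finite_int (c u : M -> R) : measurable_fun setT c -> measurable_fun setT u ->
  (forall x, (0 <= c x)%R) -> (forall x, (c x <= G * Lam * \1_A x)%R) ->
  (forall x, (0 <= u x)%R) ->
  sqint m u < +oo -> \int[m]_x (c x * u x)%:E < +oo.
Proof.
move=> mc mu c0 cle u0 uoo.
(* On [A] the factor [c] is at most G Lam and u <= 1 + u^2; off [A] it vanishes. *)
apply: (@le_lt_trans _ _ ((G * Lam)%:E * (m A + sqint m u))); last first.
  by rewrite lte_mul_pinfty ?lee_fin ?mulr_ge0// lte_add_pinfty.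
rewrite (_ : m A = \int[m]_x (\1_A x)%:E); last first.
  by rewrite integral_indic// setIT.
have mu2 : measurable_fun setT (fun x => u x ^+ 2)%R by exact: measurable_funX.
have mA1 : measurable_fun setT (\1_A : M -> R) by exact: measurable_indic.
have GL0 : (0 <= G * Lam)%R by rewrite mulr_ge0.
rewrite -ge0_integralD_EFin//; last by move=> x; exact: sqr_ge0.
rewrite -ge0_integralZ_EFin//; last 2 first.
- exact: measurable_funD.
- by move=> x; rewrite addr_ge0 ?sqr_ge0.
apply: ge0_le_integral_EFin.
- exact: measurable_funM.
- by apply: measurable_funM => //; exact: measurable_funD.
- by move=> x; rewrite mulr_ge0.
- move=> x.
  have := cle x; have := c0 x; have := u0 x; rewrite indicE.
  case: (x \in A) => /= ux cx clex; last by have := sqr_ge0 (u x); nra.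
  have ux2 : (u x <= 1 + u x ^+ 2)%R by nra.
  nra.
Qed.

Section Pairings.
Variable w : M -> R.
Hypotheses (mw : measurable_fun setT w) (w0 : forall x, (0 <= w x)%R).

Let mgw : measurable_fun setT (fun x => g x * w x)%R.
Proof. exact: measurable_funM. Qed.

Let gw0 x : (0 <= g x * w x)%R. Proof. by rewrite mulr_ge0. Qed.

(** The four pairings of [g] and [w] over the two coordinates: with [w] at the first coordinate they
    are computed directly, with [w] at the second by the symmetry of the truncated jump measure. *)
Let jump_form11 : jump_form (fun p => g p.1 * w p.1)%R = \int[m]_x (alpha x * w x)%:E.
Proof.
apply: eq_integral => x _; rewrite /= integral_EFin_cst//.
by rewrite -(fineK (mass_fin x)) -EFinM /alpha mulrAC.
Qed.

Let jump_form21 : jump_form (fun p => g p.2 * w p.1)%R = \int[m]_x (beta x * w x)%:E.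
Proof.
apply: eq_integral => x _ /=; rewrite EFinM fineK// muleC -ge0_integralZl//=.
- by apply: eq_integral => y _; rewrite mulrC.
- by apply: measurable_funTS; exact/measurable_EFinP.
- by move=> y _; rewrite lee_fin.
- by rewrite lee_fin.
Qed.

Let jump_form22 : jump_form (fun p => g p.2 * w p.2)%R = \int[m]_x (alpha x * w x)%:E.
Proof.
have := trunc_int_sym borelM sepM mA r0 symj (measurable_cst (1%R : R)) mgw
  (fun=> ler01) gw0.
rewrite -jump_form11 => E; transitivity
  (\int[m]_x ((1%R : R)%:E * \int[j x]_(y in trunc_set A r x) (g y * w y)%:E)).
  by apply: eq_integral => x _; rewrite mul1e.
rewrite E; apply: eq_integral => x _ /=.
by rewrite !integral_EFin_cst// mul1e.
Qed.

Let jump_form12 : jump_form (fun p => g p.1 * w p.2)%R = \int[m]_x (beta x * w x)%:E.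
Proof.
rewrite -jump_form21.
have := trunc_int_sym borelM sepM mA r0 symj mg mw g0 w0.
have int_mul (f h : M -> R) x : measurable_fun setT h ->
    (forall x, (0 <= f x)%R) -> (forall x, (0 <= h x)%R) ->
    (f x)%:E * \int[j x]_(y in trunc_set A r x) (h y)%:E =
    \int[j x]_(y in trunc_set A r x) (f x * h y)%:E.
  move=> mh f0 h0; rewrite -ge0_integralZl//.
  - by apply: measurable_funTS; exact/measurable_EFinP.
  - by move=> y _; rewrite lee_fin.
  - by rewrite lee_fin.
move=> E; transitivity (\int[m]_x ((g x)%:E * \int[j x]_(y in trunc_set A r x) (w y)%:E)).
  by apply: eq_integral => x _; rewrite int_mul.
rewrite E; apply: eq_integral => x _; rewrite int_mul//.
by apply: eq_integral => y _; rewrite mulrC.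
Qed.

Let m11 : measurable_fun setT (fun p : M * M => g p.1 * w p.1)%R.
Proof. exact: (measurable_fst_comp mgw). Qed.

Let m22 : measurable_fun setT (fun p : M * M => g p.2 * w p.2)%R.
Proof. exact: (measurable_snd_comp mgw). Qed.

Let m12 : measurable_fun setT (fun p : M * M => g p.1 * w p.2)%R.
Proof. by apply: measurable_funM; [exact: measurable_fst_comp|exact: measurable_snd_comp]. Qed.

Let m21 : measurable_fun setT (fun p : M * M => g p.2 * w p.1)%R.
Proof. by apply: measurable_funM; [exact: measurable_snd_comp|exact: measurable_fst_comp]. Qed.

Let diag_part (p : M * M) : R := (g p.1 * w p.1 + g p.2 * w p.2)%R.
Let cross_part (p : M * M) : R := (g p.1 * w p.2 + g p.2 * w p.1)%R.

Lemma measurable_diag_part : measurable_fun setT diag_part.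
Proof. exact: measurable_funD. Qed.

Lemma measurable_cross_part : measurable_fun setT cross_part.
Proof. exact: measurable_funD. Qed.

Lemma jump_form_diag_part :
  jump_form diag_part = 2%:E * \int[m]_x (alpha x * w x)%:E.
Proof.
rewrite (pair_formD jump_form_pair_form)//.
by rewrite mule_natl mule2n jump_form11 jump_form22.
Qed.

Lemma jump_form_cross_part :
  jump_form cross_part = 2%:E * \int[m]_x (beta x * w x)%:E.
Proof.
rewrite (pair_formD jump_form_pair_form)//.
- by rewrite mule_natl mule2n jump_form12 jump_form21.
- by move=> p; rewrite mulr_ge0.
- by move=> p; rewrite mulr_ge0.
Qed.

End Pairings.

(* u = u^+ - u^- splits the cross term (g x - g y) (u x - u y) into a difference of
   nonnegative integrands. *)
Lemma jump_form_polarization (u : M -> R) : measurable_fun setT u ->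
  sqint m u < +oo ->
  quad jump_form u + quad jump_form g =
  quad jump_form (fun x => u x - g x)%R + 4%:E * \int[m]_x (u x * gradient x)%:E.
Proof.
move=> mu uoo.
pose up x := Num.max (u x) 0%R; pose un x := Num.max (- u x)%R 0%R.
have mup : measurable_fun setT up by exact: measurable_maxr.
have mun : measurable_fun setT un by apply: measurable_maxr => //; exact: measurable_funN.
have up0 x : (0 <= up x)%R by rewrite le_max lexx orbT.
have un0 x : (0 <= un x)%R by rewrite le_max lexx orbT.
have uE x : (u x = up x - un x)%R.
  by rewrite /up /un; have /orP[u0|u0] := le_total 0%R (u x);
    [rewrite max_l// max_r ?oppr_le0// subr0|rewrite max_r// max_l ?oppr_ge0// add0r opprK].
have sq_le (w : M -> R) : measurable_fun setT w -> (forall x, w x ^+ 2 <= u x ^+ 2)%R ->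
    sqint m w < +oo.
  move=> mw wu; apply: le_lt_trans uoo; apply: ge0_le_integral_EFin => //.
  - exact: measurable_funX.
  - exact: measurable_funX.
  - by move=> x; exact: sqr_ge0.
have upoo : sqint m up < +oo.
  apply: sq_le => // x; rewrite /up; case: (leP (u x) 0%R) => // _.
  by rewrite expr0n sqr_ge0.
have unoo : sqint m un < +oo.
  apply: sq_le => // x; rewrite /un; case: (leP (- u x)%R 0%R) => _.
    by rewrite expr0n sqr_ge0.
  by rewrite sqrrN.
have fin (c w : M -> R) : measurable_fun setT c -> measurable_fun setT w ->
    (forall x, (0 <= c x)%R) -> (forall x, (c x <= G * Lam * \1_A x)%R) ->
    (forall x, (0 <= w x)%R) -> sqint m w < +oo ->
    exists2 s : R, \int[m]_x (c x * w x)%:E = s%:E &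
      m.-integrable setT (fun x => (c x * w x)%:E).
  move=> mc mw c0 cle w0 woo; have cw0 x : (0 <= c x * w x)%R by rewrite mulr_ge0.
  have lt := finite_int mc mw c0 cle w0 woo.
  exists (fine (\int[m]_x (c x * w x)%:E)).
    by rewrite fineK// ge0_fin_numE// ge0_integral_EFin.
  apply/integrableP; split; first by apply/measurable_EFinP; exact: measurable_funM.
  by under eq_integral do rewrite gee0_abs ?lee_fin//.
have [a Ea Ia] := fin alpha up malpha mup alpha_ge0 alpha_le up0 upoo.
have [b Eb Ib] := fin beta un mbeta mun beta_ge0 beta_le un0 unoo.
have [c Ec Ic] := fin alpha un malpha mun alpha_ge0 alpha_le un0 unoo.
have [e Ee Ie] := fin beta up mbeta mup beta_ge0 beta_le up0 upoo.
have -> : \int[m]_x (u x * gradient x)%:E = (a + b - (c + e))%:E.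
  transitivity (\int[m]_x (((alpha x * up x)%:E + (beta x * un x)%:E)
                         - ((alpha x * un x)%:E + (beta x * up x)%:E))).
    by apply: eq_integral => x _; rewrite -!EFinD uE /gradient; congr EFin; ring.
  rewrite integralB//; last 2 first.
  - exact: integrableD.
  - exact: integrableD.
  by rewrite !integralD// Ea Eb Ec Ee.
have mDP := measurable_diag_part mup; have mDN := measurable_diag_part mun.
have mCP := measurable_cross_part mup; have mCN := measurable_cross_part mun.
have diag0 (w : M -> R) (p : M * M) : (forall x, (0 <= w x)%R) ->
  (0 <= g p.1 * w p.1 + g p.2 * w p.2)%R by move=> w0; rewrite addr_ge0 ?mulr_ge0.
have cross0 (w : M -> R) (p : M * M) : (forall x, (0 <= w x)%R) ->
  (0 <= g p.1 * w p.2 + g p.2 * w p.1)%R by move=> w0; rewrite addr_ge0 ?mulr_ge0.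
have PF := jump_form_pair_form.
(* 2 (g x - g y) (u x - u y) is [pairing up un] minus [pairing un up], both nonnegative. *)
pose pairing (w w' : M -> R) (p : M * M) : R :=
  (2 * ((g p.1 * w p.1 + g p.2 * w p.2) + (g p.1 * w' p.2 + g p.2 * w' p.1)))%R.
have JPN (w w' : M -> R) (s s' : R) : measurable_fun setT w -> measurable_fun setT w' ->
    (forall x, (0 <= w x)%R) -> (forall x, (0 <= w' x)%R) ->
    \int[m]_x (alpha x * w x)%:E = s%:E -> \int[m]_x (beta x * w' x)%:E = s'%:E ->
    jump_form (pairing w w') = (4 * (s + s'))%:E.
  move=> mw mw' w0 w'0 Es Es'.
  rewrite (pair_formZ PF)//; last 2 first.
  - apply: measurable_funD; first exact: measurable_diag_part.
    exact: measurable_cross_part.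
  - by move=> p; rewrite addr_ge0 ?diag0 ?cross0.
  rewrite (pair_formD PF)//; last 4 first.
  - exact: measurable_diag_part.
  - exact: measurable_cross_part.
  - by move=> p; exact: diag0.
  - by move=> p; exact: cross0.
  rewrite jump_form_diag_part// jump_form_cross_part// Es Es' -!EFinM.
  by congr EFin; ring.
have EP := JPN up un a b mup mun up0 un0 Ea Eb.
have EN := JPN un up c e mun mup un0 up0 Ec Ee.
have msum (w w' : M -> R) : measurable_fun setT w -> measurable_fun setT w' ->
    measurable_fun setT (pairing w w').
  move=> mw mw'; apply: measurable_funM => //; apply: measurable_funD.
    exact: measurable_diag_part.
  exact: measurable_cross_part.
have sum0 (w w' : M -> R) (p : M * M) : (forall x, (0 <= w x)%R) -> (forall x, (0 <= w' x)%R) ->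
    (0 <= pairing w w' p)%R.
  by move=> w0 w'0; rewrite mulr_ge0// addr_ge0 ?diag0 ?cross0.
have mqu := measurable_sqr_diff mu; have mqg := measurable_sqr_diff mg.
have mqug : measurable_fun setT (fun p : M * M => ((u p.1 - g p.1) - (u p.2 - g p.2)) ^+ 2)%R.
  by apply: (measurable_sqr_diff (f := fun x => u x - g x)%R); exact: measurable_funB.
(* Both sides are sums of nonnegative integrals, to which additivity applies; only the finite number
   4 (c + e) is subtracted afterwards. *)
have key : quad jump_form u + quad jump_form g + (4 * (c + e))%:E =
           quad jump_form (fun x => u x - g x)%R + (4 * (a + b))%:E.
  rewrite -EN -EP /quad -!(pair_formD PF); try by move=> p; rewrite ?addr_ge0 ?sqr_ge0 ?sum0.
  - congr jump_form; apply/funext => p; rewrite (uE p.1) (uE p.2).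
    by rewrite /= /pairing; ring.
  - exact: mqug.
  - exact: msum.
  - exact: measurable_funD.
  - exact: msum.
  - exact: mqu.
  - exact: mqg.
have := congr1 (fun z => z - (4 * (c + e))%:E) key.
rewrite addeK// => ->; rewrite -addeA; congr (_ + _).
by rewrite -EFinD -EFinM; congr EFin; ring.
Qed.

End Polarization.
End JumpForm.

(** * Forms given by a symmetric weight *)

Section SigmaFiniteTonelli.
Context (d : measure_display) (T : measurableType d) (R : realType).
Variable m : {measure set T -> \bar R}.
Hypothesis sfm : sigma_finite setT m.
Local Open Scope ereal_scope.

Lemma measurable_fun_section_integral (f : T * T -> \bar R) :
  measurable_fun setT f -> (forall p, 0 <= f p) ->
  measurable_fun setT (fun x => \int[m]_y f (x, y)).
Proof.
move=> mf f0.
(* Sigma-finiteness of [m] is a hypothesis here and not part of its type, so [m] is repackaged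
   before Tonelli's theorem is applied. *)
pose H1 := isSFinite.Build _ _ _ _ (sfinite_measure_sigma_finite sfm).
pose H2 := isSigmaFinite.Build _ _ _ _ sfm.
pose mu := HB.pack_for (SigmaFiniteMeasure.type T R) (Measure.sort m) H1 H2.
exact: (@measurable_fun_fubini_tonelli_F _ _ T T R mu f mf f0).
Qed.

Lemma sigma_finite_tonelli (f : T * T -> \bar R) :
  measurable_fun setT f -> (forall p, 0 <= f p) ->
  \int[m]_x \int[m]_y f (x, y) = \int[m]_y \int[m]_x f (x, y).
Proof.
move=> mf f0.
pose H1 := isSFinite.Build _ _ _ _ (sfinite_measure_sigma_finite sfm).
pose H2 := isSigmaFinite.Build _ _ _ _ sfm.
pose mu := HB.pack_for (SigmaFiniteMeasure.type T R) (Measure.sort m) H1 H2.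
exact: (@fubini_tonelli _ _ T T R mu mu f mf f0).
Qed.

Section Weight.
Variables (W : T * T -> R) (Lam : R).
Hypotheses (mW : measurable_fun setT W) (W0 : forall p, (0 <= W p)%R).
Hypothesis symW : forall x y, W (x, y) = W (y, x).

Definition weight_form (h : T * T -> R) : \bar R :=
  \int[m]_x \int[m]_y (h (x, y) * W (x, y))%:E.

Let mhW (h : T * T -> R) : measurable_fun setT h ->
  measurable_fun setT (fun p => (h p * W p)%:E).
Proof. by move=> mh; apply/measurable_EFinP; exact: measurable_funM. Qed.

Lemma measurable_weight_int (h : T * T -> R) :
  measurable_fun setT h -> (forall p, (0 <= h p)%R) ->
  measurable_fun setT (fun x => \int[m]_y (h (x, y) * W (x, y))%:E).
Proof.
move=> mh h0; apply: (measurable_fun_section_integral (f := fun p => (h p * W p)%:E)).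
  exact: mhW.
by move=> p; rewrite lee_fin mulr_ge0.
Qed.

Let msec (h : T * T -> R) x : measurable_fun setT h ->
  measurable_fun setT (fun y => (h (x, y) * W (x, y)))%R.
Proof.
by move=> mh; apply: (measurable_fun_pair2 (f := fun p => (h p * W p)%R)); exact: measurable_funM.
Qed.

Let int0 (h : T * T -> R) x : (forall p, (0 <= h p)%R) ->
  0 <= \int[m]_y (h (x, y) * W (x, y))%:E.
Proof. by move=> h0; apply: ge0_integral_EFin => y; rewrite mulr_ge0. Qed.

Lemma weight_form_ge0 h : (forall p, (0 <= h p)%R) -> 0 <= weight_form h.
Proof. by move=> h0; apply: integral_ge0 => x _; exact: int0. Qed.

Lemma weight_formD (h k : T * T -> R) : measurable_fun setT h -> measurable_fun setT k ->
  (forall p, (0 <= h p)%R) -> (forall p, (0 <= k p)%R) ->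
  weight_form (fun p => h p + k p)%R = weight_form h + weight_form k.
Proof.
move=> mh mk h0 k0; rewrite /weight_form -ge0_integralD//; last 4 first.
- by move=> x _; exact: int0.
- exact: measurable_weight_int.
- by move=> x _; exact: int0.
- exact: measurable_weight_int.
apply: eq_integral => x _; rewrite -ge0_integralD_EFin//.
- by apply: eq_integral => y _; rewrite mulrDl.
- exact: msec.
- exact: msec.
- by move=> y; rewrite mulr_ge0.
- by move=> y; rewrite mulr_ge0.
Qed.

Lemma weight_formZ (c : R) (h : T * T -> R) : (0 <= c)%R -> measurable_fun setT h ->
  (forall p, (0 <= h p)%R) -> weight_form (fun p => c * h p)%R = c%:E * weight_form h.
Proof.
move=> c0 mh h0; rewrite /weight_form -ge0_integralZl//; last 2 first.
- exact: measurable_weight_int.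
- by move=> x _; exact: int0.
apply: eq_integral => x _; rewrite -ge0_integralZ_EFin//.
- by apply: eq_integral => y _; rewrite mulrA.
- exact: msec.
- by move=> y; rewrite mulr_ge0.
Qed.

Lemma weight_form_swap (h : T * T -> R) : measurable_fun setT h -> (forall p, (0 <= h p)%R) ->
  weight_form (fun p => h (p.2, p.1)) = weight_form h.
Proof.
move=> mh h0; rewrite /weight_form [RHS](sigma_finite_tonelli (f := fun p => (h p * W p)%:E)).
- by apply: eq_integral => x _; apply: eq_integral => y _ /=; rewrite symW.
- exact: mhW.
- by move=> p; rewrite lee_fin mulr_ge0.
Qed.

Lemma weight_form_le (h k : T * T -> R) : measurable_fun setT h -> measurable_fun setT k ->
  (forall p, (0 <= h p)%R) -> (forall p, (h p <= k p)%R) ->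
  weight_form h <= weight_form k.
Proof.
move=> mh mk h0 hk; have k0 p : (0 <= k p)%R by exact: le_trans (hk p).
apply: ge0_le_integral => //.
- by move=> x _; exact: int0.
- exact: measurable_weight_int.
- exact: measurable_weight_int.
- move=> x _; apply: ge0_le_integral_EFin.
  - exact: msec.
  - exact: msec.
  - by move=> y; rewrite mulr_ge0.
  - by move=> y; rewrite ler_wpM2r.
Qed.

Hypothesis WLam : forall x, \int[m]_y (W (x, y))%:E <= Lam%:E.
Hypothesis Lam0 : (0 <= Lam)%R.

(** The second marginal is the first one after exchanging the integrals, by the symmetry of [W]. *)
Lemma weight_form_pair_form : pair_form m weight_form Lam.
Proof.
have fst_le (u : T -> R) : measurable_fun setT u -> (forall x, (0 <= u x)%R) ->
    weight_form (fun p => u p.1) <= Lam%:E * \int[m]_x (u x)%:E.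
  move=> mu0 u0; rewrite -ge0_integralZ_EFin//; apply: ge0_le_integral => //.
  - by move=> x _; apply: (int0 (h := fun p => u p.1)).
  - by apply: (measurable_weight_int (h := fun p => u p.1)) => //; exact: measurable_fst_comp.
  - by apply/measurable_EFinP; exact: measurable_funM.
  - move=> x _ /=; rewrite ge0_integralZ_EFin//; last exact: measurable_fun_pair2.
    by rewrite mulrC EFinM lee_wpmul2l// lee_fin.
split.
- by move=> h; exact: weight_form_ge0.
- exact: weight_formD.
- exact: weight_formZ.
- exact: weight_form_le.
- exact: fst_le.
- move=> u mu0 u0; apply: le_trans (fst_le u mu0 u0).
  by rewrite -(weight_form_swap (h := fun p => u p.1))//; exact: measurable_fst_comp.
Qed.

End Weight.
End SigmaFiniteTonelli.

(** * Cells and averages *)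

Section CountableUnions.
Context (d : measure_display) (T : measurableType d) (R : realType).
Variables (I : choiceType) (V : set I).
Hypothesis cV : countable V.

Lemma countable_bigcup_measurable (F : I -> set T) :
  (forall i, V i -> measurable (F i)) -> measurable (\bigcup_(i in V) F i).
Proof.
have [->|[e ->]] := countable_enumeration cV => mF; first by rewrite bigcup_set0.
by rewrite bigcup_image; apply: bigcupT_measurable => n; apply: mF; exists n.
Qed.

Lemma countable_bigcup_null (mu : {measure set T -> \bar R}) (F : I -> set T) :
  (forall i, V i -> measurable (F i)) -> (forall i, V i -> mu (F i) = 0%E) ->
  mu (\bigcup_(i in V) F i) = 0%E.
Proof.
move=> mF F0; have := countable_bigcup_measurable mF.
have [->|[e Ve]] := countable_enumeration cV; first by rewrite bigcup_set0 measure0.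
have inV n : V (e n) by rewrite Ve; exists n.
rewrite Ve bigcup_image => mU; apply: measure_negligible => //.
by apply: negligible_bigcup => n; exists (F (e n)); split; [exact: mF|exact: F0|].
Qed.

(** The countable index set is carried into [nat] by an injection; indices outside its range receive
    the empty set, so that finite and infinite [V] are treated alike. *)
Lemma ge0_integral_bigcup_esum (mu : {measure set T -> \bar R}) (F : I -> set T)
    (h : T -> \bar R) : trivIset V F -> (forall i, V i -> measurable (F i)) ->
  measurable_fun setT h -> (forall x, (0 <= h x)%E) ->
  (\int[mu]_(x in \bigcup_(i in V) F i) h x = \esum_(i in V) \int[mu]_(x in F i) h x)%E.
Proof.
move=> tF mF mh h0; have [V0|/set0P[i0 Vi0]] := eqVneq V set0.
  by rewrite V0 bigcup_set0 integral_set0 esum_set0.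
have /countable_injP[f finj] := cV.
pose P := f @` V; pose e n := xget i0 [set i | V i /\ f i = n].
have eP n : P n -> V (e n) /\ f (e n) = n.
  by move=> [i Vi fi]; apply: (@xgetI _ i0 [set i | V i /\ f i = n] i).
have ef i : V i -> e (f i) = i.
  move=> Vi; have [|Ve fe] := eP (f i); first by exists i.
  by apply: finj; rewrite ?inE.
have bij : set_bij P V e.
  split => [n /eP[]//|n k|i Vi].
    by rewrite !inE => /eP[_ E1] /eP[_ E2] ee; rewrite -E1 ee E2.
  by exists (f i); [exists i|exact: ef].
pose F' n := if n \in P then F (e n) else set0.
have -> : \bigcup_(i in V) F i = \bigcup_n F' n.
  apply/seteqP; split => [x [i Vi Fx]|x [n _]].
    exists (f i) => //; rewrite /F' mem_set; last by exists i.
    by rewrite ef.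
  by rewrite /F'; case: ifPn => // /set_mem/eP[Ve _] Fx; exists (e n).
rewrite ge0_integral_bigcup//; last 3 first.
- move=> n; rewrite /F'; case: ifPn => // /set_mem/eP[Ve _]; exact: mF.
- exact: measurable_funTS.
- apply/trivIsetP => n k _ _ nk; rewrite /F'.
  case: ifPn => [/set_mem/eP[Vn fn]|_]; last by rewrite set0I.
  case: ifPn => [/set_mem/eP[Vk fk]|_]; last by rewrite setI0.
  move/trivIsetP : tF; apply => //; apply: contra nk => /eqP enk.
  by rewrite -fn -fk enk.
rewrite (reindex_esum P V e)// esum_mkcond nneseries_esumT.
  apply: eq_esum => n _; rewrite /F'; case: ifPn => // _.
  by rewrite integral_set0.
by move=> n; apply: integral_ge0.
Qed.

Lemma measurable_piecewise_const (F : I -> set T) (c : I -> R) (f : T -> R) :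
  (forall i, V i -> measurable (F i)) ->
  (forall i x, V i -> F i x -> f x = c i) ->
  (forall x, ~ (\bigcup_(i in V) F i) x -> f x = 0) -> measurable_fun setT f.
Proof.
move=> mF fc f0 _ Y mY; rewrite setTI.
have mU := countable_bigcup_measurable mF.
rewrite (_ : f @^-1` Y = \bigcup_(i in V) (if c i \in Y then F i else set0) `|`
    (if 0 \in Y then ~` (\bigcup_(i in V) F i) else set0)).
  apply: measurableU; last by case: ifP => // _; exact: measurableC.
  apply: countable_bigcup_measurable => i Vi; case: ifP => // _; exact: mF.
apply/seteqP; split => x /=.
  move=> Yf; have [[i Vi Fx]|nF] := pselect ((\bigcup_(i in V) F i) x).
    by left; exists i => //; rewrite -(fc i x)// mem_set.
  by right; rewrite -(f0 x nF) mem_set.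
move=> [[i Vi]|]; case: ifPn => // /set_mem; last by move=> Y0 /f0 ->.
by move=> Yc Fx; rewrite (fc i x).
Qed.

End CountableUnions.

(** What the arguments at a single level use; the graph itself no longer appears. The last field
    makes averages over cells meaningful. *)
Record cell_partition (R : realType) (d : measure_display) (M : metricMeasurableType R d)
    (m : {measure set M -> \bar R}) (V : set M) (U : M -> set M) : Prop := {
  cells_countable : countable V;
  cells_measurable : forall x, V x -> measurable (U x);
  cells_cover : \bigcup_(x in V) U x = setT;
  cells_disjoint : forall x y, V x -> V y -> x <> y -> m (U x `&` U y) = 0%E;
  cells_finite : forall x, V x -> (0 < m (U x) < +oo)%E
}.

Section Level.
Context (R : realType) (d : measure_display) (M : metricMeasurableType R d).
Variables (m : {measure set M -> \bar R}) (V : set M) (U : M -> set M).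
Hypotheses (cells : cell_partition m V U) (sfm : sigma_finite setT m).
Let cV := cells_countable cells.
Let mU := cells_measurable cells.
Let Ucover := cells_cover cells.
Let Udisj := cells_disjoint cells.
Let Ufin := cells_finite cells.
Local Open Scope ereal_scope.

Lemma measurable_core x : V x -> measurable (core V U x).
Proof.
move=> Vx; apply: measurableD; first exact: mU.
apply: countable_bigcup_measurable; last by move=> y [Vy _]; exact: mU.
by apply: sub_countable cV; apply: subset_card_le; exact: subDsetl.
Qed.

Lemma core_sub x : core V U x `<=` U x. Proof. by move=> z []. Qed.

Lemma core_inj x y z : V x -> V y -> core V U x z -> core V U y z -> x = y.
Proof.
move=> Vx Vy [Uxz _] [Uyz nz]; apply: contrapT => xy; apply: nz.
by exists x.
Qed.

Lemma trivIset_core : trivIset V (core V U).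
Proof. by move=> x y Vx Vy [z [xz yz]]; exact: core_inj xz yz. Qed.

(** Since the cells cover the space, these are the points lying in at least two cells, a null set.
    [extend] and [extend2] vanish there. *)
Definition overlap : set M := ~` (\bigcup_(x in V) core V U x).

Lemma measurable_overlap : measurable overlap.
Proof.
by apply: measurableC; apply: countable_bigcup_measurable => // x; exact: measurable_core.
Qed.

Lemma measure_cell_overlap x : V x -> m (U x `&` \bigcup_(y in V `\ x) U y) = 0.
Proof.
move=> Vx; rewrite setI_bigcupr; apply: countable_bigcup_null.
- by apply: sub_countable cV; apply: subset_card_le; exact: subDsetl.
- by move=> y [Vy _]; apply: measurableI; exact: mU.
- by move=> y [Vy yx]; apply: Udisj => // xy; apply: yx.
Qed.

Lemma measure_core x : V x -> m (core V U x) = m (U x).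
Proof.
move=> Vx; have mB : measurable (\bigcup_(y in V `\ x) U y).
  apply: countable_bigcup_measurable; last by move=> y [Vy _]; exact: mU.
  by apply: sub_countable cV; apply: subset_card_le; exact: subDsetl.
rewrite [RHS](@measureDI _ _ _ m (U x) (\bigcup_(y in V `\ x) U y))//; last exact: mU.
by rewrite [X in _ + X]measure_cell_overlap// adde0.
Qed.

Lemma measure_overlap : m overlap = 0.
Proof.
apply/eqP; rewrite -measure_le0 -(countable_bigcup_null cV
  (F := fun x => U x `&` \bigcup_(y in V `\ x) U y) (mu := m))//; last 2 first.
- move=> x Vx; apply: measurableI; first exact: mU.
  apply: countable_bigcup_measurable; last by move=> y [Vy _]; exact: mU.
  by apply: sub_countable cV; apply: subset_card_le; exact: subDsetl.
- exact: measure_cell_overlap.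
apply: le_measure; rewrite ?inE.
- exact: measurable_overlap.
- apply: countable_bigcup_measurable => // x Vx.
  apply: measurableI; first exact: mU.
  apply: countable_bigcup_measurable; last by move=> y [Vy _]; exact: mU.
  by apply: sub_countable cV; apply: subset_card_le; exact: subDsetl.
- move=> z nz; have : (\bigcup_(x in V) U x) z by rewrite Ucover.
  move=> [x Vx Ux]; exists x => //; split => //.
  by apply: contrapT => nU; apply: nz; exists x.
Qed.

Lemma integral_cells (h : M -> \bar R) : measurable_fun setT h -> (forall x, 0 <= h x) ->
  \int[m]_z h z = \esum_(x in V) \int[m]_(z in core V U x) h z.
Proof.
move=> mh h0; rewrite (ge0_negligible_integral measurable_overlap)//; last exact: measure_overlap.
rewrite setTD setCK ge0_integral_bigcup_esum//; first exact: trivIset_core.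
exact: measurable_core.
Qed.

Lemma extend_core (g : M -> R) x z : V x -> core V U x z -> extend V U g z = g x.
Proof.
move=> Vx xz; rewrite /extend -(@fsbig_widen _ _ _ _ [set x] V).
- by rewrite fsbig_set1 indicE mem_set// mulr1.
- by move=> y ->.
- move=> y [Vy yx] /=; rewrite indicE memNset ?mulr0// => yz.
  by apply: yx; exact: core_inj yz xz.
Qed.

Lemma extend_overlap (g : M -> R) z : overlap z -> extend V U g z = 0%R.
Proof.
move=> nz; rewrite /extend fsbig1// => x Vx; rewrite indicE memNset ?mulr0// => xz.
by apply: nz; exists x.
Qed.

Lemma extend2_core (c : M -> M -> R) x z w : V x -> core V U x z ->
  extend2 V U c z w = extend V U (c x) w.
Proof.
move=> Vx xz; rewrite /extend2 -(@fsbig_widen _ _ _ _ [set x] V).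
- by rewrite fsbig_set1 indicE mem_set//; apply: eq_fsbigr => y _; rewrite mulr1.
- by move=> y ->.
- move=> y [Vy yx] /=; rewrite fsbig1// => k Vk; rewrite indicE memNset ?mulr0 ?mul0r// => yz.
  by apply: yx; exact: core_inj yz xz.
Qed.

Lemma extend2_overlap (c : M -> M -> R) z w : overlap z -> extend2 V U c z w = 0%R.
Proof.
move=> nz; rewrite /extend2 fsbig1// => x Vx; rewrite fsbig1// => k Vk.
rewrite indicE memNset ?mulr0 ?mul0r// => xz.
by apply: nz; exists x.
Qed.

Lemma coreP z : (exists2 x, V x & core V U x z) \/ overlap z.
Proof. by have [[x Vx xz]|nz] := pselect ((\bigcup_(x in V) core V U x) z); [left;
  exists x|right]. Qed.

Lemma extend_ge0 (g : M -> R) z : (forall x, V x -> (0 <= g x)%R) -> (0 <= extend V U g z)%R.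
Proof.
by move=> g0; have [[x Vx xz]|nz] := coreP z;
  [rewrite (extend_core _ Vx xz) g0|rewrite extend_overlap].
Qed.

Lemma measurable_extend (g : M -> R) : measurable_fun setT (extend V U g).
Proof.
apply: (measurable_piecewise_const cV (F := core V U) (c := g)).
- exact: measurable_core.
- by move=> x z; exact: extend_core.
- exact: extend_overlap.
Qed.

Lemma measurable_extend2 (c : M -> M -> R) :
  measurable_fun setT (fun p : M * M => extend2 V U c p.1 p.2).
Proof.
apply: (measurable_piecewise_const (countableX cV cV)
  (F := fun q => core V U q.1 `*` core V U q.2) (c := fun q => c q.1 q.2)).
- by move=> [x y] [/= Vx Vy]; apply: measurableX; exact: measurable_core.
- move=> [x y] [z w] [/= Vx Vy] [/= xz yw].
  by rewrite (extend2_core c w Vx xz) (extend_core _ Vy yw).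
- move=> [z w] nzw /=; have [[x Vx xz]|nz] := coreP z; last exact: extend2_overlap.
  rewrite (extend2_core c w Vx xz); have [[y Vy yw]|nw] := coreP w; last exact: extend_overlap.
  by exfalso; apply: nzw; exists (x, y).
Qed.

Lemma extend2_ge0 (c : M -> M -> R) z w : (forall x y, V x -> V y -> (0 <= c x y)%R) ->
  (0 <= extend2 V U c z w)%R.
Proof.
move=> c0; have [[x Vx xz]|nz] := coreP z; last by rewrite extend2_overlap.
by rewrite (extend2_core c w Vx xz) extend_ge0// => y Vy; exact: c0.
Qed.

Lemma extend2_sym (c : M -> M -> R) z w : (forall x y, V x -> V y -> c x y = c y x) ->
  extend2 V U c z w = extend2 V U c w z.
Proof.
move=> csym; have [[x Vx xz]|nz] := coreP z; have [[y Vy yw]|nw] := coreP w.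
- rewrite (extend2_core c w Vx xz) (extend2_core c z Vy yw).
  by rewrite (extend_core _ Vy yw) (extend_core _ Vx xz) csym.
- by rewrite (extend2_core c w Vx xz) extend2_overlap// extend_overlap.
- by rewrite (extend2_core c z Vy yw) extend2_overlap// extend_overlap.
- by rewrite !extend2_overlap.
Qed.

Lemma integral_core_cst x (h : M -> \bar R) (c : R) : V x ->
  (forall z, core V U x z -> h z = c%:E) ->
  \int[m]_(z in core V U x) h z = c%:E * m (U x).
Proof.
move=> Vx hc; rewrite -measure_core// -integral_EFin_cst; last exact: measurable_core.
by apply: eq_integral => z /set_mem; exact: hc.
Qed.

Lemma integral_extend (a : M -> R) : (forall x, V x -> (0 <= a x)%R) ->
  \int[m]_z (extend V U a z)%:E = \esum_(x in V) ((a x)%:E * m (U x)).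
Proof.
move=> a0; rewrite integral_cells.
- by apply: eq_esum => x Vx; apply: integral_core_cst => // z xz; rewrite (extend_core _ Vx xz).
- by apply/measurable_EFinP; exact: measurable_extend.
- by move=> z; rewrite lee_fin extend_ge0.
Qed.

Lemma sqint_extend (g : M -> R) :
  sqint m (extend V U g) = \esum_(x in V) (((g x) ^+ 2)%:E * m (U x)).
Proof.
rewrite -integral_extend => [|x _]; last exact: sqr_ge0.
apply: eq_integral => z _; have [[x Vx xz]|nz] := coreP z.
  by rewrite !(extend_core _ Vx xz).
by rewrite !extend_overlap// expr0n.
Qed.

(** The integrand is itself constant on products of cores, with value (u x - u y)^2 c(x, y); on
    [overlap] the weight is 0, so the value 0 given there to the extension of [u] is harmless.
    Estimates on discrete energies can thus be made on M x M. *)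
Lemma discrete_sumE (c : M -> M -> R) (u : M -> R) :
  (forall x y, V x -> V y -> (0 <= c x y)%R) ->
  discrete_sum m V U c u =
  \int[m]_z \int[m]_w ((extend V U u z - extend V U u w) ^+ 2 * extend2 V U c z w)%:E.
Proof.
move=> c0; pose K x y := ((u x - u y) ^+ 2 * c x y)%R.
have K0 x y : V x -> V y -> (0 <= K x y)%R.
  by move=> Vx Vy; rewrite mulr_ge0 ?sqr_ge0 ?c0.
have row z w : ((extend V U u z - extend V U u w) ^+ 2 * extend2 V U c z w)%R
    = extend2 V U K z w.
  have [[x Vx xz]|nz] := coreP z; last by rewrite !(extend2_overlap _ _ nz) mulr0.
  rewrite !(extend2_core _ w Vx xz); have [[y Vy yw]|nw] := coreP w.
    by rewrite !(extend_core _ Vy yw) (extend_core _ Vx xz).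
  by rewrite [X in (_ * X)%R]extend_overlap// [RHS]extend_overlap// mulr0.
under eq_integral do under eq_integral do rewrite row.
have fin x : V x -> exists2 s : R, (0 < s)%R & m (U x) = s%:E.
  move=> Vx; have /andP[Ux0 Uxoo] := Ufin Vx.
  exists (fine (m (U x))); first exact: fine_gt0 (introT andP (conj Ux0 Uxoo)).
  by rewrite fineK// ge0_fin_numE.
rewrite integral_cells; last 2 first.
- apply: (measurable_fun_section_integral sfm
    (f := fun p => (extend2 V U K p.1 p.2)%:E)).
    by apply/measurable_EFinP; exact: measurable_extend2.
  by move=> p; rewrite lee_fin; exact: extend2_ge0.
- by move=> z; apply: ge0_integral_EFin => w; apply: extend2_ge0.
apply: eq_esum => x Vx; have [s s0 mUx] := fin x Vx.
transitivity ((\int[m]_w (extend V U (K x) w)%:E) * m (U x)); last first.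
  rewrite -(measure_core Vx) -integral_cst; last exact: measurable_core.
  apply: eq_integral => z /set_mem xz; apply: eq_integral => w _.
  by rewrite (extend2_core _ w Vx xz).
rewrite mUx muleC -ge0_integralZ_EFin; last 3 first.
- exact: measurable_extend.
- exact: ltW.
- by move=> w; apply: extend_ge0 => y Vy; exact: K0.
rewrite (_ : (fun w => (s * extend V U (K x) w)%:E) =
  (fun w => (extend V U (fun y => s * K x y)%R w)%:E)); last first.
  apply/funext => w; have [[y Vy yw]|nw] := coreP w.
    by rewrite !(extend_core _ Vy yw).
  by rewrite !extend_overlap// mulr0.
rewrite integral_extend; last by move=> y Vy; rewrite mulr_ge0 ?K0// ltW.
by apply: eq_esum => y Vy; rewrite -/(K x y) mulrC EFinM.
Qed.

End Level.

Section Average.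
Context (R : realType) (d : measure_display) (M : metricMeasurableType R d).
Variables (m : {measure set M -> \bar R}) (V : set M) (U : M -> set M).
Hypotheses (cells : cell_partition m V U) (sfm : sigma_finite setT m).
Local Open Scope ereal_scope.

Lemma measure_cell x : V x -> exists2 s : R, (0 < s)%R & m (U x) = s%:E.
Proof.
move=> Vx; have /andP[Ux0 Uxoo] := cells_finite cells Vx.
exists (fine (m (U x))); first exact: fine_gt0 (introT andP (conj Ux0 Uxoo)).
by rewrite fineK// ge0_fin_numE.
Qed.

Lemma integral_cell x (h : M -> \bar R) : V x -> measurable_fun setT h ->
  (forall z, 0 <= h z) -> \int[m]_(z in U x) h z = \int[m]_(z in core V U x) h z.
Proof.
move=> Vx mh h0; rewrite (ge0_negligible_integral (measurable_overlap cells))//.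
- congr (integral _ _ _); apply/seteqP; split => z.
    move=> [Uz /contrapT[y Vy [Uyz nz]]].
    have [<-//|yx] := pselect (y = x); exfalso; apply: nz; exists x => //.
    by split => // xy; apply: yx.
  by move=> xz; split; [exact: core_sub xz|move=> nz; apply: nz; exists x].
- exact: (cells_measurable cells Vx).
- exact: measurable_funTS.
- exact: measure_overlap.
Qed.

Lemma integrable_cell_cst (c : R) x : V x ->
  m.-integrable (U x) (EFin \o (fun=> c)).
Proof.
move=> Vx; have mUx := cells_measurable cells Vx.
have [s s0 mUxE] := measure_cell Vx.
apply/integrableP; split; first exact: measurable_cst.
by rewrite /= integral_EFin_cst// mUxE -EFinM ltry.
Qed.

Lemma square_integrable_cell (f : M -> R) x : V x -> square_integrable m f ->
  m.-integrable (U x) (EFin \o f) /\ m.-integrable (U x) (EFin \o (fun z => f z ^+ 2)%R).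
Proof.
move=> Vx [mf foo]; have mUx := cells_measurable cells Vx.
have mf2 : measurable_fun setT (fun z => f z ^+ 2)%R by exact: measurable_funX.
have i2 : m.-integrable (U x) (EFin \o (fun z => f z ^+ 2)%R).
  apply: (@integrableS _ _ _ m setT) => //.
  apply/integrableP; split; first exact/measurable_EFinP.
  by under eq_integral do rewrite /= ger0_norm ?sqr_ge0//.
split => //; have [s s0 mUxE] := measure_cell Vx.
have i1 : m.-integrable (U x) (EFin \o (fun z => 1 + f z ^+ 2)%R).
  apply: (eq_integrable _ (fun z => (1%R : R)%:E + (f z ^+ 2)%:E)) => //.
  by apply: integrableD => //; exact: (integrable_cell_cst 1%R Vx).
apply: (le_integrable _ _ _ i1) => //; first by apply: measurable_funTS; exact/measurable_EFinP.
move=> z _ /=; rewrite lee_fin [leRHS]ger0_norm ?addr_ge0 ?sqr_ge0//.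
have := sqr_ge0 (`|f z| - 1)%R; rewrite -(real_normK (num_real (f z))).
have := normr_ge0 (f z); nra.
Qed.

Lemma averageB (f g : M -> R) x : V x -> square_integrable m f -> square_integrable m g ->
  average m U (fun z => f z - g z)%R x = (average m U f x - average m U g x)%R.
Proof.
move=> Vx f2 g2; rewrite /average RintegralB ?mulrBr//.
- exact: (cells_measurable cells Vx).
- by case: (square_integrable_cell Vx f2).
- by case: (square_integrable_cell Vx g2).
Qed.

Lemma Rintegral_cell_cst (c : R) x : V x ->
  (\int[m]_(z in U x) c)%R = (c * fine (m (U x)))%R.
Proof. by move=> Vx; rewrite -Rintegral_cst//; exact: (cells_measurable cells Vx). Qed.

Lemma average_dist_le (f : M -> R) x (a D : R) : V x -> square_integrable m f ->
  (forall z, U x z -> (`|a - f z| <= D)%R) -> (`|a - average m U f x| <= D)%R.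
Proof.
move=> Vx f2 fD; have [fi _] := square_integrable_cell Vx f2.
have [s s0 mUxE] := measure_cell Vx; have mUx := cells_measurable cells Vx.
have bnd z : U x z -> (a - D <= f z <= a + D)%R.
  by move=> /fD; rewrite ler_norml => /andP[? ?]; apply/andP; split; lra.
have icst (c : R) := integrable_cell_cst c Vx.
have : (\int[m]_(z in U x) (a - D) <= \int[m]_(z in U x) f z)%R.
  by apply: le_Rintegral => // z /bnd/andP[].
have : (\int[m]_(z in U x) f z <= \int[m]_(z in U x) (a + D))%R.
  by apply: le_Rintegral => // z /bnd/andP[].
rewrite !Rintegral_cell_cst// /average mUxE /= [(s^-1 * _)%R]mulrC -(ler_pdivrMr _ _ s0)
  -(ler_pdivlMr _ _ s0) => le ge.
by rewrite ler_norml; apply/andP; split; lra.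
Qed.

(** Jensen's inequality, obtained by integrating 2 t f - t^2 <= f^2 with [t] the average. *)
Lemma sqr_average_le (f : M -> R) x : V x -> square_integrable m f ->
  ((average m U f x) ^+ 2)%:E * m (U x) <= \int[m]_(z in U x) ((f z) ^+ 2)%:E.
Proof.
move=> Vx f2; have [i1 i2] := square_integrable_cell Vx f2.
have mUx := cells_measurable cells Vx.
have [s s0 mUxE] := measure_cell Vx.
pose t := average m U f x.
have It : (\int[m]_(z in U x) f z = t * s)%R.
  by rewrite /t /average mUxE /= mulrAC mulVf ?mul1r// gt_eqF.
have icst (c : R) := integrable_cell_cst c Vx.
have i3 : m.-integrable (U x) (EFin \o (fun z => 2 * t * f z)%R).
  by apply: (eq_integrable _ (fun z => (2 * t)%:E * (f z)%:E)) => //; exact: integrableZl.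
have : (\int[m]_(z in U x) (2 * t * f z - t ^+ 2) <= \int[m]_(z in U x) (f z ^+ 2))%R.
  apply: le_Rintegral => //.
    by apply: (eq_integrable _ (fun z => (2 * t * f z)%:E - (t ^+ 2)%:E)) => //;
      exact: (integrableB mUx i3 (icst (t ^+ 2)%R)).
  by move=> z _; have := sqr_ge0 (f z - t)%R; nra.
rewrite RintegralB// RintegralZl// It Rintegral_cell_cst// mUxE /= => le.
rewrite -/t -EFinM -(fineK (integrable_fin_num mUx i2)) lee_fin.
by apply: le_trans le; rewrite le_eqVlt; apply/orP; left; apply/eqP; ring.
Qed.

(** Averaging contracts the L^2 norm, by Jensen's inequality in each cell. This is what lets
    [extend_average_cvg] pass from Lipschitz functions to all of L^2. *)
Lemma sqint_extend_average (f : M -> R) : square_integrable m f ->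
  sqint m (extend V U (average m U f)) <= sqint m f.
Proof.
move=> f2; have [mf _] := f2; rewrite sqint_extend// /sqint (integral_cells cells)//.
- by apply: le_esum => x Vx; rewrite -integral_cell ?sqr_average_le//;
    [apply/measurable_EFinP; exact: measurable_funX|move=> z; rewrite lee_fin sqr_ge0].
- by apply/measurable_EFinP; exact: measurable_funX.
- by move=> z; rewrite lee_fin sqr_ge0.
Qed.

Lemma average_L2V (f : M -> R) : square_integrable m f -> L2V m V U (average m U f).
Proof.
move=> f2; rewrite /L2V /= -(sqint_extend cells).
by apply: le_lt_trans (sqint_extend_average f2) _; case: f2.
Qed.

Lemma extend_averageB (f g : M -> R) z : square_integrable m f -> square_integrable m g ->
  extend V U (average m U (fun z => f z - g z)%R) z =
  (extend V U (average m U f) z - extend V U (average m U g) z)%R.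
Proof.
move=> f2 g2; have [[x Vx xz]|nz] := coreP V U z.
  by rewrite !(extend_core _ Vx xz) averageB.
by rewrite !extend_overlap// subr0.
Qed.

Lemma L2V_extend (g : M -> R) : L2V m V U g -> square_integrable m (extend V U g).
Proof.
move=> g2; split; first exact: (measurable_extend cells).
by rewrite sqint_extend.
Qed.

End Average.

(** * Density of Lipschitz functions in L^2 *)

Section L2Norm.
Context (R : realType) (d : measure_display) (M : metricMeasurableType R d).
Variable m : {measure set M -> \bar R}.
Local Open Scope ereal_scope.

Lemma L2norm_sqint (u : M -> R) : L2norm m u = sqint m u `^ 2^-1.
Proof.
rewrite /L2norm unlock; congr (_ `^ _); apply: eq_integral => x _.
by rewrite -[(EFin \o u) x]/((u x)%:E) abse_EFin poweR_EFin powR_mulrn// real_normK// num_real.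
Qed.

Lemma sqr_L2norm (u : M -> R) : L2norm m u ^+ 2 = sqint m u.
Proof.
rewrite L2norm_sqint; have := sqint_ge0 m u; case: (sqint m u) => [r| |//].
  rewrite lee_fin => r0; rewrite poweR_EFin expe2 -EFinM -expr2.
  by rewrite powR12_sqrt// sqr_sqrtr.
by rewrite poweRyr ?expe2 ?mulyy// invr_eq0.
Qed.

Lemma L2_square_integrable (u : M -> R) : L2 m u <-> square_integrable m u.
Proof.
rewrite /L2 /= inE /=; split.
  move=> /andP[/set_mem/= mu /set_mem/= foo]; split => //.
  rewrite -sqr_L2norm; move: foo; rewrite /finite_norm -/(L2norm m u).
  have : 0 <= L2norm m u by exact: Lnorm_ge0.
  by case: (L2norm m u) => // r _ _; rewrite expe2 -EFinM ltry.
move=> [mu uoo]; apply/andP; split; first exact: mem_set.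
apply: mem_set; rewrite /= /finite_norm -/(L2norm m u) L2norm_sqint; exact: poweR_lty.
Qed.

Lemma strong_cvg_sqint (f : nat -> M -> R) (u : M -> R) :
  (forall eps : R, (0 < eps)%R -> \forall k \near \oo,
     sqint m (fun x => f k x - u x)%R <= eps%:E) -> strong_cvg m f u.
Proof.
move=> fu; rewrite /strong_cvg; apply/fine_cvgP; split.
  apply: filterS (fu 1%R ltr01) => k k1.
  rewrite L2norm_sqint ge0_fin_numE ?poweR_ge0// poweR_lty//.
  by rewrite (le_lt_trans k1) ?ltry.
apply/cvgrPdist_le => /= eps e0; have e2 : (0 < eps ^+ 2)%R by rewrite exprn_gt0.
apply: filterS (fu _ e2) => k ke.
have n0 : 0 <= L2norm m (f k \- u)%R by rewrite L2norm_sqint poweR_ge0.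
have le : L2norm m (f k \- u)%R <= eps%:E.
  apply: lee_sqrE; first by rewrite lee_fin ltW.
  by rewrite sqr_L2norm expe2 -EFinM -expr2.
have nfin : L2norm m (f k \- u)%R \is a fin_num.
  by rewrite ge0_fin_numE// (le_lt_trans le) ?ltry.
by rewrite sub0r normrN ger0_norm ?fine_ge0// -lee_fin fineK.
Qed.

End L2Norm.

Section LipschitzDensity.
Context (R : realType) (d : measure_display) (M : metricMeasurableType R d).
Variables (m : {measure set M -> \bar R}) (x0 : M).
Hypothesis hM : metric_measure_space m.
Let borelM := mms_borel hM.
Let sepM := mms_separable hM.
Local Open Scope ereal_scope.

Lemma ball_lty (x : M) (r : R) : m (ball x r) < +oo.
Proof.
have [r0|r0] := ltP 0%R r; first by have /andP[] := mms_volume hM x r0.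
rewrite (_ : ball x r = set0) ?measure0//; apply/seteqP; split => // y.
by rewrite ballEmdist /= => /lt_le_trans /(_ r0); rewrite ltNge mdist_ge0.
Qed.

Lemma ball_exhaust : \bigcup_n ball x0 (n%:R : R) = [set: M].
Proof.
apply/seteqP; split => // x _; have [n nx] := ltr_add_invr (ltr01 : 0 < 1 :> R)%R.
exists (Num.bound (mdist x0 x)) => //; rewrite ballEmdist /=.
by rewrite archi_boundP// mdist_ge0.
Qed.

Lemma metric_measure_sigma_finite : sigma_finite setT m.
Proof.
exists (fun n => ball x0 (n%:R : R)); first by rewrite ball_exhaust.
by move=> n; split; [exact: measurable_mball|exact: ball_lty].
Qed.

Lemma compact_sub_ball (K : set M) : compact K -> exists n : nat, K `<=` ball x0 (n%:R : R).
Proof.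
move=> /compact_near_coveringP cK.
have [|n _ nK] := cK nat \oo (fun n x => ball x0 (n%:R : R) x).
  move=> x _; pose n := Num.bound (mdist x0 x + 1)%R.
  exists (ball x 1%R, [set k | (n <= k)%N]); first split => //=.
  - by apply: nbhsx_ballx.
  - by exists n.
  - move=> [y k] [/= xy nk]; move: xy; rewrite !ballEmdist /= => xy.
    have : (mdist x0 x + 1 < n%:R)%R by rewrite archi_boundP// addr_ge0// mdist_ge0.
    have : (n%:R <= k%:R :> R)%R by rewrite ler_nat.
    by have := metric_triangle x0 x y; lra.
by exists n; apply: (nK n) => /=.
Qed.

Lemma Lipc_bounded (f : M -> R) : @Lipc R d M f -> exists (L G : R) (n : nat),
  [/\ (0 <= L)%R, (0 <= G)%R, forall x y, (`|f x - f y| <= L * mdist x y)%R,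
      forall x, (`|f x| <= G)%R & forall x, f x != 0%R -> ball x0 (n%:R : R) x].
Proof.
move=> [[L fL] cf]; have [n nf] := compact_sub_ball cf.
have sub x : f x != 0%R -> ball x0 (n%:R : R) x.
  by move=> fx; apply: nf; exact: subset_closure.
exists `|L|%R, (`|f x0| + `|L| * n%:R)%R, n; split => //.
- move=> x y; apply: le_trans (fL x y) _.
  by rewrite ler_wpM2r ?mdist_ge0// ler_norm.
- move=> x; have [->|/sub] := eqVneq (f x) 0%R.
    by rewrite normr0 addr_ge0 ?mulr_ge0.
  rewrite ballEmdist /= => xn; rewrite -lerBlDl.
  apply: le_trans (_ : `|f x - f x0| <= _)%R; first exact: lerB_dist.
  apply: le_trans (fL x x0) _; rewrite metric_sym.
  have := mdist_ge0 x0 x; have := ler_norm L; have := normr_ge0 L; nra.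
Qed.

Lemma Lipc_measurable (f : M -> R) : @Lipc R d M f -> measurable_fun setT f.
Proof. by move=> [[L fL] _]; exact: (lipschitz_measurable borelM fL). Qed.

Lemma bounded_support_sqint (f : M -> R) (G r : R) : measurable_fun setT f ->
  (forall x, `|f x| <= G)%R -> (forall x, f x != 0%R -> ball x0 r x) ->
  sqint m f <= (G ^+ 2)%:E * m (ball x0 r).
Proof.
move=> mf fG fr; have mB := measurable_mball borelM x0 r.
have -> : (G ^+ 2)%:E * m (ball x0 r) = \int[m]_x (G ^+ 2 * \1_(ball x0 r) x)%:E.
  rewrite ge0_integralZ_EFin ?sqr_ge0//.
  by rewrite integral_indic// setIT.
apply: ge0_le_integral_EFin.
- exact: measurable_funX.
- by apply: measurable_funM => //; exact: measurable_indic.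
- by move=> x; exact: sqr_ge0.
- move=> x; have [fx|/fr/mem_set fx] := eqVneq (f x) 0%R.
    by rewrite fx expr0n mulr_ge0 ?sqr_ge0.
  rewrite indicE fx mulr1 -(real_normK (num_real (f x))).
  by rewrite ler_pXn2r ?nnegrE// (le_trans _ (fG x)).
Qed.

Lemma Lipc_square_integrable (f : M -> R) : @Lipc R d M f -> square_integrable m f.
Proof.
move=> fL; have [L [G [n [L0 G0 Lf fG fn]]]] := Lipc_bounded fL.
have mf := Lipc_measurable fL; split => //.
apply: le_lt_trans (bounded_support_sqint mf fG fn) _.
by rewrite lte_mul_pinfty ?lee_fin ?sqr_ge0//; exact: ball_lty.
Qed.

End LipschitzDensity.

Lemma sqint_dominated (d : measure_display) (T : measurableType d) (R : realType)
    (m : {measure set T -> \bar R}) (g : nat -> T -> R) (H : T -> R) :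
  (forall n, measurable_fun setT (g n)) -> square_integrable m H ->
  (forall n x, `|g n x| <= `|H x|) -> (forall x, g n x @[n --> \oo] --> (0 : R)) ->
  forall eps : R, 0 < eps -> exists n, (sqint m (g n) <= eps%:E)%E.
Proof.
move=> mg [mH Hoo] gH g0 eps e0.
have H2 : measurable_fun setT (fun x => H x ^+ 2) by exact: measurable_funX.
have : (sqint m (g n) @[n --> \oo] --> \int[m]_x (0%R : R)%:E)%E.
  apply: (@dominated_cvg _ _ _ _ _ measurableT _ _ (fun x => (H x ^+ 2)%:E)) => //.
  - by move=> n; apply/measurable_EFinP; exact: measurable_funX.
  - move=> x _; apply: cvg_EFin; first exact: nearW.
    rewrite [X in _ --> X](_ : _ = 0 * 0); last by rewrite mulr0.
    by under eq_fun do rewrite /= expr2; exact: cvgM.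
  - apply/integrableP; split; first exact/measurable_EFinP.
    by under eq_integral do rewrite /= ger0_norm ?sqr_ge0//.
  - move=> n x _ /=; rewrite lee_fin ger0_norm ?sqr_ge0//.
    rewrite -(real_normK (num_real (g n x))) -(real_normK (num_real (H x))).
    by rewrite ler_pXn2r ?nnegrE.
rewrite integral0 => /fine_cvgP[finn /cvgrPdist_le /(_ eps e0) le].
have [n _ nP] := filterI finn le; exists n; have [nfin] := nP n (leqnn n).
by rewrite /= sub0r normrN -[X in (X <= _)%E]fineK// lee_fin; exact: le_trans (ler_norm _).
Qed.

Section Density.
Context (R : realType) (d : measure_display) (M : metricMeasurableType R d).
Variables (m : {measure set M -> \bar R}) (x0 : M).
Hypothesis hM : metric_measure_space m.
Let borelM := mms_borel hM.
Let sepM := mms_separable hM.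
Local Open Scope ereal_scope.

Lemma Lipc_of_ball (f : M -> R) (L r : R) :
  (forall x y, `|f x - f y| <= L * mdist x y)%R ->
  (forall x, f x != 0%R -> ball x0 r x) -> @Lipc R d M f.
Proof.
move=> fL fr; split; first by exists L.
have r0 : (0 < `|r| + 1)%R by rewrite ltr_wpDl.
apply: (subclosed_compact _ (@mms_compact_ball _ _ _ _ hM x0 _ r0)); first exact: closed_closure.
apply: closure_subset => x /fr; rewrite !ballEmdist /= => xr.
by rewrite (lt_le_trans xr)// ler_wpDr// ler_norm.
Qed.

Definition Lipc_approximable (h : M -> R) := forall eps : R, (0 < eps)%R ->
  exists2 f : M -> R, @Lipc R d M f & sqint m (fun x => h x - f x)%R <= eps%:E.

Lemma Lipc_approximableD (h k : M -> R) :
  measurable_fun setT h -> measurable_fun setT k ->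
  Lipc_approximable h -> Lipc_approximable k -> Lipc_approximable (fun x => h x + k x)%R.
Proof.
move=> mh mk ah ak eps e0; have e4 : (0 < eps / 4)%R by rewrite divr_gt0.
have [f Lf hf] := ah _ e4; have [g Lg kg] := ak _ e4.
have [L [_ [n [L0 _ fL _ fn]]]] := Lipc_bounded x0 Lf.
have [L' [_ [n' [L'0 _ gL _ gn]]]] := Lipc_bounded x0 Lg.
exists (fun x => f x + g x)%R.
  apply: (@Lipc_of_ball _ (L + L')%R (n + n')%:R) => [x y|x fgx].
    rewrite opprD addrACA mulrDl; apply: le_trans (ler_normD _ _) _.
    by rewrite lerD.
  have [fx|/fn] := eqVneq (f x) 0%R; last first.
    by rewrite !ballEmdist /= => /lt_le_trans; apply; rewrite ler_nat leq_addr.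
  have /gn : g x != 0%R by move: fgx; rewrite fx add0r.
  by rewrite !ballEmdist /= => /lt_le_trans; apply; rewrite ler_nat leq_addl.
have mf := Lipc_measurable hM Lf; have mg := Lipc_measurable hM Lg.
rewrite (_ : (fun x => _) = (fun x => (h x - f x) + (k x - g x)))%R; last first.
  by apply/funext => x; rewrite opprD addrACA.
apply: le_trans (sqint_young _ _ _) _; [exact: measurable_funB|exact: measurable_funB|].
have -> : eps%:E = 2%:E * (eps / 4)%:E + 2%:E * (eps / 4)%:E.
  by rewrite -!EFinM -EFinD; congr EFin; field.
by rewrite leeD// lee_wpmul2l.
Qed.

Lemma Lipc_approximableZ (c : R) (h : M -> R) : measurable_fun setT h ->
  Lipc_approximable h -> Lipc_approximable (fun x => c * h x)%R.
Proof.
move=> mh ah eps e0; have c0 : (0 < c ^+ 2 + 1)%R by rewrite ltr_wpDl ?sqr_ge0.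
have [f Lf hf] := ah (eps / (c ^+ 2 + 1))%R (divr_gt0 e0 c0).
have [L [_ [n [L0 _ fL _ fn]]]] := Lipc_bounded x0 Lf.
exists (fun x => c * f x)%R.
  apply: (@Lipc_of_ball _ (`|c| * L)%R n%:R) => [x y|x].
    by rewrite -mulrBr normrM -mulrA ler_wpM2l.
  by rewrite mulf_eq0 negb_or => /andP[_ /fn].
have mf := Lipc_measurable hM Lf.
rewrite [X in X <= _](_ : _ = (c ^+ 2)%:E * sqint m (fun x => h x - f x)%R); last first.
  rewrite -ge0_integralZ_EFin ?sqr_ge0//.
  - by apply: eq_integral => x _; rewrite -mulrBr exprMn.
  - by apply: measurable_funX; exact: measurable_funB.
  - by move=> x; exact: sqr_ge0.
apply: le_trans (lee_wpmul2l _ hf) _; first by rewrite lee_fin sqr_ge0.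
rewrite -EFinM lee_fin mulrCA ler_piMr ?(ltW e0)//.
by rewrite ler_pdivrMr// mul1r lerDl.
Qed.

Lemma Lipc_approximable_lim (h : M -> R) : measurable_fun setT h ->
  (forall eps : R, (0 < eps)%R -> exists k : M -> R, [/\ measurable_fun setT k,
     Lipc_approximable k & sqint m (fun x => h x - k x)%R <= eps%:E]) ->
  Lipc_approximable h.
Proof.
move=> mh ah eps e0; have e4 : (0 < eps / 4)%R by rewrite divr_gt0.
have [k [mk ak hk]] := ah _ e4; have [f Lf kf] := ak _ e4.
have mf := Lipc_measurable hM Lf; exists f => //.
rewrite (_ : (fun x => _) = (fun x => (h x - k x) + (k x - f x)))%R; last first.
  by apply/funext => x; rewrite addrA subrK.
apply: le_trans (sqint_young _ _ _) _; [exact: measurable_funB|exact: measurable_funB|].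
have -> : eps%:E = 2%:E * (eps / 4)%:E + 2%:E * (eps / 4)%:E.
  by rewrite -!EFinM -EFinD; congr EFin; field.
by rewrite leeD// lee_wpmul2l.
Qed.

Lemma Lipc_approximable0 : Lipc_approximable (fun=> 0%R).
Proof.
move=> eps e0; exists (fun=> 0%R).
  by apply: (@Lipc_of_ball _ 0%R 0%R) => [x y|x]; rewrite ?subrr ?normr0 ?mul0r// eqxx.
by rewrite /sqint integral0_eq ?lee_fin ?(ltW e0)// => x _; rewrite subrr expr0n.
Qed.

(* The truncated distance min(1, n d(x, ~O)) to the complement of O, written as an infimum
   that equals 1 when O is the whole space. *)
Let tent (O : set M) (n : nat) (x : M) : R :=
  inf ([set 1%R] `|` [set n%:R * mdist x y | y in ~` O]%R)%classic.

Let tent_lb (O : set M) n (x : M) : has_lbound (([set 1%R] `|` [set n%:R * mdist x y | y in ~`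
  O]%R)%classic : set R).
Proof. by exists 0%R => _ [->//|[y _ <-]]; rewrite mulr_ge0 ?mdist_ge0. Qed.

Let tent_le1 (O : set M) n (x : M) : (tent O n x <= 1)%R.
Proof. by apply: ge_inf; [exact: tent_lb|left]. Qed.

Let le_tent (O : set M) n (x : M) (c : R) : (c <= 1)%R ->
  (forall y, ~ O y -> c <= n%:R * mdist x y)%R -> (c <= tent O n x)%R.
Proof.
move=> c1 cO; apply: lb_le_inf; first by exists 1%R; left.
by move=> _ [->//|[y nOy <-]]; exact: cO.
Qed.

Let tent_ge0 (O : set M) n (x : M) : (0 <= tent O n x)%R.
Proof. by apply: le_tent => // y _; rewrite mulr_ge0 ?mdist_ge0. Qed.

Let tent_out (O : set M) n (x : M) : ~ O x -> tent O n x = 0%R.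
Proof.
move=> nOx; apply/eqP; rewrite eq_le tent_ge0 andbT.
rewrite -[leRHS](mulr0 n%:R) -(mdistxx x); apply: ge_inf; first exact: tent_lb.
by right; exists x.
Qed.

Let tent_lip1 (O : set M) n (x y : M) : (tent O n x - n%:R * mdist x y <= tent O n y)%R.
Proof.
apply: le_tent => [|z nOz].
  rewrite lerBlDr; apply: le_trans (tent_le1 O n x) _.
  by rewrite lerDl mulr_ge0 ?mdist_ge0.
have : (tent O n x <= n%:R * mdist x z)%R.
  by apply: ge_inf; [exact: tent_lb|right; exists z].
have := metric_triangle x y z; have : (0 <= n%:R :> R)%R by [].
nra.
Qed.

Let tent_lip (O : set M) n (x y : M) : (`|tent O n x - tent O n y| <= n%:R * mdist x y)%R.
Proof.
have := tent_lip1 O n x y; have := tent_lip1 O n y x; rewrite (metric_sym y x).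
by rewrite ler_norml => *; apply/andP; split; lra.
Qed.

(** The intersection with a ball of radius n + 1 bounds the support, which is then compact even if
    [O] is unbounded. *)
Let bump (O : set M) (n : nat) : M -> R := tent (O `&` ball x0 (n.+1%:R : R)) n.

Let bump_out O n x : ~ O x -> bump O n x = 0%R.
Proof. by move=> nOx; apply: tent_out => -[]. Qed.

Let Lipc_bump O n : @Lipc R d M (bump O n).
Proof.
apply: Lipc_of_ball (tent_lip _ n) _ => x nz; apply: contrapT => nx.
by move: nz; rewrite /bump tent_out ?eqxx// => -[_ /nx].
Qed.

Let bump_cvg (O : set M) (x : M) : open O -> bump O n x @[n --> \oo] --> (\1_O x : R).
Proof.
move=> oO; rewrite indicE; have [/set_mem Ox|/negP nOx] := boolP (x \in O); last first.
  rewrite (_ : (fun n => _) = fun=> 0%R); first exact: cvg_cst.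
  by apply/funext => n; apply: bump_out => Ox; apply: nOx; exact: mem_set.
have /nbhs_ballP[e /= e0 xe] : nbhs x O by exact: open_nbhs_nbhs.
(* For B(x, e) inside [O], n is taken with n e >= 1 and d(x0, x) <= n. A point at distance at least
   e or at least 1 from x then contributes at least 1 to the infimum, and a nearer one lies in [O]
   and in B(x0, n + 1), hence does not compete. *)
apply: cvg_near_cst; exists (Num.bound e^-1 + Num.bound (mdist x0 x)).+1 => // n /= nP.
have en : (e^-1 <= n%:R)%R.
  apply: (@le_trans _ _ (Num.bound e^-1)%:R).
    by apply/ltW/archi_boundP; rewrite invr_ge0 ltW.
  by rewrite ler_nat (leq_trans _ nP)// leqW// leq_addr.
have xn : (mdist x0 x <= n%:R)%R.
  apply: (@le_trans _ _ (Num.bound (mdist x0 x))%:R); first exact/ltW/archi_boundP/mdist_ge0.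
  by rewrite ler_nat (leq_trans _ nP)// leqW// leq_addl.
have n1 : (1 <= n%:R :> R)%R by rewrite ler1n (leq_trans _ nP).
apply/eqP; rewrite eq_le tent_le1; apply: le_tent => // y nOy.
have [ey|ye] := leP e (mdist x y).
  by rewrite -[leLHS](mulVf (lt0r_neq0 e0)) ler_pM ?invr_ge0 ?(ltW e0).
have [xy1|yx1] := leP 1%R (mdist x y); first by rewrite -[leLHS]mulr1 ler_pM.
exfalso; apply: nOy; split; first by apply: xe; rewrite ballEmdist.
rewrite ballEmdist /= -natr1; apply: le_lt_trans (metric_triangle x0 x y) _; exact: ler_ltD.
Qed.

Lemma indic_square_integrable (A : set M) : measurable A -> m A < +oo ->
  square_integrable m (\1_A : M -> R).
Proof.
move=> mA Aoo; split; first exact: measurable_indic.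
rewrite /sqint (eq_integral (fun x => (\1_A x : R)%:E)); last first.
  by move=> x _; rewrite indicE; case: (x \in A); rewrite ?expr1n ?expr0n.
by rewrite integral_indic// setIT.
Qed.

Lemma Lipc_approximable_open (O : set M) : open O -> m O < +oo ->
  Lipc_approximable (\1_O : M -> R).
Proof.
move=> oO Ooo eps e0; have mO := open_measurableM borelM oO.
have mbump n : measurable_fun setT (bump O n) by exact: (Lipc_measurable hM (Lipc_bump O n)).
have le1 n x : (`|\1_O x - bump O n x| <= `|\1_O x : R|)%R.
  rewrite !indicE; have [xO|/negP nOx] := boolP (x \in O).
    by rewrite normr1 ger0_norm ?subr_ge0 ?tent_le1// lerBlDr lerDl; exact: tent_ge0.
  by rewrite bump_out ?subr0 ?normr0// => /mem_set.
have lim x : (\1_O x - bump O n x)%R @[n --> \oo] --> (0%R : R).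
  rewrite -(subrr (\1_O x : R)); apply: cvgB; first exact: cvg_cst.
  exact: bump_cvg.
have mdiff n : measurable_fun setT (fun x => \1_O x - bump O n x)%R.
  by apply: measurable_funB => //; exact: measurable_indic.
have [n nP] := sqint_dominated mdiff (indic_square_integrable mO Ooo) le1 lim e0.
by exists (bump O n).
Qed.

(** Outer regularity of the Radon measure gives an open [O] containing [A] with m(O \ A) small, and
    the squared distance of the two indicators is that measure. *)
Lemma Lipc_approximable_indic (A : set M) : measurable A -> m A < +oo ->
  Lipc_approximable (\1_A : M -> R).
Proof.
move=> mA Aoo; apply: Lipc_approximable_lim; first exact: measurable_indic.
move=> eps e0; have [_ outer _] := mms_radon hM.
have Afin : m A \is a fin_num by rewrite ge0_fin_numE.
have [|z [ O [oO AO] <-]] := @lb_ereal_inf_adherent R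
  [set m O | O in [set O | open O /\ A `<=` O]] eps e0; first by rewrite -outer.
rewrite -outer// => OA; have mO := open_measurableM borelM oO.
have Ooo : m O < +oo by apply: lt_le_trans OA _; rewrite leey.
exists \1_O; split; [exact: measurable_indic|exact: Lipc_approximable_open|].
have mD : measurable (O `\` A) by exact: measurableD.
rewrite /sqint (eq_integral (fun x => (\1_(O `\` A) x : R)%:E)); last first.
  move=> x _; rewrite !indicE in_setD; have [xA|xA] := boolP (x \in A).
    by rewrite (mem_set (AO _ (set_mem xA))) /= subrr expr0n.
  by rewrite andbT sub0r sqrrN; case: (x \in O); rewrite ?expr1n ?expr0n.
rewrite integral_indic// setIT measureD// (setIidr AO).
by rewrite leeBlDr// addeC ltW.
Qed.

Import HBNNSimple.

(** A level set at height y <> 0 has finite measure since y^2 m(s = y) <= [sqint m s]; the level set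
    at 0 may be infinite but enters with coefficient 0. *)
Lemma Lipc_approximable_nnsfun (s : {nnsfun M >-> R}) : sqint m s < +oo ->
  Lipc_approximable s.
Proof.
move=> soo; have mlev y : measurable (s @^-1` [set y]) by exact: measurable_sfunP.
have lev y : Lipc_approximable (fun x => y * \1_(s @^-1` [set y]) x)%R.
  have [->|y0] := eqVneq y 0%R.
    by rewrite (_ : (fun x => _) = fun=> 0%R) => [|]; [exact: Lipc_approximable0|
      apply/funext => x; rewrite mul0r].
  apply: Lipc_approximableZ; first exact: measurable_indic.
  apply: Lipc_approximable_indic => //.
  have y2 : (0 < y ^+ 2)%R by rewrite exprn_even_gt0.
  have : (y ^+ 2)%:E * m (s @^-1` [set y]) <= sqint m s.
    rewrite -[X in _ * m X]setIT -integral_indic// -ge0_integralZ_EFin ?(ltW y2)//.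
    apply: ge0_le_integral_EFin.
    - by apply: measurable_funM => //; exact: measurable_indic.
    - exact: measurable_funX.
    - by move=> x; rewrite mulr_ge0 ?(ltW y2).
    - move=> x; rewrite indicE; have [/set_mem/= ->|_] := boolP (x \in _).
        by rewrite mulr1.
      by rewrite mulr0 sqr_ge0.
  case: (m _) => [r _|+|//]; first by rewrite ltry.
  by rewrite gt0_muley ?lte_fin// leye_eq => /eqP soo'; rewrite soo' in soo.
rewrite (_ : (s : M -> R) = fun x =>
    (\sum_(y <- finmap.enum_fset (fset_set (range s))) y * \1_(s @^-1` [set y]) x)%R); last first.
  by apply/funext => x; rewrite fimfunE fsbig_finite.
move: (finmap.enum_fset (fset_set (range s))) => l; elim: l => [|y l IH].
  rewrite (_ : (fun x => _) = fun=> 0%R); first exact: Lipc_approximable0.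
  by apply/funext => x; rewrite big_nil.
rewrite (_ : (fun x => _) = fun x => (y * \1_(s @^-1` [set y]) x +
    \sum_(y <- l) y * \1_(s @^-1` [set y]) x)%R); last first.
  by apply/funext => x; rewrite big_cons.
apply: Lipc_approximableD => //.
- by apply: measurable_funM => //; exact: measurable_indic.
- apply: measurable_sum => y'; apply: measurable_funM => //; exact: measurable_indic.
Qed.

Lemma Lipc_approximable_ge0 (h : M -> R) : square_integrable m h ->
  (forall x, (0 <= h x)%R) -> Lipc_approximable h.
Proof.
move=> [mh hoo] h0; apply: Lipc_approximable_lim => // eps e0.
have mhE : measurable_fun setT (EFin \o h) by exact/measurable_EFinP.
pose s := nnsfun_approx measurableT mhE.
have cs x : s n x @[n --> \oo] --> h x.
  have /fine_cvgP[_] := @cvg_nnsfun_approx _ _ _ _ measurableT _ mhE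
    (fun x _ => h0 x) x I.
  by [].
have sh n x : (s n x <= h x)%R.
  rewrite -(cvg_lim _ (cs x))//; apply: nondecreasing_cvgn_le.
    by move=> p q pq; exact/lefP/nd_nnsfun_approx.
  by apply/cvg_ex; exists (h x); exact: cs.
have [n sn] : exists n, sqint m (fun x => h x - s n x)%R <= eps%:E.
  apply: (@sqint_dominated _ _ _ m (fun n x => h x - s n x)%R h) => //.
  - by move=> n; exact: measurable_funB.
  - move=> n x; rewrite !ger0_norm ?subr_ge0// lerBlDr lerDl; exact: fun_ge0.
  - by move=> x; rewrite -(subrr (h x)); apply: cvgB; [exact: cvg_cst|exact: cs].
exists (s n); split => //; apply: Lipc_approximable_nnsfun.
apply: le_lt_trans hoo; apply: ge0_le_integral_EFin.
- exact: measurable_funX.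
- exact: measurable_funX.
- by move=> x; exact: sqr_ge0.
- by move=> x; rewrite ler_pXn2r ?nnegrE//; exact: fun_ge0.
Qed.

Lemma Lipc_dense (h : M -> R) : square_integrable m h -> Lipc_approximable h.
Proof.
move=> [mh hoo]; have part (c : R) : (`|c| = 1)%R ->
    square_integrable m (fun x => Num.max (c * h x)%R 0%R).
  move=> c1; split; first by apply: measurable_maxr => //; exact: measurable_funM.
  apply: le_lt_trans hoo; apply: ge0_le_integral_EFin.
  - by apply: measurable_funX; apply: measurable_maxr => //; exact: measurable_funM.
  - exact: measurable_funX.
  - by move=> x; exact: sqr_ge0.
  - move=> x; case: (leP (c * h x)%R 0%R) => _; first by rewrite expr0n sqr_ge0.
    by rewrite exprMn -(real_normK (num_real c)) c1 expr1n mul1r.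
have hE : h = (fun x => Num.max (1 * h x) 0 + (-1) * Num.max (- 1 * h x) 0)%R.
  apply/funext => x; rewrite !mulN1r mul1r; have /orP[h0|h0] := le_total 0%R (h x).
    by rewrite max_l// max_r ?oppr_le0// subr0.
  by rewrite max_r// max_l ?oppr_ge0// add0r opprK.
have p1 := part 1%R (normr1 _); have p2 : square_integrable m (fun x => Num.max (- 1 * h x)%R 0%R).
  by apply: part; rewrite normrN1.
rewrite hE; apply: Lipc_approximableD.
- by case: p1.
- by apply: measurable_funM => //; case: p2.
- by apply: Lipc_approximable_ge0 => // x; rewrite le_max lexx orbT.
- apply: Lipc_approximableZ; first by case: p2.
  by apply: Lipc_approximable_ge0 => // x; rewrite le_max lexx orbT.
Qed.

End Density.

(** * The approximating graphs *)

Section GraphDistance.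
Context (R : realType) (M : choiceType) (B : rel M).

(** Connectedness makes the set of path lengths nonempty, without which its real infimum would be 0;
    a path of length 0 has equal ends. *)
Lemma graph_dist_ge1 (V : set M) (x y : M) : connected_graph V B ->
  V x -> V y -> x <> y -> 1 <= graph_dist R B x y.
Proof.
move=> cB Vx Vy xy; have [p Bp xpy] := cB x y Vx Vy.
apply: lb_le_inf; first by exists (size p)%:R, p.
move=> _ [[|z q] [_ xq] <-] /=; first by exfalso; apply: xy; rewrite -xq.
by rewrite ler1n.
Qed.

End GraphDistance.

(** * Truncated discrete forms as weighted integrals *)

Section TruncatedWeight.
Context (R : realType) (d : measure_display) (M : metricMeasurableType R d).
Variables (m : {measure set M -> \bar R}) (A : set M) (r : R) (c : M -> M -> R).
Local Open Scope ereal_scope.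

Definition trunc_weight (p : M * M) : R := (\1_(trunc_set A r p.1) p.2 * c p.1 p.2)%R.

Lemma truncated_discrete_energyE (f : M -> R) : (forall z w, c z w = c w z) ->
  truncated_discrete_energy m c A r f = 2^-1%:E * quad (weight_form m trunc_weight) f.
Proof.
move=> csym; congr (_ * _); rewrite integral_mkcond; apply: eq_integral => z _.
rewrite patchE; have [/set_mem Az|/negP Az] := boolP (z \in A); last first.
  rewrite integral0_eq// => w _; rewrite /trunc_weight /= indicE memNset ?mul0r ?mulr0//.
  by move=> [/mem_set].
rewrite [LHS]integral_mkcond; apply: eq_integral => w _.
rewrite patchE /trunc_weight /= indicE (_ : (w \in _) = (w \in trunc_set A r z)); last first.
  by apply/idP/idP => /set_mem zw; apply: mem_set; move: zw => /=; [case|case].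
case: ifPn => _ /=; last by rewrite mul0r mulr0.
by rewrite mul1r csym -sqrrN opprB.
Qed.

Hypotheses (borelM : borel_sigma_algebra M) (sepM : separable M) (mA : measurable A).

Lemma measurable_trunc_weight : measurable_fun setT (fun p : M * M => c p.1 p.2) ->
  measurable_fun setT trunc_weight.
Proof.
move=> mc; apply: measurable_funM => //.
have [A0|/set0P[x0 Ax0]] := eqVneq A set0.
  rewrite (_ : (fun p => _) = cst 0%R); first exact: measurable_cst.
  by apply/funext => p; rewrite indicE memNset// /trunc_set A0 => -[].
rewrite (_ : (fun p => _) = \1_((A `*` A) `&` [set p | (r < mdist p.1 p.2)%R])).
  apply: measurable_indic; apply: measurableI; first exact: measurableX.
  exact: measurable_far.
apply/funext => p; rewrite !indicE; congr (_%:R); congr nat_of_bool.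
by apply/idP/idP => /set_mem pS; apply: mem_set; move: pS => /=; [case|case; case].
Qed.

Lemma trunc_weight_ge0 p : (forall z w, (0 <= c z w)%R) -> (0 <= trunc_weight p)%R.
Proof. by move=> c0; rewrite mulr_ge0. Qed.

Lemma trunc_weight_sym z w : (forall z w, c z w = c w z) ->
  trunc_weight (z, w) = trunc_weight (w, z).
Proof.
move=> csym; rewrite /trunc_weight /= csym !indicE; congr (_%:R * _)%R; congr nat_of_bool.
by apply/idP/idP => /set_mem pS; apply: mem_set; move: pS; rewrite /trunc_set /= metric_sym;
  case.
Qed.

End TruncatedWeight.

Section ApproximatingGraphs.
Context (R : realType) (d : measure_display) (M : metricMeasurableType R d).
Variables (m : {measure set M -> \bar R}) (x0 : M).
Variables (V : nat -> set M) (B : nat -> rel M) (U : nat -> M -> set M).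
Hypotheses (hM : metric_measure_space m) (hG : approximating_graphs m V B U).
Let borelM := mms_borel hM.
Let sepM := mms_separable hM.
Let sfm := metric_measure_sigma_finite x0 hM.
Local Open Scope ereal_scope.

(** Graph distances between distinct vertices are at least 1, which (AG.2) turns into a separation
    of order 1/k. It yields both the countability of V_k and the radius at which reverse doubling
    starts. *)
Lemma vertices_separated : exists2 C1 : R, (0 < C1)%R & forall k x y, (0 < k)%N ->
  V k x -> V k y -> x <> y -> (C1 / k%:R <= mdist x y)%R.
Proof.
have [C1 [C2 [C10 C20 dist]]] := ag_dist hG; exists C1 => // k x y k0 Vx Vy xy.
have /andP[le _] := dist k x y k0 Vx Vy; apply: le_trans le.
rewrite ler_peMr ?divr_ge0 ?(ltW C10)//.
exact: graph_dist_ge1 (ag_connected hG k0) Vx Vy xy.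
Qed.

(** Each vertex is sent to a dense point within C1/(2k); two vertices with the same image would
    violate the separation. *)
Lemma countable_vertices k : (0 < k)%N -> countable (V k).
Proof.
move=> k0; have [C1 C10 sep] := vertices_separated.
have [p pd] := dense_seq sepM x0.
have e0 : (0 < C1 / k%:R / 2)%R by rewrite !divr_gt0// ltr0n.
pose f x := projT1 (cid (pd x _ e0)).
have fP x : (mdist x (p (f x)) < C1 / k%:R / 2)%R by rewrite /f; case: cid.
apply/countable_injP; exists f => x y /set_mem Vx /set_mem Vy fxy.
apply: contrapT => xy; have := sep k x y k0 Vx Vy xy.
have := fP x; have := fP y; rewrite -fxy => py px.
have := metric_triangle x (p (f x)) y; rewrite (metric_sym (p (f x)) y).
lra.
Qed.

(** The volume comparison of (AG.3) carries positivity and finiteness from balls to cells: the bound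
    with C5 excludes measure 0, the bound with C4 excludes infinite measure. *)
Lemma graph_cells k : (0 < k)%N -> cell_partition m (V k) (U k).
Proof.
move=> k0; split.
- exact: countable_vertices.
- by move=> x Vx; exact: (ag_cell hG k0 Vx).
- exact: (ag_cover hG k0).
- by move=> x y Vx Vy xy; exact: (ag_disjoint hG k0 Vx Vy xy).
- move=> x Vx; have [C4 [C5 [C40 C50 vol]]] := ag_cell_volume hG.
  have /andP[le ge] := vol k x k0 Vx.
  have kV0 : (0 < k%:R^-1 :> R)%R by rewrite invr_gt0 ltr0n.
  have /andP[b0 boo] := mms_volume hM x kV0; apply/andP; split.
    rewrite lt0e measure_ge0 andbT; apply/negP => /eqP U0.
    by move: (lt_le_trans b0 ge); rewrite U0 mule0 ltxx.
  case: (m (U k x)) le => [r _|+|//]; first by rewrite ltry.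
  by rewrite gt0_muley ?lte_fin// leye_eq => /eqP bE; rewrite bE in boo.
Qed.

Lemma vertex_in_cell k x : (0 < k)%N -> V k x -> U k x x.
Proof.
move=> k0 Vx; have : (V k `&` (U k x)°) x by rewrite (ag_interior hG k0 Vx).
by move=> [_ /interior_subset].
Qed.

Lemma average_lipschitz (f : M -> R) (L D : R) k x z : (0 < k)%N -> V k x -> (0 <= L)%R ->
  square_integrable m f -> (forall x y, `|f x - f y| <= L * mdist x y)%R ->
  (forall w, U k x w -> mdist z w <= D)%R ->
  (`|f z - average m (U k) f x| <= L * D)%R.
Proof.
move=> k0 Vx L0 f2 fL zD; apply: (average_dist_le (graph_cells k0) Vx f2) => w Uw.
by apply: le_trans (fL z w) _; rewrite ler_wpM2l// zD.
Qed.

(** If z lies outside the larger ball, its whole cell misses the support, and the average of the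
    zero function vanishes. *)
Lemma extend_average_support (f : M -> R) (C3 r : R) k z : (0 < k)%N ->
  square_integrable m f ->
  (forall k x, (0 < k)%N -> V k x ->
     forall xi eta, U k x xi -> U k x eta -> (mdist xi eta <= C3 / k%:R)%R) ->
  (forall x, f x != 0%R -> ball x0 r x) ->
  extend (V k) (U k) (average m (U k) f) z != 0%R -> ball x0 (r + C3 / k%:R) z.
Proof.
move=> k0 f2 diam fr; have cells := graph_cells k0.
have [[x Vx xz]|nz] := coreP (V k) (U k) z; last by rewrite extend_overlap// eqxx.
rewrite (extend_core _ Vx xz) => av0; apply: contrapT => nb.
move/negP : av0; apply; rewrite -normr_le0 -normrN -sub0r.
apply: (average_dist_le cells Vx f2) => w Uw; rewrite sub0r normrN normr_le0.
apply: contrapT => /negP /fr; rewrite ballEmdist /= => xw.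
apply: nb; rewrite ballEmdist /=; have := diam k x k0 Vx w z Uw (core_sub xz).
by have := metric_triangle x0 w z; lra.
Qed.

Lemma Lipc_average_cvg (f : M -> R) : @Lipc R d M f -> forall eps : R, (0 < eps)%R ->
  exists2 N : nat, (0 < N)%N & forall k, (N <= k)%N ->
    sqint m (fun x => f x - extend (V k) (U k) (average m (U k) f) x)%R <= eps%:E.
Proof.
move=> fLip eps e0; have [L [G [n [L0 G0 fL _ fn]]]] := Lipc_bounded x0 fLip.
have [C3 C30 diam] := ag_diam hG; have f2 := Lipc_square_integrable x0 hM fLip.
(* This ball contains the support of [f] and of all its averages, because C3/k <= C3. *)
pose A := ball x0 (n%:R + C3)%R; have mA : measurable A by exact: measurable_mball.
have Afin : m A \is a fin_num by rewrite ge0_fin_numE ?ball_lty.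
pose a := fine (m A); have a0 : (0 <= a)%R by exact: fine_ge0.
pose c := ((L * C3) ^+ 2 * a)%R; have c0 : (0 <= c)%R by rewrite mulr_ge0 ?sqr_ge0.
(* The error is at most c / k^2 <= c / k, so k >= c / eps suffices. *)
exists (Num.bound (c / eps)).+1 => // k Nk; have k0 : (0 < k)%N by exact: leq_trans Nk.
have k1 : (1 <= k%:R :> R)%R by rewrite ler1n.
have kc : (c / eps <= k%:R)%R.
  apply: ltW; apply: (@lt_le_trans _ _ (Num.bound (c / eps))%:R).
    by apply: archi_boundP; rewrite divr_ge0 ?(ltW e0).
  by rewrite ler_nat ltnW.
have cells := graph_cells k0; have mov := measurable_overlap cells.
set E := extend _ _ _; have mE : measurable_fun setT E by exact: (measurable_extend cells).
have mf : measurable_fun setT f by case: f2.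
have mfE : measurable_fun setT (fun x => (f x - E x) ^+ 2)%R.
  by apply: measurable_funX; exact: measurable_funB.
rewrite /sqint (ge0_negligible_integral mov)//; last 3 first.
- exact/measurable_EFinP.
- by move=> x _; rewrite lee_fin sqr_ge0.
- exact: (measure_overlap cells).
apply: (@le_trans _ _ (\int[m]_x ((L * C3 / k%:R) ^+ 2 * \1_A x)%:E)); last first.
  rewrite ge0_integralZ_EFin ?sqr_ge0// integral_indic// setIT -(fineK Afin) -EFinM lee_fin.
  rewrite expr_div_n mulrAC -/c ler_pdivrMr ?exprn_gt0 ?(lt_le_trans _ k1)//.
  rewrite ler_pdivrMr// in kc; apply: le_trans kc _; rewrite mulrC ler_pM2l// expr2.
  by rewrite ler_peMl// (le_trans _ k1).
have m2 : measurable_fun setT (fun x => ((L * C3 / k%:R) ^+ 2 * \1_A x)%:E).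
  by apply/measurable_EFinP; apply: measurable_funM => //; exact: measurable_indic.
apply: (@le_trans _ _ (\int[m]_(x in setT `\` overlap (V k) (U k))
   ((L * C3 / k%:R) ^+ 2 * \1_A x)%:E)); last first.
  apply: ge0_subset_integral => //.
  - exact: measurableD.
  - by move=> x _; rewrite lee_fin mulr_ge0 ?sqr_ge0.
apply: ge0_le_integral.
- exact: measurableD.
- by move=> x _; rewrite lee_fin sqr_ge0.
- by apply: measurable_funTS; exact/measurable_EFinP.
- exact: measurable_funTS.
move=> z [_ nz]; rewrite lee_fin.
have [[x Vx xz]|//] := coreP (V k) (U k) z.
have le : (`|f z - E z| <= L * (C3 / k%:R))%R.
  rewrite /E (extend_core _ Vx xz); apply: average_lipschitz => // w Uw.
  exact: diam k x k0 Vx z w (core_sub xz) Uw.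
have [zA|zA] := pselect (A z).
  rewrite indicE mem_set// mulr1 -(real_normK (num_real _)) -mulrA.
  by rewrite ler_pXn2r ?nnegrE// (le_trans _ le).
suff -> : (f z - E z = 0)%R by rewrite expr0n mulr_ge0 ?sqr_ge0.
have C3k : (C3 / k%:R <= C3)%R by rewrite ler_pdivrMr ?(lt_le_trans _ k1)// ler_peMr ?(ltW C30).
have -> : f z = 0%R.
  apply/eqP; apply: contrapT => /negP /fn; rewrite ballEmdist /= => xz0.
  by apply: zA; rewrite /A ballEmdist /=; lra.
have -> : E z = 0%R; last by rewrite subr0.
apply/eqP; apply: contrapT => /negP /(extend_average_support k0 f2 diam fn).
by rewrite ballEmdist /= => xz0; apply: zA; rewrite /A ballEmdist /=; lra.
Qed.

Lemma extend_average_cvg (f : M -> R) : square_integrable m f ->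
  forall eps : R, (0 < eps)%R -> exists2 N : nat, (0 < N)%N & forall k, (N <= k)%N ->
    sqint m (fun x => f x - extend (V k) (U k) (average m (U k) f) x)%R <= eps%:E.
Proof.
(* Two uses of [sqint_young] give 2 + 2 (2 + 2) = 10. *)
move=> f2 eps e0; have e1 : (0 < eps / 10)%R by rewrite divr_gt0.
have [g gL fg] := Lipc_dense x0 hM f2 e1.
have [N N0 gN] := Lipc_average_cvg gL e1; exists N => // k Nk.
have k0 : (0 < k)%N by exact: leq_trans Nk.
have cells := graph_cells k0; have g2 := Lipc_square_integrable x0 hM gL.
have [mf _] := f2; have [mg _] := g2.
have fg2 : square_integrable m (fun x => f x - g x)%R.
  by split; [exact: measurable_funB|exact: le_lt_trans fg (ltry _)].
set E := extend (V k) (U k).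
have mE h : measurable_fun setT (E h) by exact: (measurable_extend cells).
rewrite (_ : (fun x => _) = (fun x => (f x - g x) +
    ((g x - E (average m (U k) g) x) + (-1) * E (average m (U k) (fun z => f z - g z)) x)))%R;
      last first.
  by apply/funext => x; rewrite /E (extend_averageB cells)//; ring.
have mfg : measurable_fun setT (fun x => f x - g x)%R by exact: measurable_funB.
have mgE : measurable_fun setT (fun x => g x - E (average m (U k) g) x)%R by exact: measurable_funB.
have mNE : measurable_fun setT (fun x => -1 * E (average m (U k) (fun z => f z - g z)) x)%R.
  exact: measurable_funM.
apply: le_trans (sqint_young _ mfg (measurable_funD mgE mNE)) _.
have := sqint_young m mgE mNE.
have -> : sqint m (fun x => -1 * E (average m (U k) (fun z => f z - g z)) x)%R =
    sqint m (E (average m (U k) (fun z => f z - g z)))%R.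
  by apply: eq_integral => x _; rewrite mulN1r sqrrN.
move=> le2; have le3 := le_trans (sqint_extend_average cells fg2) fg.
have le4 : sqint m (fun x => g x - E (average m (U k) g) x
      + -1 * E (average m (U k) (fun z => f z - g z)) x)%R <= 2%:E * (eps / 10)%:E + 2%:E * (eps
        / 10)%:E.
  by apply: le_trans le2 _; rewrite leeD// lee_wpmul2l// gN.
apply: (@le_trans _ _ (2%:E * (eps / 10)%:E + 2%:E * (2%:E * (eps / 10)%:E + 2%:E * (eps / 10)%:E))).
  by rewrite leeD// lee_wpmul2l.
by rewrite -!EFinM lee_fin; lra.
Qed.

Variable C : nat -> M -> M -> R.
Hypotheses (hC : conductances V C) (hA1a : A1a m x0 V B U C).
Local Notation Br n := (ball x0 (n%:R : R)).
Local Notation Cbar k := (extend2 (V k) (U k) (C k)).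

Lemma Cbar_ge0 k z w : (0 < k)%N -> (0 <= Cbar k z w)%R.
Proof. by move=> k0; apply: extend2_ge0 => x y Vx Vy; have [] := hC k0 Vx Vy. Qed.

Lemma Cbar_sym k z w : (0 < k)%N -> Cbar k z w = Cbar k w z.
Proof. by move=> k0; apply: extend2_sym => x y Vx Vy; have [] := hC k0 Vx Vy. Qed.

Lemma measurable_Cbar k : (0 < k)%N ->
  measurable_fun setT (fun p : M * M => Cbar k p.1 p.2).
Proof. by move=> k0; exact: (measurable_extend2 (graph_cells k0)). Qed.

(** Replacing z and w by the vertices x and y of their cells keeps the distance above r/2 for large
    k, hence rho_k(x, y)/k >= r/(2 C2) by (AG.2). The factor in (A1a) is then at least [b], and the
    mass is at most the bound of (A1a) divided by [b]. *)
Lemma trunc_weight_bound (I : nat) (r : R) : (0 < r)%R ->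
  exists Lam : R, (0 <= Lam)%R /\ exists2 N : nat, (0 < N)%N & forall k, (N <= k)%N ->
    forall z, \int[m]_w (trunc_weight (Br I) r (Cbar k) (z, w))%:E <= Lam%:E.
Proof.
move=> r0; have [k0 k01 bnd] := hA1a.
have [S S0 SP] : exists2 S : R, (0 <= S)%R & forall k x, (k0 <= k)%N -> V k x ->
    Br I.+1 x -> \esum_(y in V k)
      ((C k x y * Num.min (graph_dist R (B k) x y / k%:R) 1 ^+ 2)%R%:E * m (U k y)) <= S%:E.
  have := bnd I.+1 isT; set s := ereal_sup _ => soo.
  have le k x : (k0 <= k)%N -> V k x -> Br I.+1 x -> \esum_(y in V k)
      ((C k x y * Num.min (graph_dist R (B k) x y / k%:R) 1 ^+ 2)%R%:E * m (U k y)) <= s.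
    move=> kk Vx Bx; apply: le_ereal_sup_tmp.
    exists (ereal_sup [set \esum_(y in V k)
      ((C k x y * Num.min (graph_dist R (B k) x y / k%:R) 1 ^+ 2)%R%:E * m (U k y))
        | x in closure (Br I.+1) `&` V k]); first by exists k.
    by apply: ereal_sup_ubound; exists x => //; split => //; exact: subset_closure.
  exists (Num.max (fine s) 0%R); first by rewrite le_max lexx orbT.
  move=> k x kk Vx Bx; apply: le_trans (le k x kk Vx Bx) _.
  have : s \is a fin_num.
    rewrite fin_real// soo andbT; apply: lt_le_trans (le k x kk Vx Bx).
    apply: (@lt_le_trans _ _ 0) => //.
    apply: esum_ge0 => y Vy; rewrite mule_ge0 ?lee_fin// mulr_ge0 ?sqr_ge0//.
    by have [_] := hC (leq_trans k01 kk) Vx Vy.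
  by move=> sfin; rewrite -{1}(fineK sfin) lee_fin le_max lexx.
have [C1 [C2 [C10 C20 dist]]] := ag_dist hG; have [C3 C30 diam] := ag_diam hG.
pose b := (Num.min (r / 2 / C2) 1 ^+ 2)%R.
have b0 : (0 < b)%R by rewrite exprn_gt0// lt_min ltr01 !divr_gt0.
exists (b^-1 * S)%R; split; first by rewrite mulr_ge0 ?invr_ge0 ?(ltW b0).
(* C3/k <= 1 places the vertex of a point of B_I in B_(I+1); 4 C3/k <= r makes the passage to
   vertices cost at most r/2 in distance. *)
pose N := (maxn k0 (maxn (Num.bound C3) (Num.bound (4 * C3 / r)%R)))%N.
exists N; first by rewrite leq_max k01.
move=> k; rewrite !geq_max => /and3P[kk kC kr] z; have kpos := leq_trans k01 kk.
have kpos' : (0 < k%:R :> R)%R by rewrite ltr0n.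
have C3k : (C3 / k%:R <= 1)%R.
  rewrite ler_pdivrMr// mul1r ltW//; apply: lt_le_trans (_ : (Num.bound C3)%:R <= _)%R.
    by apply: archi_boundP; exact: ltW.
  by rewrite ler_nat.
have C3r : (4 * (C3 / k%:R) <= r)%R.
  rewrite mulrA ler_pdivrMr// -ler_pdivrMl// mulrC ltW//.
  apply: lt_le_trans (_ : (Num.bound (4 * C3 / r)%R)%:R <= _)%R.
    by apply: archi_boundP; rewrite divr_ge0 ?mulr_ge0 ?(ltW C30) ?(ltW r0).
  by rewrite ler_nat.
have cells := graph_cells kpos.
have zero : (forall w, trunc_weight (Br I) r (Cbar k) (z, w) = 0%R) ->
    \int[m]_w (trunc_weight (Br I) r (Cbar k) (z, w))%:E <= (b^-1 * S)%:E.
  move=> W0; rewrite integral0_eq ?lee_fin ?mulr_ge0 ?invr_ge0 ?(ltW b0)// => w _.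
  by rewrite W0.
have [[x Vx xz]|nz] := coreP (V k) (U k) z; last first.
  by apply: zero => w; rewrite /trunc_weight /= extend2_overlap// mulr0.
have [Az|nAz] := pselect (Br I z); last first.
  by apply: zero => w; rewrite /trunc_weight /= indicE memNset ?mul0r// => -[].
have Bx : Br I.+1 x.
  move: Az; rewrite !ballEmdist /= -natr1 => Az.
  have := diam k x kpos Vx z x (core_sub xz) (vertex_in_cell kpos Vx).
  have := metric_triangle x0 z x; lra.
pose a y := (C k x y * Num.min (graph_dist R (B k) x y / k%:R) 1 ^+ 2)%R.
have a0 y : V k y -> (0 <= a y)%R.
  by move=> Vy; have [_ c0] := hC kpos Vx Vy; rewrite mulr_ge0 ?sqr_ge0.
apply: (@le_trans _ _ (\int[m]_w (b^-1 * extend (V k) (U k) a w)%:E)); last first.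
  rewrite ge0_integralZ_EFin.
  - rewrite (integral_extend cells)// EFinM lee_wpmul2l ?lee_fin ?invr_ge0 ?(ltW b0)//.
    exact: SP.
  - exact: (measurable_extend cells).
  - by rewrite invr_ge0 ltW.
  - by move=> w; exact: extend_ge0.
apply: ge0_le_integral_EFin.
- apply: (measurable_fun_pair2 (f := trunc_weight (Br I) r (Cbar k))).
  apply: measurable_trunc_weight => //; first exact: measurable_mball.
  exact: measurable_Cbar.
- by apply: measurable_funM => //; exact: (measurable_extend cells).
- by move=> w; apply: trunc_weight_ge0 => *; exact: Cbar_ge0.
move=> w; rewrite /trunc_weight /= (extend2_core _ w Vx xz).
have rhs0 : (0 <= b^-1 * extend (V k) (U k) a w)%R.
  by rewrite mulr_ge0 ?invr_ge0 ?(ltW b0)//; exact: extend_ge0.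
rewrite indicE; have [/set_mem[_ Aw rzw]|_] := boolP (w \in _); last by rewrite mul0r.
rewrite mul1r; have [[y Vy yw]|nw] := coreP (V k) (U k) w; last first.
  by rewrite extend_overlap.
rewrite !(extend_core _ Vy yw) /a; have [_ c0] := hC kpos Vx Vy.
rewrite mulrCA ler_peMr// -ler_pdivrMl ?invr_gt0// invrK mulr1.
have zx := diam k x kpos Vx z x (core_sub xz) (vertex_in_cell kpos Vx).
have yw' := diam k y kpos Vy y w (vertex_in_cell kpos Vy) (core_sub yw).
have /andP[_ xy] := dist k x y kpos Vx Vy.
have t1 := metric_triangle z x w; have t2 := metric_triangle x y w.
have gd : (r / 2 / C2 <= graph_dist R (B k) x y / k%:R)%R.
  rewrite ler_pdivrMr// (_ : _ * C2 = C2 / k%:R * graph_dist R (B k) x y)%R; last by ring.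
  by apply: le_trans xy; lra.
rewrite /b ler_pXn2r ?nnegrE//.
- by rewrite le_min ge_min gd /= ge_min lexx orbT.
- by rewrite le_min ler01 !divr_ge0 ?(ltW r0) ?(ltW C20).
- by rewrite le_min ler01 (le_trans _ gd)// !divr_ge0 ?(ltW r0) ?(ltW C20).
Qed.

End ApproximatingGraphs.

(** * Reverse volume doubling *)

Section UpperLowerLimits.
Context (R : realType).
Implicit Types u : (\bar R)^nat.
Local Open Scope ereal_scope.

Lemma limn_esup_lt u c : limn_esup u < c -> exists N, forall k, (N <= k)%N -> u k < c.
Proof.
move=> uc; have /cvg_lim E := @ereal_nonincreasing_cvgn _ _ (@nonincreasing_esups _ u).
move: uc; rewrite limn_esup_lim E// => /ereal_inf_lt[_ [N _ <-] Nc].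
exists N => k Nk; apply: le_lt_trans Nc; apply: ereal_sup_ubound.
by exists k.
Qed.

Lemma limn_esup_le u c : (forall e : R, (0 < e)%R ->
  exists N, forall k, (N <= k)%N -> u k <= c + e%:E) -> limn_esup u <= c.
Proof.
move=> uc; apply/lee_addgt0Pr => e e0; have [N Nu] := uc e e0.
have /cvg_lim E := @ereal_nonincreasing_cvgn _ _ (@nonincreasing_esups _ u).
rewrite limn_esup_lim E//; apply: (@le_trans _ _ (esups u N)).
  by apply: ereal_inf_lbound; exists N.
by apply: ge_ereal_sup => _ [k /= Nk <-]; exact: Nu.
Qed.

Lemma limn_einf_lt u c : limn_einf u < c -> forall N, exists2 k, (N <= k)%N & u k < c.
Proof.
move=> uc N; have /cvg_lim E := @ereal_nondecreasing_cvgn _ _ (@nondecreasing_einfs _ u).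
have : einfs u N < c.
  apply: le_lt_trans uc; rewrite limn_einf_lim E//.
  by apply: ereal_sup_ubound; exists N.
by move=> /ereal_inf_lt[_ [k /= Nk <-] kc]; exists k.
Qed.

End UpperLowerLimits.

Section ReverseDoubling.
Context (R : realType) (d : measure_display) (M : metricMeasurableType R d).
Variables (m : {measure set M -> \bar R}) (x0 : M).
Hypothesis hM : metric_measure_space m.
Let borelM := mms_borel hM.
Let sepM := mms_separable hM.
Local Open Scope ring_scope.

Let vol (x : M) (r : R) : R := fine (m (ball x r)).

Let volE x r : (vol x r)%:E = m (ball x r).
Proof. by rewrite fineK// ge0_fin_numE ?ball_lty. Qed.

Let mball (x : M) (r : R) : measurable (ball x r).
Proof. exact: measurable_mball. Qed.

Let vol_le x r y s : (forall z, mdist x z < r -> mdist y z < s) -> vol x r <= vol y s.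
Proof.
move=> sub; rewrite -lee_fin !volE; apply: le_measure; rewrite ?inE//.
by move=> z; rewrite !ballEmdist; exact: sub.
Qed.

Section Constant.
Variable c : R.
Hypotheses (c0 : 0 < c) (doubling : forall (x : M) (r : R), 0 < r ->
  (m (ball x (2 * r)) <= c%:E * m (ball x r))%E).

Let vol_doubling x r : 0 < r -> vol x (2 * r) <= c * vol x r.
Proof. by move=> r0; rewrite -lee_fin EFinM !volE; exact: doubling. Qed.

Lemma vol_doubling_iter x r n : 0 < r -> vol x (2 ^+ n * r) <= c ^+ n * vol x r.
Proof.
move=> r0; elim: n => [|n IH]; first by rewrite !mul1r.
rewrite exprS -mulrA; apply: le_trans (vol_doubling _ _) _.
  by rewrite mulr_gt0 ?exprn_gt0.
by rewrite exprS -mulrA ler_wpM2l ?(ltW c0).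
Qed.

(* A point p with d(z, p) = r/2 exists because the space is geodesic; the ball B(p, r/4) is
   disjoint from B(z, r/4), comparable to it in volume, and contained in B(z, r). *)
Let reverse_doubling_step z q r : 0 < r -> r / 2 <= mdist z q ->
  vol z (r / 4) <= (1 + c ^- 2)^-1 * vol z r.
Proof.
move=> r0 zq; have [g [_ g0 g1 gd]] := mms_geodesic hM z q.
pose p := g (r / 2); have zp : mdist z p = r / 2.
  by rewrite -{1}g0 /p gd ?subr0// divr_ge0 ?(ltW r0).
have c2 : 0 < c ^- 2 by rewrite invr_gt0 exprn_gt0.
have pz : c ^- 2 * vol z (r / 4) <= vol p (r / 4).
  rewrite ler_pdivrMl ?exprn_gt0//; apply: le_trans (vol_doubling_iter p 2 _).
    apply: vol_le => w zw; have := metric_triangle p z w; rewrite (metric_sym p z) zp.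
    by rewrite (_ : 2 ^+ 2 * (r / 4) = r); [lra|field].
  by rewrite divr_gt0.
have disj : vol z (r / 4) + vol p (r / 4) <= vol z r.
  rewrite -lee_fin EFinD !volE -measureU//.
    apply: le_measure; rewrite ?inE//; first exact: measurableU.
    move=> w; rewrite !ballEmdist /= => -[zw|pw]; first lra.
    have := metric_triangle z p w; lra.
  apply/seteqP; split => // w []; rewrite !ballEmdist /= => zw pw.
  have := metric_triangle z w p; rewrite (metric_sym w p) => ?; exfalso.
  by move: zp => ?; lra.
rewrite ler_pdivlMl; last by rewrite ltr_wpDl.
rewrite mulrDl mul1r; lra.
Qed.

(** The condition r/2 <= d(z, q) only weakens as r shrinks, so a single far point [q] serves every
    scale and the one-step factor is gained each time. *)
Lemma reverse_doubling z q r n : 0 < r -> r / 2 <= mdist z q ->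
  vol z (r / 4 ^+ n) <= (1 + c ^- 2)^-1 ^+ n * vol z r.
Proof.
move=> r0 zq; elim: n => [|n IH]; first by rewrite !expr0 divr1 mul1r.
have rn0 : 0 < r / 4 ^+ n by rewrite divr_gt0 ?exprn_gt0.
have le : r / 4 ^+ n / 2 <= mdist z q.
  apply: le_trans zq; rewrite ler_pM2r ?invr_gt0//.
  by rewrite ler_pdivrMr ?exprn_gt0// ler_peMr ?(ltW r0)// exprn_ege1// ler1n.
rewrite (_ : r / 4 ^+ n.+1 = r / 4 ^+ n / 4); last by rewrite exprSr invfM mulrA.
apply: le_trans (reverse_doubling_step rn0 le) _.
have th0 : 0 <= (1 + c ^- 2)^-1.
  by rewrite invr_ge0 addr_ge0 ?invr_ge0 ?exprn_ge0 ?(ltW c0).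
by rewrite [_ ^+ n.+1]exprS -mulrA ler_wpM2l.
Qed.

End Constant.

Variables (V : nat -> set M) (B : nat -> rel M) (U : nat -> M -> set M).
Hypothesis hG : approximating_graphs m V B U.

(* Two vertices are at distance at least C1/k, so reverse doubling makes the ball around z small
   compared with V(z, C1/k), which is at most a multiple of m(U k y) once the ball meets U k y. *)
Lemma small_ball_in_cell : exists2 e : R, 0 < e & forall k x y z, (0 < k)%N ->
  V k x -> V k y -> x <> y -> U k x z ->
  (m (U k y `&` ball z (e / k%:R)) <= 2^-1%:E * m (U k y))%E.
Proof.
have [c c0 dbl] := mms_doubling hM.
have [C1 C10 sep] := vertices_separated hG.
have [C3 C30 diam] := ag_diam hG.
have [C4 [C5 [C40 C50 cellvol]]] := ag_cell_volume hG.
pose th := (1 + c ^- 2)^-1.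
have c2 : 0 < c ^- 2 by rewrite invr_gt0 exprn_gt0.
have th0 : 0 < th by rewrite invr_gt0 ltr_wpDl.
have th1 : th < 1 by rewrite /th invf_lt1 ?ltrDl ?addr_gt0.
(* 2^p/k will be the radius of a ball around y containing B(z, C1/k): at most C3/k from y to a
   common point w, then C1/k from w to z and C1/k from z on. *)
have [p pP] : exists p : nat, 2 * C1 + C3 <= 2 ^+ p.
  exists (Num.bound (2 * C1 + C3)).
  apply: ltW; apply: lt_le_trans (archi_boundP _) _;
    first by rewrite addr_ge0 ?mulr_ge0 ?(ltW C10) ?(ltW C30).
  by rewrite -natrX ler_nat ltnW// ltn_expl.
pose K := c ^+ p * C5; have K0 : 0 < K by rewrite mulr_gt0 ?exprn_gt0.
(* n reductions of the radius by 4 gain th^n, which must beat the factor [K] lost in comparing V(z,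
   C1/k) with m(U_k(y)); hence e = C1/4^n. *)
have [n nP] : exists n : nat, th ^+ n * K <= 2^-1.
  have thN : `|th| < 1 by rewrite ger0_norm ?(ltW th0).
  have /cvgrPdist_le /(_ (2^-1 / K)) [|N _ NP] := cvg_expr thN.
    by rewrite divr_gt0 ?invr_gt0.
  exists N; have := NP N (leqnn N); rewrite /= sub0r normrN ger0_norm ?exprn_ge0 ?(ltW th0)//.
  by rewrite ler_pdivlMr.
exists (C1 / 4 ^+ n); first by rewrite divr_gt0 ?exprn_gt0.
move=> k x y z k0 Vx Vy xy Uz; have kp : 0 < k%:R :> R by rewrite ltr0n.
have mUy := ag_cell hG k0 Vy.
have cells := graph_cells x0 hM hG k0.
have [s s0 mUyE] := measure_cell cells Vy.
have [[w [Uw zw]]|no] := pselect ((U k y `&` ball z (C1 / 4 ^+ n / k%:R)) !=set0); last first.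
  rewrite (_ : _ `&` _ = set0) ?measure0 ?mule_ge0 ?lee_fin ?invr_ge0//.
  by apply/seteqP; split => // w Hw; apply: no; exists w.
apply: (@le_trans _ _ (m (ball z (C1 / 4 ^+ n / k%:R)))).
  by apply: le_measure; rewrite ?inE//; exact: measurableI.
rewrite mUyE -EFinM -volE lee_fin.
have r0 : 0 < C1 / k%:R by rewrite divr_gt0.
(* x and y are at least C1/k apart, so one of them is at distance at least C1/(2k) from z. *)
have [q zq] : exists q, C1 / k%:R / 2 <= mdist z q.
  have := sep k x y k0 Vx Vy xy; have := metric_triangle x z y; rewrite (metric_sym x z).
  have [zx|zx] := leP (C1 / k%:R / 2) (mdist z x); first by exists x.
  by exists y; lra.
have small : C1 / 4 ^+ n / k%:R = C1 / k%:R / 4 ^+ n by rewrite mulrAC.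
rewrite small; apply: le_trans (reverse_doubling c0 dbl n r0 zq) _.
have e1 : C1 / k%:R / 4 ^+ n <= C1 / k%:R.
  by rewrite ler_pdivrMr ?exprn_gt0// ler_peMr ?(ltW r0)// exprn_ege1// ler1n.
have zy : vol z (C1 / k%:R) <= vol y (2 ^+ p * k%:R^-1).
  apply: vol_le => v zv; have wy := diam k y k0 Vy y w (vertex_in_cell hG k0 Vy) Uw.
  move: zw; rewrite ballEmdist /= small => zw.
  have := metric_triangle y w v; have := metric_triangle w z v; rewrite (metric_sym w z) => t1 t2.
  have : (2 * C1 + C3) / k%:R <= 2 ^+ p * k%:R^-1 by rewrite ler_pM2r ?invr_gt0.
  rewrite mulrDl -mulrA; lra.
have kV0 : 0 < k%:R^-1 :> R by rewrite invr_gt0.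
have := vol_doubling_iter c0 dbl y p kV0.
have /andP[_] := cellvol k y k0 Vy; rewrite mUyE -EFinM -volE lee_fin => yU yy.
apply: (@le_trans _ _ (th ^+ n * (K * s))); last by rewrite mulrA ler_wpM2r// ltW.
rewrite ler_wpM2l ?exprn_ge0 ?(ltW th0)//; apply: le_trans zy _; apply: le_trans yy _.
by rewrite /K -mulrA ler_wpM2l// exprn_ge0// ltW.
Qed.

(** The points of the cell outside the ball of radius e/k carry at least half of its mass, hence
    e^2/2. Passing from the cell to its core changes nothing, the overlap being null. *)
Lemma cell_second_moment : exists2 kap : R, 0 < kap & forall k x y z, (0 < k)%N ->
  V k x -> V k y -> x <> y -> U k x z ->
  ((kap / k%:R ^+ 2)%:E * m (U k y) <= \int[m]_(w in core (V k) (U k) y) (mdist z w ^+ 2)%:E)%E.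
Proof.
have [e e0 small] := small_ball_in_cell; exists (e ^+ 2 / 2); first by rewrite divr_gt0 ?exprn_gt0.
move=> k x y z k0 Vx Vy xy Uz; have cells := graph_cells x0 hM hG k0.
have kp : 0 < k%:R :> R by rewrite ltr0n.
have [s s0 mUyE] := measure_cell cells Vy.
have mUy := ag_cell hG k0 Vy.
have md : measurable_fun setT (fun w => (mdist z w ^+ 2)%:E).
  apply/measurable_EFinP; apply: measurable_funX.
  exact: measurable_mdist1.
rewrite -integral_cell//; last by move=> w; rewrite lee_fin sqr_ge0.
have mD : measurable (U k y `\` ball z (e / k%:R)) by exact: measurableD.
apply: (@le_trans _ _ (\int[m]_(w in U k y `\` ball z (e / k%:R)) (mdist z w ^+ 2)%:E)%E); last first.
  apply: ge0_subset_integral => //; first exact: measurable_funTS.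
  by move=> w _; rewrite lee_fin sqr_ge0.
apply: (@le_trans _ _ (\int[m]_(w in U k y `\` ball z (e / k%:R)) ((e / k%:R) ^+ 2)%:E)%E);
  last first.
  apply: ge0_le_integral => //.
  - by move=> w _; rewrite lee_fin sqr_ge0.
  - exact: measurable_funTS.
  - move=> w [_]; rewrite ballEmdist /= => /negP; rewrite -leNgt => ew.
    by rewrite lee_fin ler_pXn2r ?nnegrE ?mdist_ge0// divr_ge0 ?(ltW e0).
have mUyf : (m (U k y) < +oo)%E by rewrite mUyE ltry.
rewrite integral_EFin_cst//.
have -> : m (U k y `\` ball z (e / k%:R)) = (m (U k y) - m (U k y `&` ball z (e / k%:R)))%E.
  exact: measureD.
have := small k x y z k0 Vx Vy xy Uz; rewrite mUyE -EFinM.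
have : (0 <= m (U k y `&` ball z (e / k%:R)))%E by [].
case: (m (U k y `&` ball z (e / k%:R))) => // a; rewrite lee_fin => a0.
rewrite lee_fin => as_; rewrite -EFinM lee_fin expr_div_n.
have : 0 <= e ^+ 2 / k%:R ^+ 2 by rewrite divr_ge0 ?exprn_ge0 ?(ltW kp) ?(ltW e0).
rewrite (_ : e ^+ 2 / 2 / k%:R ^+ 2 = e ^+ 2 / k%:R ^+ 2 / 2); last by rewrite mulrAC.
set t := e ^+ 2 / k%:R ^+ 2 => t0; nra.
Qed.

End ReverseDoubling.

(** * Mosco convergence *)

Section SquareRoots.
Context (R : realType).
Implicit Types (x : \bar R) (a : R).
Local Open Scope ereal_scope.

Lemma poweR12_le_sqr x a : 0 <= x -> (0 <= a)%R -> x `^ 2^-1 <= a%:E -> x <= (a ^+ 2)%:E.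
Proof.
move=> + a0; case: x => [x|_|//]; last by rewrite poweRyr ?invr_eq0.
rewrite poweR_EFin !lee_fin => x0; rewrite powR12_sqrt// => xa.
by rewrite -(sqr_sqrtr x0) ler_pXn2r// nnegrE sqrtr_ge0.
Qed.

Lemma le_sqr_poweR12 x a : 0 <= x -> (0 <= a)%R -> x <= (a ^+ 2)%:E -> x `^ 2^-1 <= a%:E.
Proof.
move=> + a0; case: x => [x||//]; last by rewrite leye_eq.
rewrite poweR_EFin !lee_fin => x0 xa; rewrite powR12_sqrt//.
by rewrite -(ger0_norm a0) -sqrtr_sqr ler_wsqrtr.
Qed.

End SquareRoots.

Lemma integral2_indic (d : measure_display) (T : measurableType d) (R : realType)
    (mu : {measure set T -> \bar R}) (S : set T) (D : T -> set T) (h : T -> T -> R) :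
  (\int[mu]_z \int[mu]_w (\1_S z * \1_(D z) w * h z w)%:E =
   \int[mu]_(z in S) \int[mu]_(w in D z) (h z w)%:E)%E.
Proof.
rewrite [RHS]integral_mkcond; apply: eq_integral => z _; rewrite patchE indicE.
case: (z \in S); last by apply: integral0_eq => w _; rewrite !mul0r.
rewrite [RHS]integral_mkcond; apply: eq_integral => w _; rewrite patchE indicE mul1r.
by case: (w \in D z); rewrite ?mul1r ?mul0r.
Qed.

(** x_k is taken at the largest n <= k for which P n k has a solution. Once k exceeds both a given n
    and its threshold, this largest index is at least n, and monotonicity concludes. *)
Lemma diagonal_sequence (T : Type) (P : nat -> nat -> T -> Prop) :
  (forall k, exists x, P 0%N k x) ->
  (forall n n' k x, (n <= n')%N -> P n' k x -> P n k x) ->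
  (forall n, exists N, forall k, (N <= k)%N -> exists x, P n k x) ->
  exists x : nat -> T, (forall k, P 0%N k (x k)) /\
    forall n, exists N, forall k, (N <= k)%N -> P n k (x k).
Proof.
move=> P0 Pmono Pev.
have /choice[x xP] : forall k, exists x, exists2 n, P n k x &
    forall n', (n' <= k)%N -> (exists y, P n' k y) -> (n' <= n)%N.
  move=> k; pose S n := `[< exists y, P n k y >] && (n <= k)%N.
  have S0 : exists n, S n by exists 0%N; rewrite /S leq0n andbT; apply/asboolP.
  have Sk n : S n -> (n <= k)%N by move=> /andP[].
  case: (ex_maxnP S0 Sk) => n /andP[/asboolP[y Py] nk] nmax; exists y, n => // n' n'k ex.
  by apply: nmax; rewrite /S n'k andbT; apply/asboolP.
exists x; split => [k|n]; first by have [n Pn _] := xP k; exact: Pmono Pn.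
have [N NP] := Pev n; exists (maxn n N) => k; rewrite geq_max => /andP[nk Nk].
by have [n' Pn' n'max] := xP k; apply: Pmono Pn'; apply: n'max => //; exact: NP.
Qed.

Section MoscoConvergence.
Context (R : realType) (d : measure_display) (M : metricMeasurableType R d).
Variables (m : {measure set M -> \bar R}) (x0 : M) (j : R.-ker M ~> M).
Variables (V : nat -> set M) (B : nat -> rel M) (U : nat -> M -> set M).
Variable C : nat -> M -> M -> R.
Hypotheses (hM : metric_measure_space m) (hG : approximating_graphs m V B U).
Hypotheses (hC : conductances V C) (hA1a : A1a m x0 V B U C).
Hypotheses (hA2ii : A2ii m j) (hA2iii : A2iii j).
Let borelM := mms_borel hM.
Let sepM := mms_separable hM.
Let sfm := metric_measure_sigma_finite x0 hM.
Local Open Scope ereal_scope.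
Local Notation Br n := (ball x0 (n%:R : R)).
Local Notation Cbar k := (extend2 (V k) (U k) (C k)).
Local Notation pi k f := (average m (U k) f).
Local Notation E k f := (extend (V k) (U k) f).
Local Notation Form k := (weight_form m (fun p : M * M => Cbar k p.1 p.2)).
Local Notation Q I r := (quad (jump_form m j (Br I) r)).
Local Notation Qd k I r := (quad (weight_form m (trunc_weight (Br I) r (Cbar k)))).

(** * Truncated jump forms on balls and their exhaustion *)

Lemma mass_trunc_bounded (I : nat) (r : R) : (0 < r)%R -> exists2 Lam : R, (0 <= Lam)%R &
  forall x, Br I x -> j x (trunc_set (Br I) r x) <= Lam%:E.
Proof.
(* [I] may be 0, while closed balls are compact for positive radii; hence I + 1. *)
move=> r0; have I1 : (0 < I.+1%:R :> R)%R by rewrite ltr0n.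
have := hA2iii (mms_compact_ball hM (x := x0) I1).
set S := ereal_sup _ => Soo.
have le_S x : Br I x ->
    \int[j x]_y ((Num.min (mdist x y) 1 ^+ 2)%R)%:E <= S.
  move=> xI; apply: ereal_sup_ubound; exists x => //; apply: subset_closure.
  by move: xI; rewrite !ballEmdist /= => /lt_trans; apply; rewrite ltr_nat.
(* A lower bound of min(d(x, y), 1)^2 on the truncated set, whose mass is therefore at most S / e by
   (A2.iii). *)
pose e : R := (Num.min r 1 ^+ 2)%R.
have e0 : (0 < e)%R by rewrite exprn_gt0// lt_min r0 ltr01.
have [[x1 x1I]|no] := pselect (exists x, Br I x); last first.
  by exists 0%R => // x xI; case: no; exists x.
have S0 : 0 <= S.
  by apply: le_trans (le_S _ x1I); apply: integral_ge0 => y _; rewrite lee_fin sqr_ge0.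
have Sfin : (fine S)%:E = S by rewrite fineK// ge0_fin_numE.
exists (fine S / e)%R; first by rewrite divr_ge0 ?(ltW e0)// fine_ge0.
move=> x xI; have mT : measurable (trunc_set (Br I) r x).
  by apply: (measurable_trunc_set borelM sepM _ (ltW r0)); exact: measurable_mball.
have md : measurable_fun setT (fun y => ((Num.min (mdist x y) 1 ^+ 2)%R)%:E).
  apply/measurable_EFinP; apply: measurable_funX; apply: measurable_minr => //.
  exact: measurable_mdist1.
rewrite EFinM lee_pdivlMr// muleC Sfin -integral_EFin_cst//; apply: le_trans (le_S _ xI).
apply: (@le_trans _ _ (\int[j x]_(y in trunc_set (Br I) r x)
    ((Num.min (mdist x y) 1 ^+ 2)%R)%:E)); last first.
  by apply: ge0_subset_integral => // y _; rewrite lee_fin sqr_ge0.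
apply: ge0_le_integral => //.
- by move=> y _; rewrite lee_fin ltW.
- exact: measurable_funTS.
- move=> y [_ _ ry]; rewrite lee_fin ler_pXn2r ?nnegrE ?le_min ?(ltW r0) ?ler01 ?mdist_ge0//.
  by rewrite ?ge_min ?lexx ?orbT ?(ltW ry).
Qed.

Lemma ball_jump_form (I : nat) (r : R) : (0 < r)%R -> exists2 Lam : R, (0 <= Lam)%R &
  pair_form m (jump_form m j (Br I) r) Lam.
Proof.
move=> r0; have [Lam Lam0 jLam] := mass_trunc_bounded I r0; exists Lam => //.
by apply: (jump_form_pair_form borelM sepM _ (ltW r0) Lam0 jLam hA2ii); exact: measurable_mball.
Qed.

(** One index drives both the radius and the distance of the truncation; the shift keeps the latter
    positive. *)
Let T n x := trunc_set (Br n) n.+1%:R^-1 x.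

Let mT n x : measurable (T n x).
Proof.
by apply: (measurable_trunc_set borelM sepM) => //; first exact: measurable_mball.
Qed.

Let T_nondecreasing x : nondecreasing_seq (T ^~ x).
Proof.
move=> a b ab; apply/subsetPset => y [xa ya xy]; split.
- by move: xa; rewrite !ballEmdist /= => /lt_le_trans; apply; rewrite ler_nat.
- by move: ya; rewrite !ballEmdist /= => /lt_le_trans; apply; rewrite ler_nat.
- by apply: le_lt_trans xy; rewrite lef_pV2 ?posrE ?ltr0n// ler_nat ltnS.
Qed.

Let T_bigcup x : \bigcup_n T n x = [set~ x].
Proof.
apply/seteqP; split => [y [n _ [_ _ xy]] yx|y yx].
  by move: xy; rewrite yx mdistxx ltNge invr_ge0 ler0n.
have xy : (0 < mdist x y)%R.
  by rewrite lt_neqAle mdist_ge0 andbT eq_sym; apply/eqP => /mdist_positivity xy; apply: yx.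
have inball z : exists n : nat, forall k, (n <= k)%N -> Br k z.
  exists (Num.bound (mdist x0 z)) => k nk; rewrite ballEmdist /=.
  by apply: lt_le_trans (archi_boundP (mdist_ge0 x0 z)) _; rewrite ler_nat.
have [n1 n1P] := inball x; have [n2 n2P] := inball y.
pose n3 := Num.bound (mdist x y)^-1.
have n3P : ((mdist x y)^-1 < n3%:R)%R by apply: archi_boundP; rewrite invr_ge0 ltW.
exists (n1 + n2 + n3)%N => //; split.
- by apply: n1P; rewrite -addnA leq_addr.
- by apply: n2P; rewrite addnAC leq_addl.
- rewrite invf_plt ?posrE ?ltr0n//; apply: lt_le_trans n3P _; rewrite ler_nat.
  by rewrite leqW// leq_addl.
Qed.

Section Exhaustion.
Variable h : M * M -> R.
Hypotheses (mh : measurable_fun setT h) (h0 : forall p, (0 <= h p)%R).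

Let msec x : measurable_fun setT (fun y => (h (x, y))%:E).
Proof. by apply/measurable_EFinP; exact: measurable_fun_pair2. Qed.

Let jump_int_cvg x : \int[j x]_(y in T n x) (h (x, y))%:E @[n --> \oo] -->
  \int[j x]_(y in [set~ x]) (h (x, y))%:E.
Proof.
rewrite -T_bigcup; apply: ge0_nondecreasing_set_cvg_integral => //.
- by move=> n; apply: measurable_funTS.
- by move=> n y _; rewrite lee_fin.
Qed.

Let mT_int n : measurable_fun setT (fun x => \int[j x]_(y in T n x) (h (x, y))%:E).
Proof.
have n0 : (0 < n.+1%:R^-1 :> R)%R by [].
have [Lam Lam0 jLam] := mass_trunc_bounded n n0.
apply: (measurable_trunc_int borelM sepM _ (ltW n0) jLam (h := fun p => (h p)%:E)) => //.
- exact: measurable_mball.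
- exact/measurable_EFinP.
Qed.

(** As [j x] may be infinite near x, measurability is inherited from the truncated integrals, which
    converge to this one. *)
Lemma measurable_jump_int :
  measurable_fun setT (fun x => \int[j x]_(y in [set~ x]) (h (x, y))%:E).
Proof. by apply: emeasurable_fun_cvg mT_int _ => x _; exact: jump_int_cvg. Qed.

Lemma jump_form_cvg :
  jump_form m j (Br n) n.+1%:R^-1 h @[n --> \oo] -->
  \int[m]_x \int[j x]_(y in [set~ x]) (h (x, y))%:E.
Proof.
apply: (integral_monotone_cvg mT_int) => [n x|x|x]; last exact: jump_int_cvg.
  by apply: integral_ge0 => y _; rewrite lee_fin.
move=> a b ab; apply: ge0_subset_integral => //; first exact: measurable_funTS.
  by move=> y _; rewrite lee_fin.
by apply/subsetPset; exact: T_nondecreasing.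
Qed.

Lemma jump_form_le (I : nat) (r : R) : (0 < r)%R ->
  jump_form m j (Br I) r h <=
  \int[m]_x \int[j x]_(y in [set~ x]) (h (x, y))%:E.
Proof.
move=> r0; have [Lam Lam0 jLam] := mass_trunc_bounded I r0.
have mTx x : measurable (trunc_set (Br I) r x).
  by apply: (measurable_trunc_set borelM sepM _ (ltW r0)); exact: measurable_mball.
apply: ge0_le_integral => //.
- by move=> x _; apply: integral_ge0 => y _; rewrite lee_fin.
- apply: (measurable_trunc_int borelM sepM _ (ltW r0) jLam (h := fun p => (h p)%:E)) => //.
  + exact: measurable_mball.
  + exact/measurable_EFinP.
- exact: measurable_jump_int.
- move=> x _; apply: ge0_subset_integral => //; first by apply: measurableC; exact: measurable_set1M.
  + exact: measurable_funTS.
  + by move=> y _; rewrite lee_fin.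
  + by move=> y [_ _ ry] yx; move: ry; rewrite yx mdistxx ltNge ltW.
Qed.

End Exhaustion.

Lemma quad_jump_form_cvg (u : M -> R) : measurable_fun setT u ->
  Q n n.+1%:R^-1 u @[n --> \oo] --> jump_integral m j u.
Proof.
move=> mu; apply: (jump_form_cvg (measurable_sqr_diff mu)) => p; exact: sqr_ge0.
Qed.

Lemma quad_jump_form_le (I : nat) (r : R) (u : M -> R) : (0 < r)%R -> measurable_fun setT u ->
  Q I r u <= jump_integral m j u.
Proof.
move=> r0 mu; apply: (jump_form_le (measurable_sqr_diff mu)) => // p; exact: sqr_ge0.
Qed.

Lemma jump_integral_le (u : M -> R) (c : \bar R) (N : nat) : measurable_fun setT u ->
  (forall n, (N <= n)%N -> Q n n.+1%:R^-1 u <= c) -> jump_integral m j u <= c.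
Proof.
move=> mu Qc; apply: cvge_to_le (quad_jump_form_cvg mu) _.
by near=> n; apply: Qc; near: n; exact: nbhs_infty_ge.
Unshelve. all: by end_near.
Qed.

Lemma jump_integral_ge0 (u : M -> R) : 0 <= jump_integral m j u.
Proof.
by apply: integral_ge0 => x _; apply: integral_ge0 => y _; rewrite lee_fin sqr_ge0.
Qed.

(** Proved on the truncations and carried over by exhaustion. It bounds the jump integral of an
    approximant from (A3) by that of [u]. *)
Lemma jump_integral_young (t : R) (f g : M -> R) : (0 < t)%R ->
  measurable_fun setT f -> measurable_fun setT g ->
  jump_integral m j (fun x => f x + g x)%R <=
  (1 + t)%:E * jump_integral m j f + (1 + t^-1)%:E * jump_integral m j g.
Proof.
move=> t0 mf mg; apply: (@jump_integral_le _ _ 0); first exact: measurable_funD.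
move=> n _; have n0 : (0 < n.+1%:R^-1 :> R)%R by [].
have [Lam Lam0 pf] := ball_jump_form n n0.
apply: le_trans (quad_young pf t0 mf mg) _; apply: leeD.
- by apply: lee_wpmul2l; rewrite ?lee_fin ?quad_jump_form_le// addr_ge0// ltW.
- by apply: lee_wpmul2l; rewrite ?lee_fin ?quad_jump_form_le// addr_ge0// invr_ge0 ltW.
Qed.

(** * Limits of truncated forms along strongly convergent sequences *)

Let mball (I : nat) : measurable (Br I).
Proof. exact: measurable_mball. Qed.

Lemma ball_weight_form (I : nat) (r : R) : (0 < r)%R -> exists2 Lam : R, (0 <= Lam)%R &
  exists2 N : nat, (0 < N)%N & forall k, (N <= k)%N ->
    pair_form m (weight_form m (trunc_weight (Br I) r (Cbar k))) Lam.
Proof.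
move=> r0; have [Lam [Lam0 [N N0 bnd]]] := trunc_weight_bound hM hG hC hA1a I r0.
exists Lam => //; exists N => // k Nk; have k0 : (0 < k)%N by exact: leq_trans Nk.
apply: (weight_form_pair_form sfm) => //.
- by apply: (measurable_trunc_weight _ borelM sepM (mball I)); exact: (measurable_Cbar x0 hM hG C).
- by move=> p; apply: trunc_weight_ge0 => z w; apply: (Cbar_ge0 _ hC).
- by move=> x y; apply: trunc_weight_sym => z w; apply: (Cbar_sym _ hC).
- exact: bnd.
Qed.

Definition truncated_form_cvg (I : nat) (r : R) := forall f, @Lipc R d M f ->
  truncated_discrete_energy m (Cbar k) (Br I) r f @[k --> \oo]
    --> truncated_energy m j (Br I) r f.

Lemma quad_Lipc_le (I : nat) (r : R) (f : M -> R) (c : \bar R) (N : nat) : (0 < r)%R ->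
  truncated_form_cvg I r -> @Lipc R d M f ->
  (forall k, (N <= k)%N -> Qd k I r f <= c) -> Q I r f <= c.
Proof.
move=> r0 cvgI fL Qc; have := cvgI f fL.
rewrite truncated_energyE; move=> cvgQ; rewrite -(@lee_pmul2l _ (2^-1)%:E)// ?lte_fin ?invr_gt0//.
apply: cvge_to_le cvgQ _; near=> k.
have k0 : (0 < k)%N by near: k; exact: nbhs_infty_gt.
rewrite truncated_discrete_energyE; last by move=> z w; apply: (Cbar_sym _ hC).
rewrite lee_pmul2l// ?lte_fin ?invr_gt0//; apply: Qc; near: k; exact: nbhs_infty_ge.
Unshelve. all: by end_near.
Qed.

(* The limit form is evaluated on a Lipschitz function near h, where it is the limit of the
   discrete forms, and these are then compared at hk. *)
Lemma truncated_form_closed (I : nat) (r : R) (h : M -> R) (hk : nat -> M -> R) (b : R) :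
  (0 < r)%R -> truncated_form_cvg I r -> square_integrable m h ->
  (forall k, (0 < k)%N -> measurable_fun setT (hk k)) ->
  (forall eps : R, (0 < eps)%R -> exists2 N : nat, (0 < N)%N & forall k, (N <= k)%N ->
     sqint m (fun x => h x - hk k x)%R <= eps%:E) ->
  (0 <= b)%R -> (exists N, forall k, (N <= k)%N -> Qd k I r (hk k) <= b%:E) ->
  Q I r h <= b%:E.
Proof.
move=> r0 cvgI [mh hoo] mhk hhk b0 [N1 QN1].
have [Lam1 Lam10 pQ] := ball_jump_form I r0.
have [Lam2 Lam20 [N2 N20 pQd]] := ball_weight_form I r0.
apply/lee_addgt0Pr => eps eps0.
(* [quad_perturb] is used twice, from h to f and from f to [hk], which costs (1 + t)^2 <= 1 + 3 t
   for t <= 1; then 3 t b <= eps/2. *)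
pose t := (Num.min 1 (eps / (6 * (b + 1))))%R.
have t0 : (0 < t)%R by rewrite lt_min ltr01 divr_gt0// mulr_gt0// ltr_wpDl.
have tb : ((1 + t) * ((1 + t) * b) <= b + eps / 2)%R.
  have t1 : (t <= 1)%R by rewrite ge_min lexx.
  have : (t <= eps / (6 * (b + 1)))%R by rewrite ge_min lexx orbT.
  rewrite ler_pdivlMr; last by rewrite mulr_gt0// ltr_wpDl.
  by move=> ?; nra.
pose c1 := ((1 + t^-1) * (4 * Lam1))%R; pose c2 := ((1 + t^-1) * (4 * Lam2))%R.
have tV : (0 < t^-1)%R by rewrite invr_gt0.
have c10 : (0 <= c1)%R by rewrite !mulr_ge0// addr_ge0// ltW.
have c20 : (0 <= c2)%R by rewrite !mulr_ge0// addr_ge0// ltW.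
(* Chosen after [t], so that both L^2 errors together use up at most the other eps/2; the 4 comes
   from passing from f to [hk] through h. *)
pose s := (eps / 2 / ((1 + t) * (c2 * 4) + c1 + 1))%R.
have den0 : (0 < (1 + t) * (c2 * 4) + c1 + 1)%R.
  by rewrite ltr_wpDl// addr_ge0// !mulr_ge0// addr_ge0// ltW.
have s0 : (0 < s)%R by rewrite divr_gt0// divr_gt0.
have [f fL hf] := Lipc_dense x0 hM (conj mh hoo) s0.
have mf := Lipc_measurable hM fL.
have [N3 N30 hN3] := hhk s s0.
have Qf : Q I r f <= ((1 + t) * b + c2 * (4 * s))%:E.
  apply: (@quad_Lipc_le _ _ _ _ (maxn N1 (maxn N2 N3)) r0 cvgI fL) => k.
  rewrite !geq_max => /and3P[Nk1 Nk2 Nk3]; have {}mhk := mhk k (leq_trans N20 Nk2).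
  apply: le_trans (quad_perturb Lam20 (pQd k Nk2) t0 mf mhk) _.
  apply: (@le_trans _ _ ((1 + t)%:E * b%:E + c2%:E * (4 * s)%:E)); last by rewrite -!EFinM -EFinD.
  apply: leeD.
    by apply: lee_wpmul2l; [rewrite lee_fin addr_ge0// ltW|exact: QN1].
  apply: lee_wpmul2l; first by rewrite lee_fin.
  have fh : sqint m (fun x => f x - h x)%R <= s%:E.
    by rewrite sqintBC.
  have -> : (fun x => f x - hk k x)%R = (fun x => (f x - h x) + (h x - hk k x))%R.
    by apply/funext => x; rewrite addrA subrK.
  apply: le_trans (sqint_young m _ _) _; try exact: measurable_funB.
  rewrite (_ : (4 * s)%:E = 2%:E * s%:E + 2%:E * s%:E); last by rewrite -!EFinM -EFinD;
    congr EFin; ring.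
  by apply: leeD; apply: lee_wpmul2l => //; exact: hN3.
apply: le_trans (quad_perturb Lam10 pQ t0 mh mf) _.
apply: (@le_trans _ _ ((1 + t)%:E * ((1 + t) * b + c2 * (4 * s))%:E + c1%:E * s%:E)).
  apply: leeD; first by apply: lee_wpmul2l => //; rewrite lee_fin addr_ge0// ltW.
  by apply: lee_wpmul2l => //; rewrite lee_fin.
rewrite -!EFinM -!EFinD lee_fin.
have : (s * ((1 + t) * (c2 * 4) + c1 + 1) = eps / 2)%R by rewrite /s divfK// gt_eqF.
move=> sE; nra.
Qed.

Lemma discrete_sum_ge0 k w : (0 < k)%N -> 0 <= discrete_sum m (V k) (U k) (C k) w.
Proof.
move=> k0; apply: esum_ge0 => x Vx; apply: esum_ge0 => y Vy.
by rewrite !mule_ge0// lee_fin mulr_ge0 ?sqr_ge0//; have [] := hC k0 Vx Vy.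
Qed.

Lemma discrete_energy_ge0 k w : (0 < k)%N -> 0 <= discrete_energy m (V k) (U k) (C k) w.
Proof.
move=> k0; rewrite /discrete_energy; case: ifP => // _.
by rewrite mule_ge0 ?discrete_sum_ge0// lee_fin.
Qed.

Lemma discrete_sum_le_energy k w : (0 < k)%N ->
  discrete_sum m (V k) (U k) (C k) w <= 2%:E * discrete_energy m (V k) (U k) (C k) w.
Proof.
move=> k0; rewrite /discrete_energy; case: ifP => _; last by rewrite gt0_muley ?leey// lte_fin.
by rewrite muleA -EFinM divff// mul1e.
Qed.

Lemma trunc_quad_le_discrete_sum k I r w : (0 < k)%N ->
  Qd k I r (extend (V k) (U k) w) <= discrete_sum m (V k) (U k) (C k) w.
Proof.
move=> k0; have cells := graph_cells x0 hM hG k0.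
rewrite (discrete_sumE cells sfm); last by move=> x y Vx Vy; have [] := hC k0 Vx Vy.
set F := extend (V k) (U k) w; have mF : measurable_fun setT F by exact: (measurable_extend cells).
have mD := measurable_sqr_diff mF.
(* With conductance 1 the truncated weight is the indicator of the truncation. *)
pose o := trunc_weight (Br I) r (fun _ _ : M => 1%R).
have mo : measurable_fun setT o.
  by apply: (measurable_trunc_weight _ borelM sepM (mball I)).
have o0 p : (0 <= o p)%R by apply: trunc_weight_ge0.
have o1 p : (o p <= 1)%R by rewrite /o /trunc_weight mulr1 indicE; case: (_ \in _).
rewrite [leLHS](_ : _ = weight_form m (fun p => Cbar k p.1 p.2)
    (fun p => (F p.1 - F p.2) ^+ 2 * o p)%R); last first.
  rewrite /quad /weight_form; apply: eq_integral => z _; apply: eq_integral => w' _.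
  by rewrite /o /trunc_weight /= mulr1 mulrA.
rewrite [leRHS](_ : _ = weight_form m (fun p => Cbar k p.1 p.2) (fun p => (F p.1 - F p.2) ^+ 2)%R)//.
apply: (weight_form_le sfm (measurable_Cbar x0 hM hG C k0)).
- by move=> p; apply: (Cbar_ge0 _ hC).
- exact: measurable_funM.
- exact: mD.
- by move=> p; rewrite mulr_ge0 ?sqr_ge0.
- by move=> p; rewrite ler_piMr ?sqr_ge0.
Qed.

(** * Lower bound along weakly convergent sequences *)

Hypothesis hA4ii : A4ii m V U C.

(** [N] depends on [eps] alone: (A4.ii) is uniform in i >= N and in the function, so v may later
    vary with i. The error sits inside the square because (A4.ii) compares square roots, and the 2
    undoes the 1/2 in the energy. *)
Lemma truncated_form_extend_le (I : nat) (r : R) : (0 < r)%R -> truncated_form_cvg I r ->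
  forall eps : R, (0 < eps)%R -> exists2 N : nat, (0 < N)%N & forall i v (a : R), (N <= i)%N ->
    L2V m (V i) (U i) v -> (0 <= a)%R ->
    discrete_energy m (V i) (U i) (C i) v <= (a ^+ 2)%:E ->
    Q I r (extend (V i) (U i) v) <= (2 * (a + eps) ^+ 2)%:E.
Proof.
move=> r0 cvgI eps eps0; have [N N0 NP] := hA4ii eps0; exists N => // i v a Ni vL a0 va.
have i0 : (0 < i)%N by exact: leq_trans Ni.
have sqi := L2V_extend (graph_cells x0 hM hG i0) vL.
apply: (truncated_form_closed
  (hk := fun k => extend (V k) (U k) (average m (U k) (extend (V i) (U i) v))) r0 cvgI sqi).
- by move=> k k0; apply: measurable_extend; exact: (graph_cells x0 hM hG k0).
- exact: (extend_average_cvg x0 hM hG sqi).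
- by rewrite mulr_ge0// sqr_ge0.
exists i => k ik; have k0 : (0 < k)%N by exact: leq_trans ik.
apply: le_trans (trunc_quad_le_discrete_sum _ _ _ k0) _.
apply: le_trans (discrete_sum_le_energy _ k0) _; rewrite EFinM; apply: lee_wpmul2l => //.
apply: poweR12_le_sqr; [exact: discrete_energy_ge0|by rewrite addr_ge0// ltW|].
apply: le_trans (NP k i Ni ik v vL) _; rewrite EFinD; apply: leeD => //.
by apply: le_sqr_poweR12 => //; exact: discrete_energy_ge0.
Qed.

Hypothesis hA4iii : A4iii m x0 V U C j.

(** Dropping the nonnegative form at E_i v_i - f from the polarization identity leaves an upper
    bound on the pairing of E_i v_i with [phi], which survives the weak limit. The identity for [u]
    then loses only the form at u - f, at most 4 Lam s. *)
Lemma truncated_form_liminf (I : nat) (r : R) (v : nat -> M -> R) (u : M -> R) (b : R) :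
  (0 < r)%R -> truncated_form_cvg I r ->
  (forall k, (0 < k)%N -> L2V m (V k) (U k) (v k)) -> square_integrable m u ->
  weak_cvg m (fun k => extend (V k) (U k) (v k)) u -> (0 <= b)%R ->
  (forall N, exists2 i, (N <= i)%N & Q I r (extend (V i) (U i) (v i)) <= b%:E) ->
  Q I r u <= b%:E.
Proof.
move=> r0 cvgI vL [mu uoo] weak b0 Qb.
have [Lam Lam0 jLam] := mass_trunc_bounded I r0.
have pQ := jump_form_pair_form borelM sepM (mball I) (ltW r0) Lam0 jLam hA2ii.
apply/lee_addgt0Pr => eps eps0.
pose s := (eps / 2 / (4 * Lam + 1))%R.
have den0 : (0 < 4 * Lam + 1)%R by rewrite ltr_wpDl// mulr_ge0.
have s0 : (0 < s)%R by rewrite !divr_gt0.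
have sE : (4 * Lam * s <= eps / 2)%R.
  by have : (s * (4 * Lam + 1) = eps / 2)%R; [rewrite /s divfK// gt_eqF|nra].
have [f fL uf] := Lipc_dense x0 hM (conj mu uoo) s0.
have mf := Lipc_measurable hM fL.
have [L [G [n [L0 G0 fLip fG fn]]]] := Lipc_bounded x0 fL.
(* Polarization was proved for nonnegative functions; adding a constant changes no increment. *)
pose g x := (f x + G)%R.
have mg : measurable_fun setT g by exact: measurable_funD.
have g0 x : (0 <= g x)%R by have := fG x; rewrite /g ler_norml => /andP[]; lra.
have gG x : (g x <= 2 * G)%R by have := fG x; rewrite /g ler_norml => /andP[]; lra.
have quadg w : Q I r (fun x => w x - g x)%R = Q I r (fun x => w x - f x)%R.
  by rewrite /quad; congr jump_form; apply/funext => p; rewrite /g; congr (_ ^+ 2)%R; ring.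
have quad0g : Q I r g = Q I r f.
  by rewrite /quad; congr jump_form; apply/funext => p; rewrite /g; congr (_ ^+ 2)%R; ring.
have fsq := Lipc_square_integrable x0 hM fL.
have mAoo := ball_lty hM x0 (I%:R).
pose phi := gradient j (Br I) r g.
have phi_le x : (`|phi x| <= 2 * G * Lam * \1_(Br I) x)%R.
  exact: (gradient_le borelM sepM (mball I) (ltW r0) Lam0 jLam mg g0 gG).
have phiL2 : L2 m phi.
  have mphi : measurable_fun setT phi.
    exact: (measurable_gradient borelM sepM (mball I) (ltW r0) jLam mg g0).
  apply/L2_square_integrable; split => //.
  apply: (@le_lt_trans _ _ (((2 * G * Lam) ^+ 2)%:E * m (Br I))).
    apply: (bounded_support_sqint hM mphi) => x.
      apply: le_trans (phi_le x) _; rewrite ler_piMr ?mulr_ge0// indicE; by case: (_ \in _).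
    move=> phix; apply/set_mem; have := phi_le x; rewrite indicE; case: (x \in _) => //.
    by rewrite mulr0 normr_le0 (negbTE phix).
  by rewrite lte_mul_pinfty// lee_fin sqr_ge0.
have polar w : square_integrable m w ->
    Q I r w + Q I r f = Q I r (fun x => w x - f x)%R + 4%:E * \int[m]_x (w x * phi x)%:E.
  move=> [mw woo]; rewrite -quad0g -quadg.
  exact: (jump_form_polarization borelM sepM (mball I) (ltW r0) Lam0 jLam hA2ii mAoo mg g0 gG mw woo).
have Qff : Q I r f \is a fin_num.
  rewrite ge0_fin_numE; last exact: (quad_ge0 pQ).
  apply: le_lt_trans (quad_bound Lam0 pQ mf) _.
  by rewrite lte_mul_pinfty ?lee_fin ?mulr_ge0//; exact: fsq.2.
have key : 4%:E * \int[m]_x (u x * phi x)%:E <= b%:E + Q I r f.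
  rewrite leNgt; apply/negP => lt4.
  have : \forall k \near \oo, b%:E + Q I r f < 4%:E * \int[m]_x (extend (V k) (U k) (v k) x * phi
    x)%:E.
    rewrite -lte_pdivrMl// in lt4.
    have := weak phi phiL2 _ (open_ereal_gt' lt4); rewrite /nbhs /=.
    case=> N N0 NP; exists N => // k /NP /=; by rewrite lte_pdivrMl.
  (* [N.+1] makes i positive: nothing is known of level 0. *)
  move=> [N _ NP]; have [i Ni Qi] := Qb N.+1.
  have := NP i (ltnW Ni); rewrite ltNge /=.
  have vi := L2V_extend (graph_cells x0 hM hG (leq_trans (ltn0Sn N) Ni)) (vL i (leq_trans (ltn0Sn
    N) Ni)).
  move/negP; apply; apply: (@le_trans _ _ (Q I r (extend (V i) (U i) (v i)) + Q I r f));
    last exact: leeD.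
  by rewrite (polar _ vi) leeDr// (quad_ge0 pQ).
rewrite -(leeD2rE _ _ Qff) (polar _ (conj mu uoo)).
rewrite [leLHS]addeC [leRHS]addeAC; apply: leeD => //.
apply: le_trans (quad_bound Lam0 pQ (measurable_funB mu mf)) _.
apply: (@le_trans _ _ ((4 * Lam)%:E * s%:E)).
  by apply: lee_wpmul2l => //; rewrite lee_fin mulr_ge0.
rewrite -EFinM lee_fin; lra.
Qed.


Lemma energy_le_liminf (v : nat -> M -> R) (u : M -> R) :
  (forall k, (0 < k)%N -> L2V m (V k) (U k) (v k)) -> L2 m u ->
  weak_cvg m (fun k => extend (V k) (U k) (v k)) u ->
  energy m j u <= limn_einf (fun k => discrete_energy m (V k) (U k) (C k) (v k)).
Proof.
move=> vL uL weak; set l := limn_einf _.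
have [mu uoo] := iffLR (L2_square_integrable m u) uL.
have l0 : 0 <= l.
  rewrite leNgt; apply/negP => /limn_einf_lt/(_ 1%N)[k k1].
  by rewrite ltNge discrete_energy_ge0.
have [delta0 d00 [i0 cvgQ]] := hA4iii.
case lE : l => [a| |]; [|by rewrite leey|by move: l0; rewrite lE].
have a0 : (0 <= a)%R by rewrite -lee_fin -lE.
(* The bound also puts [u] in the domain, outside of which the energy is +oo by definition. *)
suff Ju : jump_integral m j u <= (2 * a)%:E.
  rewrite /energy asboolT; last by split => //; apply: le_lt_trans Ju _; rewrite ltry.
  by rewrite lee_pdivrMl// -EFinM.
apply/lee_addgt0Pr => eps eps0.
(* The exhaustion uses B_n and the distance 1/(n+1); from max(i0, n0) on, both are in the range of
   (A4.iii). *)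
have [n0 n0P] : exists n0 : nat, forall n, (n0 <= n)%N -> (n.+1%:R^-1 < delta0)%R.
  exists (Num.bound delta0^-1) => n nP; rewrite invf_plt ?posrE ?ltr0n//.
  apply: lt_le_trans (archi_boundP _) _; first by rewrite invr_ge0 ltW.
  by rewrite ler_nat leqW.
apply: (jump_integral_le (N := maxn i0 n0) mu) => n.
rewrite geq_max => /andP[ni nn].
have r0 : (0 < n.+1%:R^-1 :> R)%R by [].
have cvgn : truncated_form_cvg n n.+1%:R^-1.
  by move=> f fL; apply: cvgQ => //; rewrite r0 n0P.
(* The margin is set on square roots, as in (A4.ii). Infinitely many energies lie below the square
   of (s + q)/2, because a = q^2 is smaller; the error (s - q)/2 brings the root up to s, and 2 s^2
   = 2 a + eps. *)
pose s := Num.sqrt (a + eps / 2)%R; pose q := Num.sqrt a.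
have e2 : (0 < eps / 2)%R by rewrite divr_gt0.
have s2 : (s ^+ 2 = a + eps / 2)%R by rewrite sqr_sqrtr// addr_ge0// ltW.
have q2 : (q ^+ 2 = a)%R by rewrite sqr_sqrtr.
have qs : (q < s)%R by rewrite ltr_sqrt ?ltrDl// ltr_wpDl.
have q0 : (0 <= q)%R by exact: sqrtr_ge0.
have d0 : (0 < (s - q) / 2)%R by rewrite divr_gt0// subr_gt0.
have [N1 N10 N1P] := truncated_form_extend_le r0 cvgn d0.
rewrite -EFinD; apply: (truncated_form_liminf r0 cvgn vL (conj mu uoo) weak).
  by rewrite addr_ge0 ?mulr_ge0// ltW.
move=> N; have la : l < (((s + q) / 2) ^+ 2)%:E.
  by rewrite lE lte_fin; nra.
have [i] := limn_einf_lt la (maxn N N1); rewrite geq_max => /andP[Ni N1i] vi.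
exists i => //; apply: le_trans (N1P i (v i) _ N1i (vL i (leq_trans N10 N1i)) _ (ltW vi)) _.
  by rewrite divr_ge0// addr_ge0// sqrtr_ge0.
rewrite (_ : (s + q) / 2 + (s - q) / 2 = s)%R; last by field.
by rewrite s2 lee_fin; lra.
Qed.

(** * Recovery sequences for Lipschitz functions *)

Lemma extend_average_bounded (f : M -> R) (G : R) k z : (0 < k)%N -> (0 <= G)%R ->
  square_integrable m f -> (forall x, `|f x| <= G)%R ->
  (`|extend (V k) (U k) (pi k f) z| <= G)%R.
Proof.
move=> k0 G0 fsq fG; have cells := graph_cells x0 hM hG k0.
have [[x Vx xz]|oz] := coreP (V k) (U k) z; last by rewrite extend_overlap// normr0.
rewrite (extend_core _ Vx xz) -normrN -sub0r.
by apply: (average_dist_le cells Vx fsq) => w _; rewrite sub0r normrN.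
Qed.

Lemma measurable_sqr_mdist (z : M) : measurable_fun setT (fun w : M => mdist z w ^+ 2 : R)%R.
Proof.
by apply: measurable_funX; exact: measurable_mdist1.
Qed.

Section Lipschitz.
Variables (f : M -> R) (L : R).
Hypotheses (L0 : (0 <= L)%R) (fLip : forall x y, (`|f x - f y| <= L * mdist x y)%R).
Hypothesis fsq : square_integrable m f.

Lemma average_increment : exists2 Lam : R, (0 <= Lam)%R & forall k x y z, (0 < k)%N ->
  V k x -> V k y -> x <> y -> core (V k) (U k) x z ->
  ((pi k f x - pi k f y) ^+ 2)%:E * m (U k y) <=
    Lam%:E * \int[m]_(w in core (V k) (U k) y) (mdist z w ^+ 2)%:E.
Proof.
have [C3 C30 diam] := ag_diam hG.
have [kap kap0 moment] := cell_second_moment x0 hM hG.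
(* The increment of the averages is at most L d(z, w) + 2 a with a = L C3/k, and (p + 2 a)^2 <= 2
   p^2 + 8 a^2. Absorbing 8 a^2 into the second moment of the cell costs the factor 1/kap. *)
exists (2 * L ^+ 2 + 8 * L ^+ 2 * C3 ^+ 2 / kap)%R.
  by rewrite addr_ge0 ?divr_ge0 ?mulr_ge0 ?sqr_ge0 ?(ltW C30) ?(ltW kap0).
move=> k x y z k0 Vx Vy xy xz; have cells := graph_cells x0 hM hG k0.
have kp : (0 < k%:R :> R)%R by rewrite ltr0n.
have Uz := core_sub xz.
have mc := measurable_core cells Vy.
have [s s0 mUyE] := measure_cell cells Vy.
have near w : core (V k) (U k) y w ->
    ((pi k f x - pi k f y) ^+ 2 <= 2 * L ^+ 2 * mdist z w ^+ 2 + 8 * L ^+ 2 * C3 ^+ 2 / k%:R ^+ 2)%R.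
  move=> /core_sub Uw.
  have e1 := average_lipschitz x0 hM hG k0 Vx L0 fsq fLip (fun v => diam k x k0 Vx z v Uz).
  have e2 := average_lipschitz x0 hM hG k0 Vy L0 fsq fLip (fun v => diam k y k0 Vy w v Uw).
  have e3 := fLip z w.
  set a := (L * (C3 / k%:R))%R in e1 e2.
  have a0 : (0 <= a)%R by rewrite mulr_ge0// divr_ge0// ltW.
  have : (`|pi k f x - pi k f y| <= L * mdist z w + 2 * a)%R.
    rewrite (_ : pi k f x - pi k f y = - (f z - pi k f x) + (f z - f w) + (f w - pi k f y))%R;
      last by ring.
    apply: le_trans (ler_normD _ _) _; apply: le_trans (lerD (ler_normD _ _) (lexx _)) _.
    by rewrite normrN; lra.
  rewrite -ler_sqr ?nnegrE ?addr_ge0 ?mulr_ge0 ?mdist_ge0 ?divr_ge0 ?(ltW C30)// real_normK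
    ?num_real// => /le_trans; apply.
  rewrite (_ : 8 * L ^+ 2 * C3 ^+ 2 / k%:R ^+ 2 = 8 * a ^+ 2)%R; last by rewrite /a; field;
    rewrite gt_eqF.
  by have := sqr_ge0 (L * mdist z w - 2 * a)%R; nra.
set S := \int[m]_(w in _) _; have S0 : 0 <= S by apply: integral_ge0 => w _; rewrite lee_fin sqr_ge0.
have step : ((pi k f x - pi k f y) ^+ 2)%:E * m (U k y) <=
    (2 * L ^+ 2)%:E * S + (8 * L ^+ 2 * C3 ^+ 2 / k%:R ^+ 2)%:E * m (U k y).
  rewrite -(measure_core cells Vy) -!integral_EFin_cst// /S -ge0_integralZl//; last 3 first.
  - by apply/measurable_EFinP; apply: measurable_funTS; exact: measurable_sqr_mdist.
  - by move=> w _; rewrite lee_fin sqr_ge0.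
  - by rewrite lee_fin mulr_ge0 ?sqr_ge0.
  rewrite -ge0_integralD//; last 3 first.
  - by move=> w _; rewrite -EFinM lee_fin mulr_ge0 ?sqr_ge0// mulr_ge0 ?sqr_ge0.
  - by apply/measurable_EFinP; apply: measurable_funM => //; apply: measurable_funTS;
    exact: measurable_sqr_mdist.
  - by move=> w _; rewrite lee_fin divr_ge0 ?sqr_ge0// mulr_ge0 ?sqr_ge0// mulr_ge0 ?sqr_ge0.
  apply: ge0_le_integral => //.
  - by move=> w _; rewrite lee_fin sqr_ge0.
  - apply/measurable_EFinP; apply: measurable_funD => //.
    by apply: measurable_funM => //; apply: measurable_funTS; exact: measurable_sqr_mdist.
have mom := moment k x y z k0 Vx Vy xy Uz.
apply: le_trans step _; rewrite EFinD ge0_muleDl ?lee_fin ?divr_ge0 ?mulr_ge0 ?sqr_ge0 ?(ltW C30)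
  ?(ltW kap0)//.
apply: leeD => //; rewrite (_ : 8 * L ^+ 2 * C3 ^+ 2 / k%:R ^+ 2 = 8 * L ^+ 2 * C3 ^+ 2 / kap *
  (kap / k%:R ^+ 2))%R; last first.
  by field; rewrite !gt_eqF.
by rewrite EFinM -muleA; apply: lee_wpmul2l => //;
  rewrite lee_fin divr_ge0 ?mulr_ge0 ?sqr_ge0 ?(ltW C30) ?(ltW kap0).
Qed.

End Lipschitz.

Definition near_pairs (A : set M) (r : R) : set (M * M) :=
  [set p | [/\ A p.1, A p.2 & (mdist p.1 p.2 <= r)%R]].

Lemma measurable_near_pairs A r : measurable A -> measurable (near_pairs A r).
Proof.
move=> mA; rewrite (_ : near_pairs A r =
  (A `*` A) `&` (setT `&` (fun p : M * M => mdist p.1 p.2) @^-1` `]-oo, r])).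
  apply: measurableI; first exact: measurableX.
  by apply: measurable_mdist => //; exact: measurable_itv.
apply/seteqP; split => p /=; first by case=> *; rewrite in_itv.
by rewrite in_itv /= => -[[? ?] [_ ?]].
Qed.

(** For fixed z in the cell of x the comparison is made cell by cell in w, where the conductance is
    constant. If one point w0 of a cell is near z, all its points are within r + C3 <= 2 r of z and
    stay in [K]: hence the larger set and the doubled distance on the right. *)
Lemma near_energy_le (f : M -> R) (A K : set M) (r Lam C3 : R) k : (0 < k)%N ->
  measurable A -> measurable K -> (0 <= Lam)%R ->
  (forall x y z, V k x -> V k y -> x <> y -> core (V k) (U k) x z ->
    ((pi k f x - pi k f y) ^+ 2)%:E * m (U k y) <=
      Lam%:E * \int[m]_(w in core (V k) (U k) y) (mdist z w ^+ 2)%:E) ->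
  (forall x xi eta, V k x -> U k x xi -> U k x eta -> (mdist xi eta <= C3)%R) -> (C3 <= r)%R ->
  (forall x w, A x -> (mdist x w <= C3)%R -> K w) ->
  weight_form m (fun p => Cbar k p.1 p.2)
    (fun p => \1_(near_pairs A r) p *
       (extend (V k) (U k) (pi k f) p.1 - extend (V k) (U k) (pi k f) p.2) ^+ 2)%R <=
  Lam%:E * weight_form m (fun p => Cbar k p.1 p.2)
    (fun p => \1_(near_pairs K (2 * r)) p * mdist p.1 p.2 ^+ 2)%R.
Proof.
move=> k0 mA mK Lam0 incr diam C3r AK; have cells := graph_cells x0 hM hG k0.
set F := extend (V k) (U k) (pi k f).
have mF : measurable_fun setT F by exact: (measurable_extend cells).
have mC := measurable_Cbar x0 hM hG C k0.
have C0 p : (0 <= Cbar k p.1 p.2)%R by exact: (Cbar_ge0 _ hC).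
pose hN (p : M * M) := (\1_(near_pairs A r) p * (F p.1 - F p.2) ^+ 2)%R.
pose hK (p : M * M) := (\1_(near_pairs K (2 * r)) p * mdist p.1 p.2 ^+ 2)%R.
change (weight_form m (fun p => Cbar k p.1 p.2) hN <=
  Lam%:E * weight_form m (fun p => Cbar k p.1 p.2) hK).
have mhN : measurable_fun setT hN.
  by apply: measurable_funM; [apply: measurable_indic;
    exact: measurable_near_pairs|exact: measurable_sqr_diff].
have mhK : measurable_fun setT hK.
  apply: measurable_funM; first by apply: measurable_indic; exact: measurable_near_pairs.
  by apply: measurable_funX; exact: measurable_mdist.
have hN0 p : (0 <= hN p)%R by rewrite mulr_ge0 ?sqr_ge0.
have hK0 p : (0 <= hK p)%R by rewrite mulr_ge0 ?sqr_ge0.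
have mhNC := measurable_funM mhN mC; have mhKC := measurable_funM mhK mC.
rewrite /weight_form -ge0_integralZl//; last 2 first.
- exact: (measurable_weight_int sfm mC C0 mhK hK0).
- by move=> z _; apply: integral_ge0 => w _; rewrite lee_fin mulr_ge0.
apply: ge0_le_integral => //.
- by move=> z _; apply: integral_ge0 => w _; rewrite lee_fin mulr_ge0.
- exact: (measurable_weight_int sfm mC C0 mhN hN0).
- by apply: emeasurable_funM => //; exact: (measurable_weight_int sfm mC C0 mhK hK0).
move=> z _; have rhs0 : 0 <= Lam%:E * \int[m]_w (hK (z, w) * Cbar k z w)%:E.
  by rewrite mule_ge0 ?lee_fin//; apply: integral_ge0 => w _;
    rewrite lee_fin (mulr_ge0 _ (C0 (z, w))).
have [[x Vx xz]|oz] := coreP (V k) (U k) z; last first.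
  rewrite [leLHS](_ : _ = 0)//; apply: integral0_eq => w _.
  by rewrite /= extend2_overlap// mulr0.
have msN : measurable_fun setT (fun w => (hN (z, w) * Cbar k z w)%:E).
  by apply/measurable_EFinP; exact: (measurable_fun_pair2 z mhNC).
have msK : measurable_fun setT (fun w => (hK (z, w) * Cbar k z w)%:E).
  by apply/measurable_EFinP; exact: (measurable_fun_pair2 z mhKC).
rewrite -ge0_integralZl//; last by move=> w _; rewrite lee_fin (mulr_ge0 _ (C0 (z, w))).
rewrite !(integral_cells cells)//; last 3 first.
- by apply: emeasurable_funM.
- by move=> w; rewrite -EFinM lee_fin mulr_ge0// (mulr_ge0 _ (C0 (z, w))).
- by move=> w; rewrite lee_fin (mulr_ge0 _ (C0 (z, w))).
apply: le_esum => y Vy.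
have Rge0 : 0 <= \int[m]_(w in core (V k) (U k) y) (Lam%:E * (hK (z, w) * Cbar k z w)%:E).
  by apply: integral_ge0 => w _; rewrite -EFinM lee_fin mulr_ge0// (mulr_ge0 _ (C0 (z, w))).
have Fz : F z = pi k f x by rewrite /F (extend_core _ Vx xz).
have Fw w : core (V k) (U k) y w -> F w = pi k f y by move=> yw; rewrite /F (extend_core _ Vy yw).
have Cw w : core (V k) (U k) y w -> Cbar k z w = C k x y.
  by move=> yw; rewrite (extend2_core _ _ Vx xz) (extend_core _ Vy yw).
have my := measurable_core cells Vy.
(* Within one cell the increment of the averages is 0; this is why [incr] may be restricted to
   distinct vertices. *)
have [xy|xy] := pselect (x = y).
  rewrite [leLHS](_ : _ = 0)//; apply: integral0_eq => w yw.
  by rewrite /hN /= Fz (Fw _ yw) xy subrr expr0n mulr0 mul0r.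
have [[w0 [yw0 [Az Aw0 zw0]]]|far] :=
    pselect (exists w, core (V k) (U k) y w /\ near_pairs A r (z, w)); last first.
  rewrite [leLHS](_ : _ = 0)//; apply: integral0_eq => w yw.
  rewrite /hN indicE memNset ?mul0r// => near; apply: far; by exists w.
have c0 : (0 <= C k x y)%R by rewrite -(Cw _ yw0); exact: (C0 (z, w0)).
apply: (@le_trans _ _ (\int[m]_(w in core (V k) (U k) y) ((pi k f x - pi k f y) ^+ 2 * C k x y)%:E)).
  apply: ge0_le_integral => //.
  - by move=> w _; rewrite lee_fin (mulr_ge0 _ (C0 (z, w))).
  - exact: measurable_funTS.
  - move=> w yw; rewrite lee_fin (Cw _ yw) ler_wpM2r// /hN /= Fz (Fw _ yw).
    by rewrite ler_piMl ?sqr_ge0// indicE; case: (_ \in _).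
rewrite integral_EFin_cst// measure_core// EFinM muleAC.
have msq : measurable_fun (core (V k) (U k) y) (fun w => (mdist z w ^+ 2)%:E).
  by apply: measurable_funTS; apply/measurable_EFinP; exact: measurable_sqr_mdist.
apply: (@le_trans _ _ (Lam%:E * \int[m]_(w in core (V k) (U k) y) (mdist z w ^+ 2)%:E * (C k x
  y)%:E)).
  by apply: lee_wpmul2r; [rewrite lee_fin|exact: incr].
rewrite -muleA (muleC _ (C k x y)%:E) -ge0_integralZl//; last by move=> w _; rewrite lee_fin sqr_ge0.
rewrite -ge0_integralZl//; last 2 first.
- by apply: emeasurable_funM.
- by move=> w _; rewrite -EFinM lee_fin mulr_ge0 ?sqr_ge0.
apply: ge0_le_integral => //.
- by move=> w _; rewrite -!EFinM lee_fin mulr_ge0// mulr_ge0 ?sqr_ge0.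
- by do 2 apply: emeasurable_funM => //.
- by apply: emeasurable_funM => //; exact: measurable_funTS.
move=> w yw; rewrite -!EFinM lee_fin ler_wpM2l// (Cw _ yw) mulrC ler_wpM2r// /hK.
rewrite indicE mem_set ?mul1r//=.
have Uy := core_sub yw0; have Uw := core_sub yw.
have w0w := diam y w0 w Vy Uy Uw.
split => /=; first by apply: AK Az _; rewrite mdistxx; apply: le_trans w0w; exact: mdist_ge0.
  exact: AK Aw0 w0w.
by have := metric_triangle z w0 w; move=> ?;
  apply: le_trans (_ : _ <= mdist z w0 + mdist w0 w)%R _ => //; lra.
Qed.

Hypotheses (hnear : A4i_near m V U C) (hfar : A4i_far m x0 V U C).

Lemma near_form_small (K : set M) (e delta : R) : compact K -> (0 < e)%R -> (0 < delta)%R ->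
  exists2 eta : R, (0 < eta < delta)%R & exists N, forall k, (N <= k)%N -> (0 < k)%N ->
    Form k (fun p => \1_(near_pairs K eta) p * mdist p.1 p.2 ^+ 2)%R < e%:E.
Proof.
move=> cK e0 delta0; have e0' : 0 < e%:E by rewrite lte_fin.
have near0 : \forall eta \near (0%R : R)^'+, limn_esup (fun k =>
    \int[m]_(y in K) \int[m]_(x in K `&` [set x | (mdist x y <= eta)%R])
      (mdist x y ^+ 2 * Cbar k x y)%:E) < e%:E by exact: (hnear cK (open_ereal_lt' e0')).
have [eta [small [eta0 etad]]] := filter_ex (filterI near0
  (filterI (nbhs_right_gt (0 : R)) (nbhs_right_lt delta0))).
exists eta; first by rewrite eta0.
have [N NP] := limn_esup_lt small; exists N => k Nk k0; apply: le_lt_trans (NP k Nk).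
rewrite -integral2_indic le_eqVlt; apply/orP; left; apply/eqP.
apply: eq_integral => z _; apply: eq_integral => w _ /=; rewrite metric_sym (Cbar_sym _ hC)//.
rewrite -[in LHS]mulrA; congr (_ * (_ * _))%:E; rewrite !indicE -natrM mulnb;
  congr (nat_of_bool _)%:R.
apply/idP/andP => [/set_mem[Kz Kw /= zw]|[/set_mem Kz /set_mem[Kw /= zw]]].
  by split; apply/mem_set => //; split => //=; rewrite metric_sym.
by apply/mem_set; split => //=; rewrite metric_sym.
Qed.

Lemma far_form_small (K : set M) (e : R) (I0 : nat) : compact K -> (0 < e)%R ->
  exists2 I : nat, (I0 <= I)%N & exists N, forall k, (N <= k)%N -> (0 < k)%N ->
    Form k (fun p => \1_K p.1 * \1_(~` Br I) p.2)%R < e%:E.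
Proof.
move=> cK e0; have e0' : 0 < e%:E by rewrite lte_fin.
have near_oo : \forall i \near \oo, limn_esup (fun k =>
    \int[m]_(y in K) \int[m]_(x in ~` Br i) (Cbar k x y)%:E) < e%:E.
  exact: (hfar cK (open_ereal_lt' e0')).
have [I [small I0I]] := filter_ex (filterI near_oo (nbhs_infty_ge I0)).
exists I => //; have [N NP] := limn_esup_lt small; exists N => k Nk k0.
apply: le_lt_trans (NP k Nk); rewrite -integral2_indic le_eqVlt; apply/orP; left; apply/eqP.
by apply: eq_integral => z _; apply: eq_integral => w _ /=; rewrite (Cbar_sym _ hC).
Qed.

(** A pair in A x A is far or near. If just one point is outside [A], where [F] vanishes, a nonzero
    increment forces the other into [K], and its square is at most G^2. If both are outside, the
    increment is 0. *)
Lemma increment_split (F : M -> R) (G delta : R) (A K : set M) (p : M * M) :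
  (forall x, `|F x| <= G)%R -> (forall x, F x != 0%R -> K x /\ A x) ->
  ((F p.1 - F p.2) ^+ 2 <=
     ((F p.1 - F p.2) ^+ 2 * trunc_weight A delta (fun _ _ => 1) p +
      \1_(near_pairs A delta) p * (F p.1 - F p.2) ^+ 2) +
     G ^+ 2 * (\1_K p.1 * \1_(~` A) p.2 + \1_K p.2 * \1_(~` A) p.1))%R.
Proof.
move=> FG FK; have out x : ~ A x -> F x = 0%R.
  by move=> Ax; apply/eqP/negPn/negP => /FK[].
have G2 x : (F x ^+ 2 <= G ^+ 2)%R by rewrite -(real_normK (num_real _)) ler_pXn2r// nnegrE
  (le_trans _ (FG x)).
have sq x : (0 <= F x ^+ 2)%R := sqr_ge0 _.
case: p => z w; rewrite /trunc_weight /= !indicE mulr1.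
have [Az|Az] := pselect (A z); have [Aw|Aw] := pselect (A w).
- rewrite !(memNset (A := ~` A))//; try exact.
  have [zw|zw] := leP (mdist z w) delta.
    rewrite (mem_set (A := near_pairs A delta))// !mulr0 addr0 mulr0 addr0 mul1r lerDr.
    by rewrite mulr_ge0 ?sqr_ge0.
  rewrite (mem_set (A := trunc_set A delta z))// mulr1 !mulr0 addr0 mulr0 addr0 lerDl.
  by rewrite mulr_ge0 ?sqr_ge0.
- rewrite (out w Aw) subr0 (mem_set (Aw : (~` A) w)) mulr1.
  have [->|Fz] := eqVneq (F z) 0%R.
    by rewrite expr0n /= mul0r mulr0 !add0r mulr_ge0 ?sqr_ge0 ?addr_ge0 ?mulr_ge0.
  rewrite (mem_set (FK z Fz).1) mulrDr mulr1; have := G2 z;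
    have : (0 <= G ^+ 2 * ((w \in K)%:R * (z \in ~` A)%:R))%R.
    by rewrite mulr_ge0 ?sqr_ge0 ?mulr_ge0.
  have : (0 <= F z ^+ 2 * (w \in trunc_set A delta z)%:R)%R by rewrite mulr_ge0.
  have : (0 <= ((z, w) \in near_pairs A delta)%:R * F z ^+ 2)%R by rewrite mulr_ge0.
  lra.
- rewrite (out z Az) sub0r sqrrN (mem_set (Az : (~` A) z)) mulr1.
  have [->|Fw] := eqVneq (F w) 0%R.
    by rewrite expr0n /= mul0r mulr0 !add0r mulr_ge0 ?sqr_ge0 ?addr_ge0 ?mulr_ge0.
  rewrite (mem_set (FK w Fw).1) mulrDr mulr1; have := G2 w;
    have : (0 <= G ^+ 2 * ((z \in K)%:R * (w \in ~` A)%:R))%R.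
    by rewrite mulr_ge0 ?sqr_ge0 ?mulr_ge0.
  have : (0 <= F w ^+ 2 * (w \in trunc_set A delta z)%:R)%R by rewrite mulr_ge0.
  have : (0 <= ((z, w) \in near_pairs A delta)%:R * F w ^+ 2)%R by rewrite mulr_ge0.
  lra.
- rewrite (out z Az) (out w Aw) subr0 expr0n /= mul0r mulr0 !add0r.
  by rewrite mulr_ge0 ?sqr_ge0 ?addr_ge0 ?mulr_ge0.
Qed.

(** The averages are compared with the fixed function [f], to which (A4.iii) applies, and the
    resulting limit is at most the full jump integral. *)
Lemma truncated_form_upper (I : nat) (r e : R) (f : M -> R) : (0 < r)%R ->
  truncated_form_cvg I r -> @Lipc R d M f -> jump_integral m j f < +oo ->
  (0 < e)%R -> exists2 N : nat, (0 < N)%N & forall k, (N <= k)%N ->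
    Qd k I r (extend (V k) (U k) (pi k f)) <= jump_integral m j f + e%:E.
Proof.
move=> r0 cvgI fL Joo e0; have mf := Lipc_measurable hM fL.
have fsq := Lipc_square_integrable x0 hM fL.
have JE : (fine (jump_integral m j f))%:E = jump_integral m j f.
  by rewrite fineK// ge0_fin_numE ?jump_integral_ge0.
have J0 : (0 <= fine (jump_integral m j f))%R by rewrite fine_ge0 ?jump_integral_ge0.
rewrite -JE; set J := fine _ in JE J0 *.
have [Lam Lam0 [N1 N10 pQd]] := ball_weight_form I r0.
(* The loss [e] is made of four quarters: t J, t e/4, the e/4 allowed in the limit, and c s. *)
pose t := (Num.min 1 (e / (4 * (J + 1))))%R.
have t0 : (0 < t)%R by rewrite lt_min ltr01 divr_gt0// mulr_gt0// ltr_wpDl.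
have t1 : (t <= 1)%R by rewrite ge_min lexx.
have tJ : (t * J <= e / 4)%R.
  have : (t <= e / (4 * (J + 1)))%R by rewrite ge_min lexx orbT.
  by rewrite ler_pdivlMr; [nra|rewrite mulr_gt0// ltr_wpDl].
pose c := ((1 + t^-1) * (4 * Lam))%R.
have c0 : (0 <= c)%R by rewrite !mulr_ge0// addr_ge0// invr_ge0 ltW.
pose s := (e / 4 / (c + 1))%R.
have s0 : (0 < s)%R by rewrite !divr_gt0// ltr_wpDl.
have sE : (c * s <= e / 4)%R.
  by have : (s * (c + 1) = e / 4)%R; [rewrite /s divfK// gt_eqF// ltr_wpDl|nra].
have [N2 N20 N2P] := extend_average_cvg x0 hM hG fsq s0.
have e4 : (0 < e / 4)%R by rewrite divr_gt0.
have lim : \forall k \near \oo, truncated_discrete_energy m (Cbar k) (Br I) r f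
    < (2^-1 * (J + e / 4))%:E.
  have lt : truncated_energy m j (Br I) r f < (2^-1 * (J + e / 4))%:E.
    rewrite truncated_energyE EFinM lte_pmul2l//.
    apply: le_lt_trans (quad_jump_form_le I r0 mf) _.
    by rewrite -JE lte_fin ltrDl.
  exact: (cvgI f fL _ (open_ereal_lt' lt)).
have [N3 _ N3P] := lim.
exists (maxn N1 (maxn N2 N3)); first by rewrite leq_max N10.
move=> k; rewrite !geq_max => /and3P[k1 k2 k3]; have k0 : (0 < k)%N by exact: leq_trans k1.
have mF : measurable_fun setT (extend (V k) (U k) (pi k f)).
  by apply: measurable_extend; exact: (graph_cells x0 hM hG k0).
apply: le_trans (quad_perturb Lam0 (pQd k k1) t0 mF mf) _.
have Qf : Qd k I r f <= (J + e / 4)%:E.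
  have := ltW (N3P k k3); rewrite /= truncated_discrete_energyE.
    by rewrite EFinM lee_pmul2l.
  by move=> z w; apply: (Cbar_sym _ hC).
have Ff : sqint m (fun x => extend (V k) (U k) (pi k f) x - f x)%R <= s%:E.
  by rewrite sqintBC; exact: N2P k k2.
apply: (@le_trans _ _ ((1 + t)%:E * (J + e / 4)%:E + c%:E * s%:E)).
  by apply: leeD; apply: lee_wpmul2l => //; rewrite lee_fin// addr_ge0// ltW.
rewrite -!EFinM -!EFinD lee_fin; nra.
Qed.

Lemma Lipc_recovery (f : M -> R) : @Lipc R d M f -> jump_integral m j f < +oo ->
  forall eps : R, (0 < eps)%R -> exists2 N : nat, (0 < N)%N & forall k, (N <= k)%N ->
    discrete_sum m (V k) (U k) (C k) (pi k f) <= jump_integral m j f + eps%:E.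
Proof.
move=> fL Joo eps eps0; have fsq := Lipc_square_integrable x0 hM fL.
have [L [G [n [L0 G0 fLip fG fn]]]] := Lipc_bounded x0 fL.
have [C3 C30 diam] := ag_diam hG.
have [Lam Lam0 incr] := average_increment L0 fLip fsq.
have [delta0 d00 [i0 cvgQ]] := hA4iii.
(* Radius of a ball around x0 containing the supports of all averages of [f]. *)
pose n1 := (n + Num.bound C3)%N.
have kC3 k : (0 < k)%N -> (C3 / k%:R <= C3)%R.
  by move=> k0; rewrite ler_pdivrMr ?ltr0n// ler_peMr ?(ltW C30)// ler1n.
have suppF k z : (0 < k)%N -> extend (V k) (U k) (pi k f) z != 0%R -> Br n1 z.
  move=> k0 /(extend_average_support hM hG k0 fsq diam fn); rewrite !ballEmdist /= => /lt_le_trans.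
  apply; rewrite natrD lerD2l; apply: le_trans (kC3 k k0) _.
  by apply/ltW/archi_boundP/ltW.
pose K1 := closure (Br n1.+1).
have cK1 : compact K1 by apply: (mms_compact_ball hM); rewrite ltr0n.
have ball_closure (a : nat) : Br a `<=` closure (Br a.+1).
  move=> z; rewrite !ballEmdist => za; apply: subset_closure; apply: lt_trans za _ => /=.
  by rewrite ltr_nat.
(* The 2 accounts for the far pairs in both orders. *)
pose e1 := (eps / 4 / (2 * G ^+ 2 + 1))%R.
have den1 : (0 < 2 * G ^+ 2 + 1)%R by rewrite ltr_wpDl// mulr_ge0 ?sqr_ge0.
have e10 : (0 < e1)%R by rewrite !divr_gt0.
have e1E : (2 * G ^+ 2 * e1 <= eps / 4)%R.
  by have : (e1 * (2 * G ^+ 2 + 1) = eps / 4)%R; [rewrite /e1 divfK// gt_eqF|nra].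
(* [I] is fixed before the truncation distance, since the compact set used for near pairs depends on
   it. I >= n1 puts the supports in B_I, and I >= i0 is for (A4.iii). *)
have [I I0 [N1 far]] := far_form_small (maxn i0 n1) cK1 e10.
pose A := Br I; pose K2 := closure (Br I.+2).
have cK2 : compact K2 by apply: (mms_compact_ball hM); rewrite ltr0n.
pose e2 := (eps / 4 / (Lam + 1))%R.
have e20 : (0 < e2)%R by rewrite !divr_gt0// ltr_wpDl.
have e2E : (Lam * e2 <= eps / 4)%R.
  by have : (e2 * (Lam + 1) = eps / 4)%R; [rewrite /e2 divfK// gt_eqF// ltr_wpDl|nra].
have [eta /andP[eta0 etad] [N2 near]] := near_form_small cK2 e20 d00.
(* Half, because [near_energy_le] doubles the distance. *)
pose delta := (eta / 2)%R; have delta1 : (0 < delta)%R by rewrite divr_gt0.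
have etaE : (2 * delta = eta)%R by rewrite /delta; field.
have cvgI : truncated_form_cvg I delta.
  move=> g gL; apply: cvgQ => //; last by apply: leq_trans I0; rewrite leq_max leqnn.
  by rewrite delta1 /=; lra.
have e4 : (0 < eps / 4)%R by rewrite divr_gt0.
have [N3 N30 trunc] := truncated_form_upper delta1 cvgI fL Joo e4.
(* Cells of diameter at most [delta] are asked for by [near_energy_le]; diameter at most 1 keeps
   those meeting B_I inside K2. *)
pose N4 := Num.bound (C3 / Num.min delta 1)%R.
have min0 : (0 < Num.min delta 1)%R by rewrite lt_min delta1 ltr01.
exists (maxn N1 (maxn N2 (maxn N3 N4))); first by rewrite !leq_max N30 !orbT.
move=> k; rewrite !geq_max => /and4P[k1 k2 k3 k4]; have k0 : (0 < k)%N by exact: leq_trans k3.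
have kp : (0 < k%:R :> R)%R by rewrite ltr0n.
have small : (C3 / k%:R <= Num.min delta 1)%R.
  rewrite ler_pdivrMr// mulrC -ler_pdivrMr//; apply: (@le_trans _ _ N4%:R); last by rewrite ler_nat.
  by apply/ltW/archi_boundP; rewrite divr_ge0// ltW.
have cells := graph_cells x0 hM hG k0.
rewrite (discrete_sumE cells sfm); last by move=> x y Vx Vy; have [] := hC k0 Vx Vy.
set F := extend (V k) (U k) (pi k f).
have mF : measurable_fun setT F by exact: (measurable_extend cells).
have mC := measurable_Cbar x0 hM hG C k0.
have C0 p : (0 <= Cbar k p.1 p.2)%R by exact: (Cbar_ge0 _ hC).
have mA : measurable A by exact: mball.
have mK1 : measurable K1 by exact: compact_measurableM.
have mK2 : measurable K2 by exact: compact_measurableM.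
have n1I : (n1 <= I)%N by apply: leq_trans I0; rewrite leq_max leqnn orbT.
have FK x : F x != 0%R -> K1 x /\ A x.
  move=> /(suppF k x k0) Bx; split; first exact: ball_closure.
  by move: Bx; rewrite /A !ballEmdist /= => /lt_le_trans; apply; rewrite ler_nat.
have FG x : (`|F x| <= G)%R by exact: (extend_average_bounded x k0 G0 fsq fG).
pose hT (p : M * M) := ((F p.1 - F p.2) ^+ 2 * trunc_weight A delta (fun _ _ => 1) p)%R.
pose hN (p : M * M) := (\1_(near_pairs A delta) p * (F p.1 - F p.2) ^+ 2)%R.
pose hP (p : M * M) := (\1_K1 p.1 * \1_(~` A) p.2 : R)%R.
have mD := measurable_sqr_diff mF.
have mhT : measurable_fun setT hT.
  by apply: measurable_funM => //; apply: (measurable_trunc_weight _ borelM sepM mA).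
have mN : measurable_fun setT hN.
  by apply: measurable_funM => //; apply: measurable_indic; exact: (measurable_near_pairs).
have mP : measurable_fun setT hP.
  apply: measurable_funM; first by apply: measurable_fst_comp; exact: measurable_indic.
  by apply: measurable_snd_comp; apply: measurable_indic; exact: measurableC.
have mP' : measurable_fun setT (fun p : M * M => hP (p.2, p.1)).
  apply: measurable_funM; first by apply: measurable_snd_comp; exact: measurable_indic.
  by apply: measurable_fst_comp; apply: measurable_indic; exact: measurableC.
have hT0 p : (0 <= hT p)%R by rewrite mulr_ge0 ?sqr_ge0//; exact: trunc_weight_ge0.
have hN0 p : (0 <= hN p)%R by rewrite mulr_ge0 ?sqr_ge0.
have hP0 p : (0 <= hP p)%R by rewrite mulr_ge0.
have G20 := sqr_ge0 G.
apply: (@le_trans _ _ (Form k (fun p => (hT p + hN p) + G ^+ 2 * (hP p + hP (p.2, p.1)))%R)).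
  apply: (weight_form_le sfm mC C0 mD).
  - apply: measurable_funD; first exact: measurable_funD.
    by apply: measurable_funM => //; exact: measurable_funD.
  - by move=> p; exact: sqr_ge0.
  - by move=> p; exact: increment_split.
rewrite (weight_formD sfm mC C0); last 4 first.
- exact: measurable_funD.
- by apply: measurable_funM => //; exact: measurable_funD.
- by move=> p; exact: addr_ge0.
- by move=> p; rewrite mulr_ge0// addr_ge0.
rewrite (weight_formD sfm mC C0)// (weight_formZ sfm mC C0)//; last 2 first.
- exact: measurable_funD.
- by move=> p; exact: addr_ge0.
rewrite (weight_formD sfm mC C0)//.
rewrite (weight_form_swap sfm mC C0 _ mP hP0); last by move=> x y; exact: (Cbar_sym _ hC).
have bT : Form k hT <= jump_integral m j f + (eps / 4)%:E.
  apply: le_trans (trunc k k3); rewrite le_eqVlt; apply/orP; left; apply/eqP.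
  apply: eq_integral => z _; apply: eq_integral => w _.
  by rewrite /hT /trunc_weight /= mulr1 mulrA.
have bN : Form k hN <= (eps / 4)%:E.
  apply: (@le_trans _ _ (Lam%:E * e2%:E)); last by rewrite -EFinM lee_fin.
  apply: le_trans (near_energy_le (K := K2) (C3 := (C3 / k%:R)%R) k0 mA mK2 Lam0 _ _ _ _) _.
  - by move=> x y z; exact: incr.
  - by move=> x xi zeta Vx; exact: diam.
  - by apply: le_trans small _; rewrite ge_min lexx.
  - move=> x w; rewrite /A ballEmdist /= => Ax xw; apply: ball_closure; rewrite ballEmdist /=.
    apply: le_lt_trans (metric_triangle x0 x w) _; rewrite -natr1.
    by apply: ltr_leD => //; apply: le_trans xw _; apply: le_trans small _; rewrite ge_min lexx orbT.
  by apply: lee_wpmul2l; [rewrite lee_fin|rewrite etaE ltW// near].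
have bP : (G ^+ 2)%:E * (Form k hP + Form k hP) <= (eps / 4)%:E.
  apply: (@le_trans _ _ ((G ^+ 2)%:E * (e1%:E + e1%:E))).
    by apply: lee_wpmul2l; [rewrite lee_fin|apply: leeD; rewrite ltW// far].
  by rewrite -EFinD -EFinM lee_fin; lra.
apply: le_trans (leeD (leeD bT bN) bP) _; move: (jump_integral m j f) => J.
by rewrite -!addeA -!EFinD; apply: leeD2l; rewrite lee_fin; lra.
Qed.

(** * Recovery sequences for general functions *)

Hypothesis hA3 : A3 m j.

Lemma energy_recovery_step (u : M -> R) : domain m j u -> forall eps : R, (0 < eps)%R ->
  exists2 f, square_integrable m f & exists2 N : nat, (0 < N)%N & forall k, (N <= k)%N ->
    sqint m (fun x => E k (pi k f) x - u x)%R <= eps%:E /\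
    discrete_energy m (V k) (U k) (C k) (pi k f) <= energy m j u + eps%:E.
Proof.
move=> udom eps eps0; have [uL Juoo] := udom; have usq := iffLR (L2_square_integrable m u) uL.
have Jg0 g := jump_integral_ge0 g.
have JuE : (fine (jump_integral m j u))%:E = jump_integral m j u by rewrite fineK// ge0_fin_numE.
have J0 : (0 <= fine (jump_integral m j u))%R by rewrite fine_ge0.
set J := fine _ in JuE J0.
(* J(f) <= (1 + t) J(u) + c J(f - u) exceeds J(u) by at most eps/4 + eps/4: t J <= eps/4, and J(f -
   u) is at most 2 e, the energy being half of J, while c e = eps/8. *)
pose t := (eps / (4 * (J + 1)))%R.
have t0 : (0 < t)%R by rewrite divr_gt0// mulr_gt0// ltr_wpDl.
have tJ : (t * J <= eps / 4)%R.
  have : (t * (J + 1) = eps / 4)%R by rewrite /t; field; rewrite gt_eqF// ltr_wpDl.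
  nra.
pose c := (1 + t^-1)%R; have c1 : (1 <= c)%R by rewrite lerDl invr_ge0 ltW.
have c0 : (0 < c)%R by apply: lt_le_trans c1.
pose e := (eps / 8 / c)%R; have e0 : (0 < e)%R by rewrite !divr_gt0.
have eE : (c * e = eps / 8)%R by rewrite /e mulrC divfK// gt_eqF.
have ee : (e <= eps / 8)%R by nra.
have [f fL] := hA3.2 u udom e e0; rewrite sqr_L2norm.
have fsq := Lipc_square_integrable x0 hM fL.
have enge0 : 0 <= energy m j (f \- u)%R.
  by rewrite /energy; case: ifP => // _; rewrite mule_ge0// lee_fin.
move=> small.
have fu : sqint m (f \- u)%R <= e%:E by apply: le_trans (ltW small); rewrite leeDr.
have Jfu : jump_integral m j (f \- u)%R <= (2 * e)%:E.
  have : energy m j (f \- u)%R <= e%:E by apply: le_trans (ltW small); rewrite leeDl// sqint_ge0.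
  rewrite /energy; case: ifP => [_|_]; last by rewrite leye_eq.
  by rewrite lee_pdivrMl// -EFinM.
have Jf : jump_integral m j f <= (J + eps / 4 + eps / 4)%:E.
  have -> : f = (fun x => u x + (f \- u)%R x)%R by apply/funext => x; rewrite /= addrC subrK.
  apply: le_trans (jump_integral_young t0 usq.1 (measurable_funB fsq.1 usq.1)) _.
  apply: (@le_trans _ _ ((1 + t)%:E * J%:E + c%:E * (2 * e)%:E)).
    by rewrite JuE; apply: leeD => //; apply: lee_wpmul2l => //; rewrite lee_fin ltW.
  by rewrite -!EFinM -EFinD lee_fin; nra.
have e4 : (0 < eps / 4)%R by rewrite divr_gt0.
have Jfoo : jump_integral m j f < +oo by apply: le_lt_trans Jf _; rewrite ltry.
have [N1 N10 N1P] := Lipc_recovery fL Jfoo e4.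
have [N2 N20 N2P] := extend_average_cvg x0 hM hG fsq e4.
exists f => //; exists (maxn N1 N2); first by rewrite leq_max N10.
move=> k; rewrite geq_max => /andP[k1 k2]; have k0 : (0 < k)%N by exact: leq_trans k1.
have cells := graph_cells x0 hM hG k0.
split.
  have -> : (fun x => E k (pi k f) x - u x)%R = (fun x => (E k (pi k f) x - f x) + (f x - u x))%R.
    by apply/funext => x; rewrite addrA subrK.
  apply: le_trans (sqint_young m _ _) _.
  - by apply: measurable_funB; [exact: (measurable_extend cells)|exact: fsq.1].
  - exact: measurable_funB fsq.1 usq.1.
  apply: (@le_trans _ _ (2%:E * (eps / 4)%:E + 2%:E * e%:E)).
    apply: leeD; apply: lee_wpmul2l => //.
    by rewrite sqintBC; exact: N2P k k2.
  by rewrite -!EFinM -EFinD lee_fin; lra.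
have sumle : discrete_sum m (V k) (U k) (C k) (pi k f) <= (J + eps)%:E.
  apply: le_trans (N1P k k1) _; apply: (@le_trans _ _ ((J + eps / 4 + eps / 4)%:E + (eps / 4)%:E)).
    exact: leeD2r.
  by rewrite -EFinD lee_fin; lra.
rewrite /discrete_energy asboolT; last first.
  by split; [exact: (average_L2V cells)|apply: le_lt_trans sumle _; rewrite ltry].
rewrite /energy asboolT// -JuE -EFinM -EFinD.
apply: (@le_trans _ _ (2^-1%:E * (J + eps)%:E)); first by apply: lee_wpmul2l.
by rewrite -EFinM lee_fin; lra.
Qed.

Lemma energy_recovery (u : M -> R) : L2 m u -> exists v : nat -> M -> R,
  [/\ forall k, (0 < k)%N -> L2V m (V k) (U k) (v k),
      strong_cvg m (fun k => E k (v k)) u &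
      limn_esup (fun k => discrete_energy m (V k) (U k) (C k) (v k)) <= energy m j u].
Proof.
move=> uL; have usq := iffLR (L2_square_integrable m u) uL.
have piL k g : (0 < k)%N -> square_integrable m g -> L2V m (V k) (U k) (pi k g).
  by move=> k0; apply: average_L2V; exact: (graph_cells x0 hM hG k0).
(* Outside the domain the energy is +oo, and the averages of [u] provide the strong convergence. *)
have [udom|nudom] := pselect (domain m j u); last first.
  exists (fun k => pi k u); split.
  - by move=> k k0; exact: piL.
  - apply: strong_cvg_sqint => eps eps0.
    have [N _ NP] := extend_average_cvg x0 hM hG usq eps0; exists N => // k /= Nk.
    by rewrite sqintBC; exact: NP k Nk.
  - by rewrite /energy asboolF ?leey.
(* At n = 0 only membership in L^2 is asked, so every k has a solution to start from; from n = 1 on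
   both tolerances are 1/n. *)
pose P n k v := ((0 < k)%N -> L2V m (V k) (U k) v) /\ ((0 < n)%N ->
  sqint m (fun x => E k v x - u x)%R <= (n%:R^-1)%:E /\
  discrete_energy m (V k) (U k) (C k) v <= energy m j u + (n%:R^-1)%:E).
have [|n n' k v nn' [vL vP]|n|v [vL vP]] := @diagonal_sequence _ P.
- by move=> k; exists (pi k u); split => // k0; exact: piL.
- split => // n0; have n'0 := leq_trans n0 nn'.
  have nV : (n'%:R^-1 <= n%:R^-1 :> R)%R by rewrite lef_pV2 ?posrE ?ltr0n// ler_nat.
  have [a b] := vP n'0; split; first by apply: le_trans a _; rewrite lee_fin.
  by apply: le_trans b _; apply: leeD => //; rewrite lee_fin.
- have [->|n0] := posnP n; first by exists 0%N => k _; exists (pi k u); split => // k0; exact: piL.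
  have nV : (0 < n%:R^-1 :> R)%R by rewrite invr_gt0 ltr0n.
  have [f fsq [N N0 NP]] := energy_recovery_step udom nV.
  by exists N => k Nk; exists (pi k f); split => [k0|_]; [exact: piL|exact: NP].
have inv_small (e : R) : (0 < e)%R -> exists2 n : nat, (0 < n)%N & (n%:R^-1 <= e)%R.
  move=> e0; exists (Num.bound e^-1).+1 => //; rewrite invf_ple ?posrE//.
  apply/ltW/(lt_le_trans (archi_boundP _)); first by rewrite invr_ge0 ltW.
  by rewrite ler_nat leqnSn.
exists v; split.
- by move=> k k0; apply: (vL k).1.
- apply: strong_cvg_sqint => eps /inv_small[n n0 ne]; have [N NP] := vP n.
  by exists N => // k /= Nk; apply: le_trans ((NP k Nk).2 n0).1 _; rewrite lee_fin.
- apply: limn_esup_le => eps /inv_small[n n0 ne]; have [N NP] := vP n; exists N => k Nk.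
  by apply: le_trans ((NP k Nk).2 n0).2 _; apply: leeD => //; rewrite lee_fin.
Qed.

End MoscoConvergence.

Theorem theorem4p6 (R : realType) (d : measure_display)
    (M : metricMeasurableType R d) (m : {measure set M -> \bar R}) (x0 : M)
    (V : nat -> set M) (B : nat -> rel M) (U : nat -> M -> set M)
    (C : nat -> M -> M -> R) (j : R.-ker M ~> M)
    (hM : metric_measure_space m)
    (hVBU : approximating_graphs m V B U)
    (hC : conductances V C)
    (hj : jump_kernel m j)
    (hA1a : A1a m x0 V B U C)
    (hA2i : A2i m j) (hA2ii : A2ii m j) (hA2iii : A2iii j)
    (hA3 : A3 m j)
    (hA4i_near : A4i_near m V U C) (hA4i_far : A4i_far m x0 V U C)
    (hA4ii : A4ii m V U C) (hA4iii : A4iii m x0 V U C j) :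
  mosco_convergent m V U C j.
Proof.
split; first exact: energy_le_liminf hM hVBU hC hA1a hA2ii hA2iii hA4ii hA4iii.
exact: energy_recovery hM hVBU hC hA1a hA2ii hA2iii hA4iii hA4i_near hA4i_far hA3.
Qed.
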